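(* Let $\mathcal{H}$ be an infinite-dimensional separable Hilbert space, let $A\in\mathcal{B}(\mathcal{H})$ be a contraction with $d_A=d_{A^*}=N<\infty$, and let $1\le k\le\infty$. Then $$\overline{\Lambda_k(A)}=\bigcap\left\{\overline{\Lambda_k(U)}: U\in\mathcal{B}(\mathcal{H}\oplus\mathbb{C}^N)\text{ is a unitary } N\text{-dilation of } A\right\}.$$
   Context: For a contraction $T$, $D_T=(I-T^*T)^{1/2}$, $\mathcal{D}_T=\overline{\operatorname{ran} D_T}$ and $d_T=\dim\mathcal{D}_T$ (the defect number). For $T\in\mathcal{B}(\mathcal{K})$ and $1\le k\le\infty$, $\Lambda_k(T)=\{\lambda\in\mathbb{C}: PTP=\lambda P \text{ for some orthogonal projection } P \text{ of rank } k\}$ (infinite rank if $k=\infty$). A unitary $N$-dilation of $A$ is a unitary operator $U$ on $\mathcal{H}\oplus\mathbb{C}^N$ with $P_{\mathcal{H}}U|_{\mathcal{H}}=A$. *)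

(* Defs.v *)
From HB Require Import structures.
From mathcomp Require Import all_boot all_order all_algebra.
From mathcomp Require Import classical_sets reals.
From mathcomp Require Import complex.
Set Implicit Arguments. Unset Strict Implicit. Unset Printing Implicit Defensive.
Import Order.TTheory GRing.Theory Num.Theory.
Local Open Scope ring_scope.

Section Hilbert.
Variable R : realType.
Local Notation C := R[i].
Variable V : lmodType C.
Variable ip : V -> V -> C.   (* inner product, linear in the first argument *)

Definition hnorm (x : V) : R := Num.sqrt (complex.Re (ip x x)).

Definition orthonormal (I : Type) (e : I -> V) : Prop :=
  (forall i, ip (e i) (e i) = 1) /\ (forall i j, i <> j -> ip (e i) (e j) = 0).

Definition fspan n (e : 'I_n -> V) : set V :=
  [set x | exists c : 'I_n -> C, x = \sum_(i < n) c i *: e i].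

Definition nclosure (A : set V) : set V :=
  [set x | forall eps : R, 0 < eps -> exists2 a, A a & hnorm (x - a) < eps].

Definition complete_ip : Prop :=
  forall u : nat -> V,
    (forall eps : R, 0 < eps -> exists M : nat, forall m n : nat,
        (M <= m)%N -> (M <= n)%N -> hnorm (u m - u n) < eps) ->
    exists l : V, forall eps : R, 0 < eps -> exists M : nat, forall n : nat,
        (M <= n)%N -> hnorm (u n - l) < eps.

Definition separable_ip : Prop :=
  exists d : nat -> V, forall (x : V) (eps : R), 0 < eps ->
    exists n : nat, hnorm (x - d n) < eps.

Definition is_sep_inf_hilbert : Prop :=
  [/\ (forall a x y z, ip (a *: x + y) z = a * ip x z + ip y z),
      (forall x y, ip y x = conjc (ip x y)),
      (forall x, 0 <= ip x x) /\ (forall x, ip x x = 0 -> x = 0),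
      complete_ip /\ separable_ip
    & (exists e : nat -> V, orthonormal e)].

Definition linearf (T : V -> V) : Prop :=
  forall a x y, T (a *: x + y) = a *: T x + T y.

Definition bounded_op (T : V -> V) : Prop :=
  linearf T /\ exists M : R, forall x, hnorm (T x) <= M * hnorm x.

Definition contraction (T : V -> V) : Prop :=
  bounded_op T /\ forall x, hnorm (T x) <= hnorm x.

Definition is_adjoint (T S : V -> V) : Prop :=
  forall x y, ip (T x) y = ip x (S y).

Definition is_defect_op (T D : V -> V) : Prop :=
  exists S, [/\ is_adjoint T S, bounded_op D, is_adjoint D D,
               (forall x, 0 <= ip (D x) x) & (forall x, D (D x) = x - S (T x))].

Definition defect_number_eq (T : V -> V) (n : nat) : Prop :=
  exists D, is_defect_op T D /\
    exists e : 'I_n -> V, orthonormal e /\ nclosure (range D) = fspan e.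

Definition orth_proj (P : V -> V) : Prop :=
  [/\ bounded_op P, is_adjoint P P & forall x, P (P x) = P x].

Definition proj_rank (P : V -> V) (k : option nat) : Prop :=
  match k with
  | Some n => exists e : 'I_n -> V, orthonormal e /\ range P = fspan e
  | None => exists e : nat -> V, orthonormal e /\ (forall i, range P (e i))
  end.

Definition higher_rank_nr (T : V -> V) (k : option nat) : set C :=
  [set l | exists P, [/\ orth_proj P, proj_rank P k & forall x, P (T (P x)) = l *: P x]].

End Hilbert.

Definition cclosure (R : realType) (A : set R[i]) : set R[i] :=
  [set z | forall eps : R, 0 < eps -> exists2 w, A w & `|z - w| < (eps%:C)%C].

Definition ip_sum (R : realType) (V : lmodType R[i]) (ip : V -> V -> R[i]) (N : nat)
  (u v : V * 'cV[R[i]]_N) : R[i] :=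
  ip u.1 v.1 + \sum_(i < N) u.2 i 0 * conjc (v.2 i 0).

Definition unitary_dilation (R : realType) (V : lmodType R[i]) (ip : V -> V -> R[i])
  (N : nat) (A : V -> V) (U : V * 'cV[R[i]]_N -> V * 'cV[R[i]]_N) : Prop :=
  [/\ bounded_op (ip_sum ip (N:=N)) U,
      (exists Us, [/\ is_adjoint (ip_sum ip (N:=N)) U Us,
                     (forall w, U (Us w) = w) & (forall w, Us (U w) = w)])
    & forall x, (U (x, 0)).1 = A x].

(* Main.v *)
Require Import Defs.
From HB Require Import structures.
From mathcomp Require Import all_boot all_order all_algebra.
From mathcomp Require Import boolp classical_sets reals.
From mathcomp Require Import complex spectral ring lra.
(* Makes [orthonormal] refer to [Defs] again; [spectral] shadows it. *)
Import Defs.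
Set Implicit Arguments.
Unset Strict Implicit.
Unset Printing Implicit Defensive.
Import Order.TTheory GRing.Theory Num.Theory.
Local Open Scope ring_scope.
Local Open Scope sesquilinear_scope.

(* If P is a projection on H, then P (+) 0 shows that Lambda_k(A) lies in
   Lambda_k(U) for every dilation U. For k = infinity the converse holds for a
   single U, because an infinite-rank range meets H in infinite dimension.

   Let k be finite and lambda in every closure of Lambda_k(U). If a is
   unimodular and a - A is invertible, some dilation U has an N-dimensional
   space of eigenvectors (h, v) for a which complements H; when Re(xi a) = c the
   form Re(xi U) - c does not change under adding such eigenvectors, so it is
   positive on a k-dimensional space iff Re(xi A) - c is. If a - A fails to be
   invertible at k points of an arc, approximate eigenvectors already give
   such a space. Hence Re(z(A - lambda)) + eps is positive on a k-dimensional
   space for all z and all eps > 0.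

   It remains to find mu near lambda with a k-dimensional space on which
   b = A - mu vanishes as a form. Let w be an essential value of the form of
   A - lambda, normalized to -1 (the case w = 0 is direct). Far out there are
   blocks on which the form is exactly a scalar d near -1. With b = H + i K
   relative to the direction of d, it is enough to find a k-dimensional space in
   a fixed finite-dimensional F with K = 0 and H >= 0: the value H is then
   cancelled by adding vectors of a scalar block. Such a space exists as soon as
   H + s K is positive on a k-dimensional subspace of F for every real s, by a
   normal form argument for the pencil. If K or - K is positive in dimension k
   one moves mu off the line through w and uses compactness of the circle;
   otherwise K has finite rank and the limits s -> +oo and s -> -oo are
   controlled by hand. *)

(** * Hermitian matrix pencils *)

(** The obstacle: positivity in dimension k is known for each direction separately, on a space that
    depends on the direction, and only up to eps, whereas [Lambda_k] asks for one space on which two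
    hermitian forms vanish together. The scalar blocks remove one of the two equations: vectors of
    value -1 turn H = 0 into H >= 0, so that a line of pencils H + s K has to be controlled with a
    single finite-dimensional F. Where positivity is an open condition on a compact set of
    directions, F comes from compactness. The ends of the line are the noncompact part. If - K or K
    is positive in dimension k, it is itself a strictly positive form to perturb from; if neither
    is, there is nothing to perturb from, and this is why finite rank is a separate case. Moreover a
    block must be orthogonal to F, so F is chosen before the exact value d of the block is known and
    must serve every d close to the essential value. Forms are handled through finite Gram matrices;
    completeness enters only to make a - A onto and to project when k is infinite. *)

Section Pencil.
Variable R : rcfType.
Local Notation C := R[i].
Local Notation "x %:C" := (real_complex _ x) : ring_scope.

Lemma conj_real_complex (x : R) : Num.conj (x%:C : C) = x%:C.
Proof. exact: conjc_real. Qed.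

Definition cdiag n (f : 'I_n -> R) : 'M[C]_n := diag_mx (\row_j (f j)%:C).

Lemma diag_sandwichE m p n (A : 'M[C]_(m, n)) (B : 'M[C]_(p, n)) (r : 'rV[C]_n) i j :
  (A *m diag_mx r *m B^t*) i j = \sum_l A i l * r 0 l * Num.conj (B j l).
Proof. by rewrite mul_mx_diag mxE; apply: eq_bigr => l _; rewrite !mxE. Qed.

Lemma diag_const_cdiag n : diag_mx (const_mx 1) = cdiag (fun=> 1) :> 'M[C]_n.
Proof. by congr diag_mx; apply/rowP => j; rewrite !mxE. Qed.

Lemma mulmx_ctr_diag m p n (A : 'M[C]_(m, n)) (B : 'M[C]_(p, n)) :
  A *m B^t* = A *m diag_mx (const_mx 1) *m B^t*.
Proof. by rewrite diag_const_mx mulmx1. Qed.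

Lemma diag_sandwich_disjoint m p n (A : 'M[C]_(m, n)) (B : 'M[C]_(p, n))
  (r : 'rV[C]_n) (J : {set 'I_n}) :
  (forall i j, j \in J -> A i j = 0) -> (forall i j, j \notin J -> B i j = 0) ->
  A *m diag_mx r *m B^t* = 0 /\ B *m diag_mx r *m A^t* = 0.
Proof.
move=> hA hB; split; apply/matrixP => i j; rewrite diag_sandwichE mxE big1 // => l _;
  have [lJ|lJ] := boolP (l \in J).
- by rewrite hA // !mul0r.
- by rewrite (hB _ _ lJ) rmorph0 mulr0.
- by rewrite (hA _ _ lJ) rmorph0 mulr0.
- by rewrite hB // !mul0r.
Qed.

(* Put t = - h / kap. The j-th value h + s kap is positive for s > t j if kap j > 0
   and for s < t j if kap j < 0. One removes an index with kap = 0 < h, or else a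
   pair a, b with kap b < 0 < kap a and t b - t a > 0 minimal: by minimality the
   count on ]t a, t b[ exceeds the count at t a, so removing both loses only one. *)
Lemma pairing_step n (h kap : 'I_n -> R) k (J : {set 'I_n}) :
  (forall s, (k < #|[set j in J | (0 < h j + s * kap j)%R] |)%N) ->
  exists (v : 'rV[C]_n) (J' : {set 'I_n}),
    [/\ J' \subset J /\ (forall j, j \notin J :\: J' -> v 0 j = 0),
      v *m v^t* = 1%:M, v *m cdiag kap *m v^t* = 0,
      0 <= (v *m cdiag h *m v^t*) 0 0
    & forall s, (k <= #|[set j in J' | (0 < h j + s * kap j)%R] |)%N].
Proof.
move=> hJ; set A := fun s => [set j in J | 0 < h j + s * kap j].
have [j /and3P[jJ /eqP kj hj]|nosingle] := pickP [pred j | [&& j \in J, kap j == 0 & 0 < h j]].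
  exists (delta_mx 0 j), (J :\ j); split.
  - split; first exact: finset.subD1set.
    move=> i; rewrite !inE mxE eqxx /=; case: eqP => [->|] //=.
    by rewrite jJ.
  - rewrite mulmx_ctr_diag; apply/matrixP => i i'; rewrite !ord1 diag_sandwichE (bigD1 j) //= big1.
      by rewrite !mxE !eqxx !mul1r rmorph1 addr0.
    by move=> l lj; rewrite !mxE (negPf lj) andbF !mul0r.
  - apply/matrixP => i i'; rewrite !ord1 diag_sandwichE (bigD1 j) //= big1.
      by rewrite !mxE kj rmorph0 mulr0 mul0r addr0.
    by move=> l lj; rewrite !mxE (negPf lj) andbF !mul0r.
  - rewrite diag_sandwichE (bigD1 j) //= big1.
      by rewrite !mxE !eqxx !mul1r rmorph1 mulr1 addr0 ler0c ltW.
    by move=> l lj; rewrite !mxE (negPf lj) andbF !mul0r.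
  - move=> s; have := hJ s; rewrite (cardsD1 j) => H.
    rewrite -ltnS; apply: (leq_trans H); rewrite -add1n leq_add ?leq_b1 //.
    by apply/subset_leq_card/fintype.subsetP => i; rewrite !inE => /and3P[-> -> ->].
pose t j := - h j / kap j.
have tE j : kap j != 0 -> h j = - t j * kap j.
  by move=> kj; rewrite /t; field.
have plusP s j : 0 < kap j -> (0 < h j + s * kap j) = (t j < s).
  move=> kj; rewrite (tE j) ?gt_eqF // -mulrDl pmulr_lgt0 // addrC subr_gt0 //.
have minusP s j : kap j < 0 -> (0 < h j + s * kap j) = (s < t j).
  move=> kj; rewrite (tE j) ?lt_eqF // -mulrDl nmulr_lgt0 // addrC subr_lt0 //.
have zerP s j : j \in J -> kap j = 0 -> (0 < h j + s * kap j) = false.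
  move=> jJ kj; rewrite kj mulr0 addr0; have := nosingle j.
  by rewrite /= jJ kj eqxx /= => ->.
pose P := [pred p : 'I_n * 'I_n | [&& p.1 \in J, p.2 \in J, 0 < kap p.1, kap p.2 < 0 & t p.1 < t p.2]].
have [p0 Pp0|nopair] := pickP P; last first.
  (* Without a pair, every threshold of an index with kap > 0 is at least every threshold of an
     index with kap < 0. The largest of the latter, or failing any the smallest of the former, is
     then an s that counts no index. *)
  exfalso; suff [s As0] : exists s, A s = finset.set0.
    by have := hJ s; rewrite -/(A s) As0 cards0.
  have [jm /andP[jmJ jmn]|nominus] := pickP [pred j | (j \in J) && (kap j < 0)].
    have [i /andP[iJ ineg] imax] := @arg_maxP _ _ _ jm [pred j | (j \in J) && (kap j < 0)] t (introT andP (conj jmJ jmn)).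
    exists (t i); apply/finset.setP => j; rewrite !inE; apply/negbTE/negP => /andP[jJ].
    case: (ltgtP (kap j) 0) => kj.
    - by rewrite minusP // ltNge; apply/negP; rewrite negbK; apply: imax; rewrite /= jJ.
    - rewrite plusP // => tji; have := nopair (j, i).
      by rewrite /= jJ iJ kj ineg tji.
    - by rewrite zerP.
  have [jm /andP[jmJ jmn]|noplus] := pickP [pred j | (j \in J) && (0 < kap j)].
    have [i /andP[iJ ineg] imax] := @arg_minP _ _ _ jm [pred j | (j \in J) && (0 < kap j)] t (introT andP (conj jmJ jmn)).
    exists (t i); apply/finset.setP => j; rewrite !inE; apply/negbTE/negP => /andP[jJ].
    case: (ltgtP (kap j) 0) => kj.
    - by have := nominus j; rewrite /= jJ kj.
    - by rewrite plusP // ltNge; apply/negP; rewrite negbK; apply: imax; rewrite /= jJ.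
    - by rewrite zerP.
  exists 0; apply/finset.setP => j; rewrite !inE; apply/negbTE/negP => /andP[jJ].
  case: (ltgtP (kap j) 0) => kj.
  - by have := nominus j; rewrite /= jJ kj.
  - by have := noplus j; rewrite /= jJ kj.
  - by rewrite zerP.
have [[a b] /= /and5P[aJ bJ ka kb tab] minab] := @arg_minP _ _ _ p0 P (fun p => t p.2 - t p.1) Pp0.
have ab : a != b by apply: contraTneq ka => ->; rewrite -leNgt ltW.
pose D := kap a - kap b.
have D0 : 0 < D by rewrite subr_gt0 (lt_trans kb).
(* Weights with al^2 + be^2 = 1 and al^2 kap a + be^2 kap b = 0; the value of h becomes kap a (- kap
   b) (t b - t a) / D. *)
pose al := Num.sqrt (- kap b / D); pose be := Num.sqrt (kap a / D).
have al2 : al ^+ 2 = - kap b / D by rewrite sqr_sqrtr //; apply: divr_ge0; rewrite ?oppr_ge0 ltW.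
have be2 : be ^+ 2 = kap a / D by rewrite sqr_sqrtr //; apply: divr_ge0; rewrite ltW.
pose v : 'rV[C]_n := \row_j (if j == a then al else if j == b then be else 0)%:C.
have vE (r : 'I_n -> R) : (v *m cdiag r *m v^t*) 0 0 = (al ^+ 2 * r a + be ^+ 2 * r b)%:C.
  rewrite diag_sandwichE (bigD1 a) //= (bigD1 b) //=; last by rewrite eq_sym.
  rewrite big1 ?addr0.
    rewrite !mxE !eqxx (eq_sym b a) (negPf ab) !conj_real_complex -!rmorphM -rmorphD /=.
    by congr (_ %:C); ring.
  by move=> l /andP[la lb]; rewrite !mxE (negPf la) (negPf lb) !mul0r.
exists v, (J :\ a :\ b); split.
- split; first by apply: (fintype.subset_trans (finset.subD1set _ _)); apply: finset.subD1set.
  move=> j; rewrite !inE mxE; have [->|ja] := eqVneq j a; first by rewrite aJ andbF.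
  by have [->|jb] := eqVneq j b; rewrite ?bJ.
- have := vE (fun=> 1); rewrite !mulr1 => e.
  apply/matrixP => i i'; rewrite !ord1 [RHS]mxE eqxx mulr1n.
  rewrite mulmx_ctr_diag diag_const_cdiag.
  rewrite e al2 be2 -mulrDl [_ + kap a]addrC divff ?gt_eqF //.
- apply/matrixP => i i'; rewrite !ord1 vE mxE al2 be2.
  by rewrite -[RHS](rmorph0 (real_complex R)); congr (_ %:C); field; rewrite gt_eqF.
- rewrite vE ler0c al2 be2 (tE a) ?gt_eqF // (tE b) ?lt_eqF //.
  rewrite (_ : _ + _ = (kap a * (- kap b) * (t b - t a)) / D); last by field; rewrite gt_eqF.
  apply: divr_ge0 (ltW D0); rewrite mulr_ge0 ?subr_ge0 ?(ltW tab) //.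
  by apply: mulr_ge0; rewrite ?oppr_ge0 ltW.
- move=> s; have -> : [set j in J :\ a :\ b | 0 < h j + s * kap j] = A s :\ a :\ b.
    by apply/finset.setP => j; rewrite !inE !andbA.
  have drop1 c (B : {set 'I_n}) : (k < #|B|)%N -> (k <= #|B :\ c|)%N.
    rewrite (cardsD1 c) => H; rewrite -ltnS; apply: (leq_trans H).
    by rewrite -add1n leq_add ?leq_b1.
  have [sa|sa] := leP s (t a).
    have -> : A s :\ a = A s.
      by apply/finset.setDidPl; rewrite disjoint_sym disjoints1 !inE aJ plusP //= ltNge sa.
    exact: (drop1 _ _ (hJ s)).
  have [sb|sb] := leP (t b) s.
    have -> : A s :\ a :\ b = A s :\ a.
      by apply/finset.setDidPl; rewrite disjoint_sym disjoints1 !inE bJ minusP //= ltNge sb !andbF.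
    exact: (drop1 _ _ (hJ s)).
  apply: drop1; apply: (leq_trans (hJ (t a))); apply/subset_leq_card/fintype.subsetP => j.
  rewrite !inE; case: eqP => [->|_] /andP[jJ]; first by rewrite plusP // ltxx.
  rewrite jJ /=; case: (ltgtP (kap j) 0) => kj.
  - rewrite !minusP // => taj; have := minab (a, j).
    rewrite /= aJ jJ ka kj taj /= lerD2r => /(_ isT); exact: lt_le_trans.
  - by rewrite !plusP // => /lt_trans; apply.
  - by rewrite zerP.
Qed.

(** The rows have disjoint supports, hence are orthogonal for all diagonal forms at once; the clause
    on [J] carries this through the induction. *)
Lemma pairing n (h kap : 'I_n -> R) k (J : {set 'I_n}) :
  (forall s, (k <= #|[set j in J | (0 < h j + s * kap j)%R] |)%N) ->
  exists M : 'M[C]_(k, n),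
    [/\ (forall i j, j \notin J -> M i j = 0), M *m M^t* = 1%:M,
      M *m cdiag kap *m M^t* = 0
    & exists2 d : 'rV[C]_k, (forall i, 0 <= d 0 i) & M *m cdiag h *m M^t* = diag_mx d].
Proof.
elim: k J => [|k IHk] J hJ.
  exists 0; split; try by [move=> [] | apply/matrixP => -[]].
  by exists 0; [move=> [] | apply/matrixP => -[]].
have [v [J' [[sJ' vJ] v1 vk vh /IHk [M [MJ M1 Mk [d d0 Mh]]]]]] := pairing_step hJ.
have vJ' : forall i j, j \in J' -> v i j = 0.
  by move=> i j jJ'; rewrite ord1 vJ // !inE jJ'.
pose dis r := diag_sandwich_disjoint r vJ' MJ.
have colJ (i : 'I_(1 + k)) j : j \notin J -> col_mx v M i j = 0.
  move=> jJ; case: (split_ordP i) => i' ->.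
    by rewrite col_mxEu ord1 vJ // !inE (negPf jJ) andbF.
  by rewrite col_mxEd MJ //; apply: contra jJ => /(fintype.subsetP sJ').
have row0 (i : 'I_(1 + k)) : 0 <= row_mx (v *m cdiag h *m v^t*) d 0 i.
  by case: (split_ordP i) => i' ->; rewrite ?row_mxEl ?row_mxEr ?ord1.
have ctrX : (col_mx v M)^t* = row_mx (v^t*) (M^t*) by rewrite tr_col_mx map_row_mx.
have X1 : col_mx v M *m (col_mx v M)^t* = 1%:M.
  rewrite ctrX mul_col_row v1 M1 (mulmx_ctr_diag v M) (mulmx_ctr_diag M v).
  by have [-> ->] := dis (const_mx 1); rewrite -scalar_mx_block.
have Xk : col_mx v M *m cdiag kap *m (col_mx v M)^t* = 0.
  rewrite ctrX mul_col_mx mul_col_row vk Mk.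
  by have [-> ->] := dis (\row_j (kap j)%:C); rewrite block_mx0.
have Xh : col_mx v M *m cdiag h *m (col_mx v M)^t* = diag_mx (row_mx (v *m cdiag h *m v^t*) d).
  rewrite ctrX mul_col_mx mul_col_row Mh.
  have [-> ->] := dis (\row_j (h j)%:C); rewrite diag_mx_row; congr block_mx.
  by apply/matrixP => i j; rewrite !ord1 [RHS]mxE mulr1n.
by exists (col_mx v M); split => //; exists (row_mx (v *m cdiag h *m v^t*) d).
Qed.

End Pencil.

(** * Eigenvectors of a hermitian pencil *)

Section PencilReduction.
Variable R : rcfType.
Local Notation C := R[i].
Local Notation "x %:C" := (real_complex _ x) : ring_scope.

Definition mxquad n (Q : 'M[C]_n) (u : 'rV[C]_n) : C := (u *m Q *m u^t*) 0 0.

Definition posidx n k (Q : 'M[C]_n) : Prop :=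
  exists m, exists2 S : 'M[C]_(m, n), (k <= \rank S)%N &
    forall u : 'rV_n, (u <= S)%MS -> u != 0 -> 0 < mxquad Q u.

Lemma ctrmxM m n p (A : 'M[C]_(m, n)) (B : 'M[C]_(n, p)) : (A *m B)^t* = B^t* *m A^t*.
Proof. by rewrite trmx_mul map_mxM. Qed.

Lemma mxquad_comp m n (Q : 'M[C]_n) (E : 'M[C]_(m, n)) v :
  mxquad (E *m Q *m E^t*) v = mxquad Q (v *m E).
Proof. by rewrite /mxquad ctrmxM !mulmxA. Qed.

(** Half of Sylvester's law of inertia: a positive subspace meets the space where all coordinates of
    positive weight vanish only in 0, so these coordinates embed it. *)
Lemma posidx_diag m n k (Q : 'M[C]_n) (X : 'M[C]_(m, n)) (f : 'I_m -> R) :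
  row_full X -> X *m Q *m X^t* = cdiag f -> posidx k Q ->
  (k <= #|[set j | (0 < f j)%R]|)%N.
Proof.
move=> Xu XQ [p [S rS posS]]; set P := [set j | _].
pose T : 'M[C]_(m, #|P|) := \matrix_(i, j) (i == enum_val j)%:R.
pose Z := pinvmx X *m T.
apply: (leq_trans rS); apply: leq_trans (rank_leq_col (S *m Z)).
suff /eqP/mxrank_injP -> : (S :&: kermx Z)%MS = 0 by [].
apply/eqP/rowV0P => u; rewrite sub_capmx => /andP[uS /sub_kermxP uZ].
apply/eqP/negPn/negP => u0; have := posS u uS u0.
pose y := u *m pinvmx X.
have -> : mxquad Q u = mxquad (cdiag f) y by rewrite -XQ mxquad_comp mulmxKpV ?submx_full.
suff h : mxquad (cdiag f) y <= 0 by rewrite le_gtF.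
rewrite /mxquad diag_sandwichE; apply: sumr_le0 => l _.
have [fl|fl] := ltP 0 (f l).
  have lP : l \in P by rewrite inE.
  suff -> : y 0 l = 0 by rewrite !mul0r.
  have TE i : T i (enum_rank_in lP l) = (i == l)%:R by rewrite mxE enum_rankK_in.
  move/rowP: uZ => /(_ (enum_rank_in lP l)); rewrite /Z mulmxA -/y mxE [RHS]mxE (bigD1 l) //= big1.
    by rewrite TE eqxx mulr1 addr0.
  by move=> i il; rewrite TE (negPf il) mulr0.
rewrite mulrAC -normCK mulr_ge0_le0 ?exprn_ge0 //.
by rewrite mxE; move: fl; rewrite -lecR.
Qed.

(** [ab] is a homogeneous eigenvalue; (0, 1) is the infinite one, taken when K is singular. *)
Lemma pencil_eigenvector n (H K : 'M[C]_n) : (0 < n)%N ->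
  exists x : 'rV[C]_n, exists ab : C * C,
    [/\ x != 0, ab != 0 & x *m (ab.1 *: H + ab.2 *: K) = 0].
Proof.
move=> n0; have [Ku|Ku] := boolP (K \in unitmx).
  have [a /eigenvalueP[x xe x0]] := eigenvalue_closed (H *m invmx K) n0.
  exists x, (1, - a); split=> //; first by rewrite xpair_eqE oner_eq0.
  have xH : x *m H = a *: (x *m K).
    by rewrite -[x *m H](mulmxKV Ku) -[x *m H *m _]mulmxA xe -scalemxAl.
  by rewrite /= scale1r mulmxDr xH -scalemxAr scaleNr subrr.
have /rowV0Pn [x xK x0] : kermx K != 0.
  by rewrite kermx_eq0 row_free_unit.
exists x, (0, 1); split=> //; first by rewrite xpair_eqE oner_eq0 andbF.
by rewrite /= scale0r scale1r add0r; apply/sub_kermxP.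
Qed.

(** Conjugating the eigenvalue equation makes the two columns proportional, so the vectors
    orthogonal to x for the whole pencil form [kermx phi]. That phi is itself one of the columns
    turns isotropy of x into x phi = 0. *)
Lemma pencil_kernel n (H K : 'M[C]_n) (x : 'rV[C]_n) (ab : C * C) :
  H^t* = H -> K^t* = K -> ab != 0 -> x *m (ab.1 *: H + ab.2 *: K) = 0 ->
  exists (phi : 'cV[C]_n) (c : C * C),
    [/\ H *m x^t* = c.1 *: phi, K *m x^t* = c.2 *: phi,
        c != 0 & phi = H *m x^t* \/ phi = K *m x^t*].
Proof.
case: ab => a b /= Hh Kh ab0 xe.
have e : Num.conj a *: (H *m x^t*) + Num.conj b *: (K *m x^t*) = 0.
  move/(congr1 (fun M => M^t*)): xe; rewrite ctrmxM trmx0 map_mx0.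
  by rewrite [_^T]linearD /= !linearZ /= map_mxD !map_mxZ Hh Kh mulmxDl -!scalemxAl.
have [a0|a0] := eqVneq a 0.
  have b0 : b != 0 by apply: contraNneq ab0 => ->; rewrite a0.
  exists (H *m x^t*), (1, 0); split=> /=; rewrite ?scale1r ?scale0r //.
  - move: e; rewrite a0 rmorph0 scale0r add0r => /eqP.
    by rewrite scaler_eq0 fmorph_eq0 (negPf b0) /= => /eqP.
  - by rewrite xpair_eqE oner_eq0.
  - by left.
exists (K *m x^t*), (- (Num.conj b / Num.conj a), 1); split=> /=; rewrite ?scale1r //.
- move/eqP: e; rewrite addr_eq0 => /eqP e.
  apply: (@scalerI _ _ (Num.conj a)); first by rewrite fmorph_eq0.
  by rewrite e scalerA mulrN mulrC divfK ?fmorph_eq0 // scaleNr.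
- by rewrite xpair_eqE oner_eq0 andbF.
- by right.
Qed.

End PencilReduction.

Section PencilIsotropic.
Variable R : rcfType.
Local Notation C := R[i].
Local Notation "x %:C" := (real_complex _ x) : ring_scope.

Definition isotropic_eigenvector n (H K : 'M[C]_n) (x : 'rV[C]_n) : Prop :=
  [/\ x != 0, mxquad H x = 0, mxquad K x = 0
    & exists2 ab : C * C, ab != 0 & x *m (ab.1 *: H + ab.2 *: K) = 0].

Lemma herm_real_entry (z : C) : Num.conj z = z -> (complex.Re z)%:C = z.
Proof. by move=> e; apply: RRe_real; apply/CrealP. Qed.

Lemma ctr_comp m n (Q : 'M[C]_n) (E : 'M[C]_(m, n)) :
  Q^t* = Q -> (E *m Q *m E^t*)^t* = E *m Q *m E^t*.
Proof. by move=> Qh; rewrite !ctrmxM trmxCK Qh mulmxA. Qed.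

Lemma herm_quad_real n (Q : 'M[C]_n) (x : 'rV[C]_n) : Q^t* = Q ->
  (complex.Re (mxquad Q x))%:C = mxquad Q x.
Proof.
move=> Qh; apply: herm_real_entry.
by have /(congr1 (fun M : 'M_1 => M 0 0)) := ctr_comp x Qh; rewrite mxE mxE.
Qed.

(** An eigenvector x of the pencil is not isotropic for both forms, so x phi is nonzero and the
    space is the sum of x and [kermx phi], orthogonal for both forms; induction diagonalizes the
    second summand. *)
Lemma simultaneous_diag n (H K : 'M[C]_n) :
  H^t* = H -> K^t* = K -> (forall x, ~ isotropic_eigenvector H K x) ->
  exists m, exists2 X : 'M[C]_(m, n), row_free X /\ row_full X &
    exists h kap : 'I_m -> R,
      X *m H *m X^t* = cdiag h /\ X *m K *m X^t* = cdiag kap.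
Proof.
elim/ltn_ind: n => n IHn in H K *; move=> Hh Kh noiso.
have [n0|n0] := posnP n.
  subst n; exists 0, 0; first by rewrite /row_free /row_full mxrank0.
  by exists (fun=> 0), (fun=> 0); split; apply/matrixP => -[].
have [x [ab [x0 ab0 xe]]] := pencil_eigenvector H K n0.
have [phi [c [cH cK c0 phiE]]] := pencil_kernel Hh Kh ab0 xe.
have qE (Q : 'M_n) d : Q *m x^t* = d *: phi -> mxquad Q x = d * (x *m phi) 0 0.
  by move=> e; rewrite /mxquad -mulmxA e -scalemxAr mxE.
have xphi : (x *m phi) 0 0 != 0.
  apply/eqP => e; apply: (noiso x); split=> //; try by exists ab.
    by rewrite (qE _ _ cH) e mulr0.
  by rewrite (qE _ _ cK) e mulr0.
have phi0 : phi != 0 by apply: contraNneq xphi => ->; rewrite mulmx0 mxE.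
have rphi : \rank phi = 1%N.
  by apply/eqP; rewrite eqn_leq rank_leq_col lt0n mxrank_eq0.
pose E := row_base (kermx phi).
have Ephi : E *m phi = 0 by apply/sub_kermxP; rewrite eq_row_base.
have rE : \rank (kermx phi) = n.-1 by rewrite mxrank_ker rphi subn1.
have rankE : \rank E = n.-1 by rewrite eq_row_base.
have rx : \rank x = 1%N by rewrite rank_rV x0.
have rxE : \rank (x + E)%MS = n.
  have := mxrank_sum_cap x E; rewrite rx rankE add1n prednK //.
  suff -> : (x :&: E)%MS = 0 by rewrite mxrank0 addn0.
  apply/eqP/rowV0P => u; rewrite sub_capmx => /andP[/sub_rVP[a ->]].
  move=> /submxP[w aw]; move/(congr1 (fun M => (M *m phi) 0 0)): aw.
  rewrite -mulmxA Ephi mulmx0 -scalemxAl [LHS]mxE [RHS]mxE => /eqP.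
  by rewrite mulf_eq0 (negPf xphi) orbF => /eqP ->; rewrite scale0r.
have Ehh := ctr_comp E Hh; have Ekh := ctr_comp E Kh.
have kill (Q : 'M_n) d : Q *m x^t* = d *: phi -> E *m Q *m x^t* = 0.
  by move=> e; rewrite -mulmxA e -scalemxAr Ephi scaler0.
have kill' (Q : 'M_n) : Q^t* = Q -> E *m Q *m x^t* = 0 -> x *m Q *m E^t* = 0.
  move=> Qh /(congr1 (fun M => M^t*)); rewrite !ctrmxM trmxCK Qh mulmxA.
  by rewrite trmx0 map_mx0.
(* An isotropic eigenvector of the restriction is one of the whole pencil, since both forms also
   vanish between [kermx phi] and x. *)
have EnoIso v : ~ isotropic_eigenvector (E *m H *m E^t*) (E *m K *m E^t*) v.
  case=> v0 vH vK [ab' ab'0 ve]; apply: (noiso (v *m E)); split.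
  - by rewrite mulmx_free_eq0 ?row_base_free.
  - by rewrite -(mxquad_comp H E v) vH.
  - by rewrite -(mxquad_comp K E v) vK.
  - exists ab' => //; set Q := _ + _.
    have Qx : v *m E *m Q *m x^t* = 0.
      rewrite /Q mulmxDr mulmxDl -!scalemxAr -!scalemxAl.
      by rewrite -!(mulmxA v) (kill _ _ cH) (kill _ _ cK) mulmx0 !scaler0 addr0.
    have QE : v *m E *m Q *m E^t* = 0.
      move: ve; rewrite /Q !mulmxDr mulmxDl -!scalemxAr -!scalemxAl !mulmxA.
      by [].
    have : v *m E *m Q *m (col_mx x E)^t* = 0.
      by rewrite tr_col_mx map_row_mx mul_mx_row Qx QE row_mx0.
    move/(congr1 (fun M => M^t*)); rewrite ctrmxM trmxCK trmx0 map_mx0 => e.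
    have /row_fullP[Y YE] : row_full (col_mx x E).
      by rewrite /row_full -addsmxE rxE.
    have /(congr1 (fun M => M^t*)) : (v *m E *m Q)^t* = 0.
      by rewrite -[LHS]mul1mx -YE -(mulmxA Y) e mulmx0.
    by rewrite trmxCK trmx0 map_mx0.
have ltn : (\rank (kermx phi) < n)%N by rewrite rE prednK.
have [m [X1 [X1free X1full] [h [kap [X1h X1k]]]]] := IHn _ ltn _ _ Ehh Ekh EnoIso.
have mE : m = n.-1.
  by rewrite -rE; move: X1free X1full => /eqP e1 /eqP e2; exact: etrans (esym e1) e2.
have rX : \rank (col_mx x (X1 *m E)) = n.
  have eqx : (x + X1 *m E :=: x + E)%MS by apply: adds_eqmx => //; apply: eqmxMfull.
  by rewrite -addsmxE eqx.
exists (1 + m)%N, (col_mx x (X1 *m E)).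
  by rewrite /row_free /row_full rX mE add1n prednK.
have blocks (Q : 'M_n) d f : Q^t* = Q -> Q *m x^t* = d *: phi ->
    X1 *m (E *m Q *m E^t*) *m X1^t* = cdiag f ->
    exists g : 'I_(1 + m) -> R,
      col_mx x (X1 *m E) *m Q *m (col_mx x (X1 *m E))^t* = cdiag g.
  move=> Qh Qx X1Q.
  exists (fun i => match split i with inl _ => complex.Re (mxquad Q x) | inr j => f j end).
  rewrite tr_col_mx map_row_mx mul_col_mx mul_col_row ctrmxM.
  have -> : x *m Q *m (E^t* *m X1^t*) = 0.
    by rewrite mulmxA (kill' _ Qh (kill _ _ Qx)) mul0mx.
  have -> : X1 *m E *m Q *m x^t* = 0.
    by rewrite -!(mulmxA X1) (kill _ _ Qx) mulmx0.
  have -> : X1 *m E *m Q *m (E^t* *m X1^t*) = cdiag f by rewrite -X1Q !mulmxA.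
  have -> : x *m Q *m x^t* = diag_mx (const_mx (mxquad Q x)).
    by rewrite diag_const_mx -mx11_scalar.
  rewrite -diag_mx_row; congr diag_mx; apply/rowP => i.
  by rewrite mxE [RHS]mxE; case: splitP => j _; rewrite !mxE ?herm_quad_real.
have [g1 g1E] := blocks _ _ _ Hh cH X1h.
have [g2 g2E] := blocks _ _ _ Kh cK X1k.
by exists g1, g2.
Qed.

End PencilIsotropic.

Section PencilNeutral.
Variable R : rcfType.
Local Notation C := R[i].
Local Notation "x %:C" := (real_complex _ x) : ring_scope.

(* [kermx phi] is the common orthogonal of x for the pencil; it has codimension at
   most 1, contains x, and Q is unchanged along x. *)
Lemma posidx_isotropic_reduce n k (Q : 'M[C]_n) (x : 'rV[C]_n) (phi : 'cV[C]_n) (c : C) :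
  Q^t* = Q -> Q *m x^t* = c *: phi -> x != 0 -> x *m phi = 0 -> posidx k.+1 Q ->
  let E := row_base (kermx phi :\: x)%MS in posidx k (E *m Q *m E^t*).
Proof.
move=> Qh Qx x0 xphi [m [S rS posS]] E; set D := (kermx phi :\: x)%MS in E *.
have DF : (D <= kermx phi)%MS by exact: diffmxSl.
have xF : (x <= kermx phi)%MS by apply/sub_kermxP.
have kill u : (u <= kermx phi)%MS -> u *m Q *m x^t* = 0.
  by move=> /sub_kermxP uphi; rewrite -mulmxA Qx -scalemxAr uphi scaler0.
have kill' (u : 'rV_n) : (u <= kermx phi)%MS -> x *m Q *m u^t* = 0.
  move=> /kill /(congr1 (fun M => M^t*)); rewrite !ctrmxM trmxCK Qh mulmxA.
  by rewrite trmx0 map_mx0.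
(* [proj_mx] takes square matrices, hence [<<x>>] in place of the row x. *)
have capDx : (D :&: <<x>> = 0)%MS.
  apply/eqP; rewrite -submx0; have := capmx_diff (kermx phi) x; rewrite /D => e.
  apply: submx_trans (_ : (D :&: x <= 0)%MS); first by rewrite capmxS // genmxE.
  by rewrite submx0 -/D; apply/eqP; rewrite /D e.
have FDx : (kermx phi <= D + <<x>>)%MS.
  rewrite -(addsmx_diff_cap_eq (kermx phi) x) addsmxS //.
  by rewrite genmxE capmxSr.
pose S1 := (S :&: kermx phi)%MS.
have rS1 : (k <= \rank S1)%N.
  have := mxrank_mul_ker S phi; have := rank_leq_col (S *m phi).
  rewrite /S1 => r1 e; move: rS; rewrite -e => H.
  by rewrite -ltnS; apply: leq_trans H _; rewrite -[X in (_ <= X)%N]add1n leq_add2r.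
pose f := proj_mx D <<x>>%MS *m pinvmx E.
have decomp (u : 'rV_n) : (u <= kermx phi)%MS ->
    exists a : C, u = u *m proj_mx D <<x>>%MS + a *: x.
  move=> uF; have uDx := submx_trans uF FDx.
  have := add_proj_mx capDx uDx => e.
  have /sub_rVP[a ae] : (u *m proj_mx <<x>>%MS D <= x)%MS.
    by rewrite -(genmxE x) proj_mx_sub.
  by exists a; rewrite -ae.
have projE (u : 'rV_n) : u *m f *m E = u *m proj_mx D <<x>>%MS.
  by rewrite /f mulmxA mulmxKpV // eq_row_base proj_mx_sub.
have quadE (u : 'rV_n) : (u <= kermx phi)%MS -> mxquad Q u = mxquad Q (u *m f *m E).
  move=> uF; rewrite projE; have [a ue] := decomp u uF.
  have pF : (u *m proj_mx D <<x>>%MS <= kermx phi)%MS.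
    exact: submx_trans (proj_mx_sub _ _ _) DF.
  move: ue pF; set p := u *m proj_mx _ _ => -> pF.
  rewrite /mxquad linearD map_mxD linearZ map_mxZ /= mulmxDl mulmxDl !mulmxDr -!scalemxAl -!scalemxAr.
  by rewrite kill // kill' // kill // !scaler0 !addr0.
have inj : \rank (S1 *m f) = \rank S1.
  apply/mxrank_injP/rowV0P => u; rewrite sub_capmx => /andP[uS1 /sub_kermxP uf].
  move: uS1; rewrite sub_capmx => /andP[uS uF].
  apply/eqP/negPn/negP => u0; have := posS u uS u0.
  by rewrite quadE // uf mul0mx /mxquad !mul0mx mxE ltxx.
exists _, (S1 *m f); first by rewrite inj.
move=> w /submxP[z we] w0; rewrite mxquad_comp we mulmxA.
have zS1 : (z *m S1 <= S1)%MS by exact: submxMl.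
move: (zS1); rewrite {2}/S1 sub_capmx => /andP[zS zF].
rewrite -quadE //; apply: posS => //.
by apply: contraNneq w0 => e; rewrite we mulmxA e mul0mx.
Qed.

(* Induction on n: an eigenvector of the pencil that is isotropic for both forms is
   put in L and one passes to its orthogonal modulo itself; if there is none, the
   pencil is diagonalizable by congruence and [pairing] applies. *)
Theorem pencil_neutral n k (H K : 'M[C]_n) :
  H^t* = H -> K^t* = K -> (forall s : R, posidx k (H + s%:C *: K)) ->
  exists2 L : 'M[C]_(k, n), row_free L &
    L *m K *m L^t* = 0 /\
    exists2 d : 'rV[C]_k, (forall i, 0 <= d 0 i) & L *m H *m L^t* = diag_mx d.
Proof.
elim/ltn_ind: n => n IHn in k H K *; move=> Hh Kh pos.
case: k pos => [|k] pos.
  exists 0; first by rewrite /row_free mxrank0.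
  split; first by apply/matrixP => -[].
  by exists 0; [move=> [] | apply/matrixP => -[]].
have [[x [x0 Hx Kx [ab ab0 xe]]]|noiso] := pselect (exists x, isotropic_eigenvector H K x); last first.
  have [|m [X [Xfree Xfull] [h [kap [Xh Xk]]]]] := simultaneous_diag Hh Kh.
    by move=> x xi; apply: noiso; exists x.
  have cnt s : (k.+1 <= #|[set j in [set: 'I_m] | (0 < h j + s * kap j)%R]|)%N.
    have e : X *m (H + s%:C *: K) *m X^t* = cdiag (fun j => h j + s * kap j).
      rewrite mulmxDr mulmxDl -scalemxAr -scalemxAl Xh Xk -linearZ -linearD /=.
      by congr diag_mx; apply/rowP => j; rewrite !mxE rmorphD rmorphM.
    have := posidx_diag Xfull e (pos s); congr (_ <= _)%N; apply: eq_card => j.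
    by rewrite !inE.
  have [M [_ M1 Mk [d d0 Mh]]] := pairing cnt.
  exists (M *m X).
    rewrite /row_free mxrankMfree //; apply/eqP/mxrank_unitary.
    by apply/unitarymxP.
  rewrite ctrmxM !mulmxA -!(mulmxA M) Xk mulmxA Mk; split=> //.
  by exists d => //; rewrite Xh mulmxA.
have [phi [c [cH cK c0 phiE]]] := pencil_kernel Hh Kh ab0 xe.
have xphi : x *m phi = 0.
  apply/matrixP => i j; rewrite !ord1 [RHS]mxE.
  by case: phiE => ->; rewrite mulmxA.
set D := (kermx phi :\: x)%MS; pose E := row_base D.
have rD : (\rank D < n)%N.
  have := mxrank_cap_compl (kermx phi) x; rewrite -/D => e.
  have rF : (\rank (kermx phi) <= n)%N by exact: rank_leq_row.
  apply: leq_trans rF; rewrite -e -add1n leq_add2r lt0n mxrank_eq0.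
  apply: contraNneq x0 => e0; rewrite -submx0 -e0 sub_capmx submx_refl andbT.
  exact/sub_kermxP.
have posE s : posidx k (E *m H *m E^t* + s%:C *: (E *m K *m E^t*)).
  have <- : E *m (H + s%:C *: K) *m E^t* = E *m H *m E^t* + s%:C *: (E *m K *m E^t*).
    by rewrite mulmxDr mulmxDl -scalemxAr -scalemxAl.
  apply: (@posidx_isotropic_reduce _ _ _ x phi (c.1 + s%:C * c.2)) => //.
    by rewrite [_^T]linearD /= linearZ /= map_mxD map_mxZ Hh Kh; congr (_ + _ *: _); exact: conj_real_complex.
  by rewrite mulmxDl -scalemxAl cH cK scalerA scalerDl.
have [L1 L1free [L1k [d d0 L1h]]] :=
  IHn _ rD k _ _ (ctr_comp E Hh) (ctr_comp E Kh) posE.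
have Ephi : E *m phi = 0.
  by apply/sub_kermxP; rewrite eq_row_base diffmxSl.
have kill (Q : 'M_n) a : Q *m x^t* = a *: phi -> L1 *m E *m Q *m x^t* = 0.
  by move=> e; rewrite -mulmxA e -scalemxAr -mulmxA Ephi mulmx0 scaler0.
have kill' (Q : 'M_n) a : Q^t* = Q -> Q *m x^t* = a *: phi -> x *m Q *m (L1 *m E)^t* = 0.
  move=> Qh /kill /(congr1 (fun M => M^t*)); rewrite !ctrmxM trmxCK Qh !mulmxA.
  by rewrite trmx0 map_mx0.
have block (Q : 'M_n) a : Q^t* = Q -> Q *m x^t* = a *: phi -> mxquad Q x = 0 ->
  col_mx x (L1 *m E) *m Q *m (col_mx x (L1 *m E))^t* =
  block_mx 0 0 0 (L1 *m (E *m Q *m E^t*) *m L1^t*).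
  move=> Qh Qx qx; rewrite tr_col_mx map_row_mx mul_col_mx mul_col_row.
  rewrite (kill _ _ Qx) (kill' _ _ Qh Qx) ctrmxM !mulmxA; congr block_mx.
  by apply/matrixP => i j; rewrite !ord1 [RHS]mxE.
have free : row_free (col_mx x (L1 *m E)).
  have rx : \rank x = 1%N by rewrite rank_rV x0.
  have rL : \rank (L1 *m E) = k.
    by rewrite mxrankMfree ?row_base_free //; apply/eqP.
  have := mxrank_sum_cap x (L1 *m E); rewrite rx rL /row_free -addsmxE.
  suff -> : (x :&: (L1 *m E))%MS = 0 by rewrite mxrank0 addn0 => ->.
  apply/eqP; rewrite -submx0 capmxC.
  have <- : (D :&: x)%MS = 0 by exact: capmx_diff.
  by rewrite capmxS // (submx_trans (submxMl _ _)) // eq_row_base.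
have row0 (i : 'I_(1 + k)) : 0 <= row_mx (0 : 'rV_1) d 0 i.
  by case: (split_ordP i) => i' ->; rewrite ?row_mxEl ?row_mxEr ?mxE.
have Hd : col_mx x (L1 *m E) *m H *m (col_mx x (L1 *m E))^t* =
    diag_mx (row_mx (0 : 'rV_1) d).
  by rewrite (block _ _ Hh cH) // L1h diag_mx_row; congr block_mx; rewrite linear0.
exists (col_mx x (L1 *m E)) => //; split; last by exists (row_mx (0 : 'rV_1) d).
by rewrite (block _ _ Kh cK) // L1k block_mx0.
Qed.

End PencilNeutral.

(** * Sesquilinear forms and positive families *)

Section Sesquilinear.
Variable R : realType.
Local Notation C := R[i].
Local Notation "x %:C" := (real_complex _ x) : ring_scope.
Variable V : lmodType C.

Definition sesq (b : V -> V -> C) : Prop :=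
  (forall a x y z, b (a *: x + y) z = a * b x z + b y z) /\
  (forall a x y z, b z (a *: x + y) = conjc a * b z x + b z y).

Definition hermform (b : V -> V -> C) : Prop :=
  (forall a x y z, b (a *: x + y) z = a * b x z + b y z) /\
  (forall x y, b y x = conjc (b x y)).

Lemma hermform_sesq b : hermform b -> sesq b.
Proof.
move=> [bl bc]; split=> // a x y z.
by rewrite bc bl rmorphD rmorphM /= -!bc.
Qed.

Section Expansion.
Variable b : V -> V -> C.
Hypothesis bs : sesq b.

Lemma sesqDl x y z : b (x + y) z = b x z + b y z.
Proof. by have := bs.1 1 x y z; rewrite scale1r mul1r. Qed.

Lemma sesqDr x y z : b z (x + y) = b z x + b z y.
Proof. by have := bs.2 1 x y z; rewrite scale1r conjc1 mul1r. Qed.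

Lemma sesq0l z : b 0 z = 0.
Proof. by have := sesqDl 0 0 z; rewrite addr0 => /eqP; rewrite -subr_eq0 opprD addNKr oppr_eq0 => /eqP. Qed.

Lemma sesq0r z : b z 0 = 0.
Proof. by have := sesqDr 0 0 z; rewrite addr0 => /eqP; rewrite -subr_eq0 opprD addNKr oppr_eq0 => /eqP. Qed.

Lemma sesqZl a x z : b (a *: x) z = a * b x z.
Proof. by have := bs.1 a x 0 z; rewrite addr0 sesq0l addr0. Qed.

Lemma sesqZr a x z : b z (a *: x) = conjc a * b z x.
Proof. by have := bs.2 a x 0 z; rewrite addr0 sesq0r addr0. Qed.

Lemma sesqNl x z : b (- x) z = - b x z.
Proof. by rewrite -scaleN1r sesqZl mulN1r. Qed.

Lemma sesqNr x z : b z (- x) = - b z x.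
Proof. by rewrite -scaleN1r sesqZr rmorphN1 mulN1r. Qed.

Lemma sesqBl x y z : b (x - y) z = b x z - b y z.
Proof. by rewrite sesqDl sesqNl. Qed.

Lemma sesqBr x y z : b z (x - y) = b z x - b z y.
Proof. by rewrite sesqDr sesqNr. Qed.

Lemma sesq_suml I (r : seq I) (P : pred I) (F : I -> V) z :
  b (\sum_(i <- r | P i) F i) z = \sum_(i <- r | P i) b (F i) z.
Proof. exact: (big_morph (b^~ z) (fun x y => sesqDl x y z) (sesq0l z)). Qed.

Lemma sesq_sumr I (r : seq I) (P : pred I) (F : I -> V) z :
  b z (\sum_(i <- r | P i) F i) = \sum_(i <- r | P i) b z (F i).
Proof. exact: (big_morph (b z) (fun x y => sesqDr x y z) (sesq0r z)). Qed.

End Expansion.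

(** Coefficients form a row vector, so subspaces of a span become row spaces and a change of family
    becomes a congruence of [gram]. *)
Definition lc k (c : 'rV[C]_k) (x : 'I_k -> V) : V := \sum_i c 0 i *: x i.

Lemma lcDl k (c d : 'rV_k) x : lc (c + d) x = lc c x + lc d x.
Proof. by rewrite /lc -big_split; apply: eq_bigr => i _; rewrite mxE scalerDl. Qed.

Lemma lcZl k a (c : 'rV_k) x : lc (a *: c) x = a *: lc c x.
Proof. by rewrite /lc scaler_sumr; apply: eq_bigr => i _; rewrite mxE scalerA. Qed.

Lemma lc0l k (x : 'I_k -> V) : lc 0 x = 0.
Proof. by rewrite /lc big1 // => i _; rewrite mxE scale0r. Qed.

Lemma lcDr k (c : 'rV_k) x y : lc c (fun i => x i + y i) = lc c x + lc c y.
Proof. by rewrite /lc -big_split; apply: eq_bigr => i _; rewrite scalerDr. Qed.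

Lemma lcBr k (c : 'rV_k) x y : lc c (fun i => x i - y i) = lc c x - lc c y.
Proof. by rewrite /lc -sumrB; apply: eq_bigr => i _; rewrite scalerBr. Qed.

Lemma lc_delta k i (x : 'I_k -> V) : lc (delta_mx 0 i) x = x i.
Proof.
rewrite /lc (bigD1 i) //= big1 ?addr0 ?mxE ?eqxx ?scale1r // => j ji.
by rewrite mxE (negPf ji) andbF scale0r.
Qed.

Lemma lc_mul k l (c : 'rV_k) (P : 'M_(k, l)) x :
  lc (c *m P) x = lc c (fun i => lc (row i P) x).
Proof.
rewrite /lc; transitivity (\sum_j \sum_i (c 0 i * P i j) *: x j).
  by apply: eq_bigr => j _; rewrite mxE scaler_suml.
rewrite exchange_big; apply: eq_bigr => i _.
by rewrite scaler_sumr; apply: eq_bigr => j _; rewrite mxE scalerA.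
Qed.

Definition gram k l (b : V -> V -> C) (x : 'I_k -> V) (y : 'I_l -> V) : 'M[C]_(k, l) :=
  \matrix_(i, j) b (x i) (y j).

Lemma sesq_lc b k l (c : 'rV_k) (d : 'rV_l) x y : sesq b ->
  b (lc c x) (lc d y) = (c *m gram b x y *m d^t*) 0 0.
Proof.
move=> bs; rewrite /lc sesq_suml // mxE.
transitivity (\sum_j \sum_i c 0 i * b (x i) (y j) * conjc (d 0 j)).
  rewrite exchange_big; apply: eq_bigr => i _; rewrite sesqZl // sesq_sumr // mulr_sumr.
  by apply: eq_bigr => j _; rewrite sesqZr // -mulrA [conjc _ * _]mulrC.
apply: eq_bigr => j _; rewrite !mxE mulr_suml; apply: eq_bigr => i _.
by rewrite !mxE.
Qed.

Lemma sesq_mxquad b k (c : 'rV_k) x : sesq b -> b (lc c x) (lc c x) = mxquad (gram b x x) c.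
Proof. by move=> bs; rewrite sesq_lc. Qed.

Lemma gram_lc b k l k' l' (P : 'M_(k', k)) (Q : 'M_(l', l)) x y : sesq b ->
  gram b (fun i => lc (row i P) x) (fun j => lc (row j Q) y) = P *m gram b x y *m Q^t*.
Proof.
move=> bs; apply/matrixP => i j; rewrite mxE sesq_lc // !mxE.
by apply: eq_bigr => l0 _; rewrite -row_mul !mxE.
Qed.

Lemma gram_herm b k (x : 'I_k -> V) : hermform b -> (gram b x x)^t* = gram b x x.
Proof. by move=> [_ bc]; apply/matrixP => i j; rewrite !mxE -[RHS]conjcK -bc. Qed.

Definition posfam k (q : V -> V -> C) (x : 'I_k -> V) : Prop :=
  forall c : 'rV[C]_k, c != 0 -> 0 < q (lc c x) (lc c x).

Lemma posdef_normalize k (G : 'M[C]_k) : G^t* = G ->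
  (forall c, c != 0 -> 0 < mxquad G c) -> exists P : 'M_k, P *m G *m P^t* = 1%:M.
Proof.
move=> Gh Gpos.
have Gn : G \is normalmx by apply/normalmxP; rewrite Gh.
have /orthomx_spectralP Gs := Gn.
set U := spectralmx G in Gs; set d := spectral_diag G in Gs.
have Uu : U \is unitarymx := spectral_unitarymx G.
have UG : U *m G *m U^t* = diag_mx d.
  by rewrite Gs -invmx_unitary // mulmxA mulmxA mulmxV ?mul1mx ?mulmxK ?unitarymx_unit.
have d0 i : 0 < d 0 i.
  have := Gpos (delta_mx 0 i *m U); rewrite -mxquad_comp UG /mxquad diag_sandwichE.
  rewrite (bigD1 i) //= big1 ?addr0; last first.
    by move=> j ji; rewrite !mxE (negPf ji) andbF !mul0r.
  rewrite !mxE !eqxx mul1r rmorph1 mulr1; apply.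
  rewrite mulmx_free_eq0 ?row_free_unit ?unitarymx_unit //.
  by apply/eqP => /matrixP/(_ 0 i)/eqP; rewrite !mxE !eqxx oner_eq0.
pose s : 'rV[C]_k := \row_i (sqrtC (d 0 i))^-1.
have sc : (diag_mx s)^t* = diag_mx s.
  apply/matrixP => i j; rewrite !mxE eq_sym; case: eqP => [->|_]; last by rewrite rmorph0.
  rewrite mulr1n fmorphV; congr (_^-1).
  by apply/CrealP; rewrite ger0_real // sqrtC_ge0 ltW.
exists (diag_mx s *m U); rewrite ctrmxM sc !mulmxA -!(mulmxA (diag_mx s)) UG.
rewrite mulmxA !mulmx_diag; apply/matrixP => i j; rewrite !mxE; congr (_ *+ _).
by rewrite mulrAC -invfM -expr2 sqrtCK mulVf ?gt_eqF.
Qed.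

Lemma posfam_normalize k q (x : 'I_k -> V) : hermform q -> posfam q x ->
  exists P : 'M_k, gram q (fun i => lc (row i P) x) (fun i => lc (row i P) x) = 1%:M.
Proof.
move=> qh qpos; have qs := hermform_sesq qh.
have [|P PE] := posdef_normalize (gram_herm x qh).
  by move=> c /qpos; rewrite sesq_mxquad.
by exists P; rewrite gram_lc.
Qed.

(** With S the sum of the |c i|^2 one has |c i| |c j| <= S, so the error is at most S times the
    hypothesis' sum, hence below S. This reduces positivity of a family to entrywise bounds on its
    Gram matrix. *)
Lemma near_identity k (G : 'M[C]_k) : G^t* = G ->
  \sum_i \sum_j `|G i j - (i == j)%:R| < 1 -> forall c, c != 0 -> 0 < mxquad G c.
Proof.
move=> Gh GE c c0; pose S := \sum_i `|c 0 i| ^+ 2.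
have S0 : 0 < S.
  have /rV0Pn[i ci] := c0.
  rewrite /S (bigD1 i) //= ltr_pwDl ?exprn_gt0 ?normr_gt0 //.
  by apply: sumr_ge0 => j _; rewrite exprn_ge0.
have cS i j : `|c 0 i| * `|c 0 j| <= S.
  have le1 l : `|c 0 l| ^+ 2 <= S.
    by rewrite /S (bigD1 l) //= lerDl; apply: sumr_ge0 => m _; rewrite exprn_ge0.
  have [le|le] := real_leP (normr_real (c 0 i)) (normr_real (c 0 j)).
    by apply: le_trans (le1 j); rewrite expr2 ler_wpM2r.
  by apply: le_trans (le1 i); rewrite expr2 ler_wpM2l // ltW.
pose E := \sum_j \sum_i c 0 i * (G i j - (i == j)%:R) * Num.conj (c 0 j).
have qE : mxquad G c = S + E.
  rewrite /mxquad mxE /S /E -big_split /=; apply: eq_bigr => j _.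
  rewrite !mxE; under [in RHS]eq_bigr do rewrite mulrBr mulrBl.
  have e : \sum_i c 0 i * (i == j)%:R * Num.conj (c 0 j) = `|c 0 j| ^+ 2.
    rewrite (bigD1 j) //= big1 ?addr0 ?eqxx ?mulr1 -?normCK //.
    by move=> i ij; rewrite (negPf ij) mulr0 mul0r.
  by rewrite sumrB e addrC subrK mulr_suml.
have EE : `|E| < S.
  apply: (@le_lt_trans _ _ (S * \sum_i \sum_j `|G i j - (i == j)%:R|)); last by rewrite gtr_pMr.
  rewrite /E exchange_big; apply: le_trans (ler_norm_sum _ _ _) _.
  rewrite mulr_sumr; apply: ler_sum => i _; apply: le_trans (ler_norm_sum _ _ _) _.
  rewrite mulr_sumr; apply: ler_sum => j _.
  by rewrite !normrM norm_conjC mulrAC ler_wpM2r.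
have qr : mxquad G c \is Num.real.
  by rewrite -(herm_quad_real c Gh); apply/complex_realP; exists (complex.Re (mxquad G c)).
have Sr : S \is Num.real by rewrite ger0_real // ltW.
have Er : E \is Num.real by rewrite -[E](addKr S) -qE rpredD ?rpredN.
by move: EE; rewrite qE real_ltr_norml // => /andP[+ _]; rewrite -subr_gt0 opprK addrC.
Qed.

End Sesquilinear.

Section PositiveFamilies.
Variable R : realType.
Local Notation C := R[i].
Local Notation "x %:C" := (real_complex _ x) : ring_scope.
Variable V : lmodType C.
Implicit Types q r : V -> V -> C.

(** The modulus as an element of [R]; the norm of [R[i]] takes its values in [R[i]]. *)
Definition rnorm (z : C) : R := complex.Re `|z|.

Lemma rnormE z : (rnorm z)%:C = `|z|.
Proof. by rewrite /rnorm RRe_real // normr_real. Qed.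

Lemma rnorm_ge0 z : 0 <= rnorm z.
Proof. by rewrite -ler0c rnormE. Qed.

(** A positive family is independent, so this is positivity on a k-dimensional space. *)
Definition haspos k q : Prop := exists x : 'I_k -> V, posfam q x.

(* Vectors taken from a list, not from its span: lists concatenate, which is all
   that the compactness arguments need. *)
Definition haspos_in (F : seq V) k q : Prop :=
  exists2 x : 'I_k -> V, (forall i, x i \in F) & posfam q x.

Definition addform q (a : R) r : V -> V -> C := fun x y => q x y + a%:C * r x y.

Lemma hermform_add q a r : hermform q -> hermform r -> hermform (addform q a r).
Proof.
move=> [ql qc] [rl rc]; split=> [c x y z|x y]; rewrite /addform.
  by rewrite ql rl; ring.
by rewrite qc rc rmorphD rmorphM /= oppr0.
Qed.

Lemma posfam_ext k q r (x : 'I_k -> V) : q =2 r -> posfam q x -> posfam r x.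
Proof. by move=> e p c c0; rewrite -e; apply: p. Qed.

Lemma haspos_ext k q r : q =2 r -> haspos k q -> haspos k r.
Proof. by move=> e [x p]; exists x; apply: posfam_ext p. Qed.

Lemma haspos_in_ext F k q r : q =2 r -> haspos_in F k q -> haspos_in F k r.
Proof. by move=> e [x xF p]; exists x => //; apply: posfam_ext p. Qed.

Lemma haspos_in_sub F G k q : {subset F <= G} -> haspos_in F k q -> haspos_in G k q.
Proof. by move=> s [x xF p]; exists x => // i; apply: s. Qed.

Lemma haspos_normalize k q : hermform q -> haspos k q ->
  exists y : 'I_k -> V, gram q y y = 1%:M.
Proof. by move=> qh [x /(posfam_normalize qh) [P PE]]; exists (fun i => lc (row i P) x). Qed.

Definition gramnorm k r (y : 'I_k -> V) : R := \sum_i \sum_j rnorm (r (y i) (y j)).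

Lemma gramnorm_ge0 k r (y : 'I_k -> V) : 0 <= gramnorm r y.
Proof. by apply: sumr_ge0 => i _; apply: sumr_ge0 => j _; apply: rnorm_ge0. Qed.

Lemma posfam_perturb k q r1 r2 a1 a2 (y : 'I_k -> V) :
  hermform q -> hermform r1 -> hermform r2 -> gram q y y = 1%:M ->
  `|a1| * gramnorm r1 y + `|a2| * gramnorm r2 y < 1 ->
  posfam (addform (addform q a1 r1) a2 r2) y.
Proof.
move=> qh r1h r2h qy small c c0.
have fh := hermform_add a2 (hermform_add a1 qh r1h) r2h.
rewrite (sesq_mxquad _ _ (hermform_sesq fh)); apply: near_identity c0; first exact: gram_herm.
apply: (@le_lt_trans _ _ (`|a1| * gramnorm r1 y + `|a2| * gramnorm r2 y)%:C); last first.
  by rewrite -[1](rmorph1 (real_complex R)) ltcR.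
rewrite /gramnorm !mulr_sumr -big_split rmorph_sum; apply: ler_sum => i _.
rewrite !mulr_sumr -big_split rmorph_sum; apply: ler_sum => j _.
have := congr1 (fun M : 'M_k => M i j) qy; rewrite !mxE /= => e.
rewrite /addform e rmorphD !rmorphM /= !rnormE.
have -> (d X Y : C) : d + X + Y - d = X + Y by ring.
apply: le_trans (ler_normD _ _) _; rewrite !normrM.
by rewrite !normc_def /= !expr0n /= !addr0 !sqrtr_sqr.
Qed.

(** Compactness of the segment by a supremum: S collects the u for which one list serves [a, u], and
    [loc] is the openness of positivity. Concatenating two lists passes beyond [sup S] unless b is
    reached. *)
Lemma haspos_segment k (H K : V -> V -> C) (a b : R) : hermform H -> hermform K -> a <= b ->
  (forall s, a <= s <= b -> haspos k (addform H s K)) ->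
  exists F, forall s, a <= s <= b -> haspos_in F k (addform H s K).
Proof.
move=> Hh Kh ab pos.
pose S : set R := [set u | a <= u <= b /\
  exists F, forall s, a <= s <= u -> haspos_in F k (addform H s K)]%classic.
have loc m : a <= m <= b -> exists2 rho : R, 0 < rho &
    exists G, forall s, `|s - m| < rho -> haspos_in G k (addform H s K).
  move=> /pos /(haspos_normalize (hermform_add m Hh Kh)) [y yE].
  have N0 := gramnorm_ge0 K y; have N1 : 0 < gramnorm K y + 1 by rewrite ltr_wpDl.
  exists (gramnorm K y + 1)^-1; first by rewrite invr_gt0.
  exists (codom y) => s sm; exists y; first by move=> i; apply: codom_f.
  apply: posfam_ext (posfam_perturb (a1 := s - m) (a2 := 0) (hermform_add m Hh Kh) Kh Kh yE _).
    by move=> u v; rewrite /addform rmorphB rmorph0 /=; ring.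
  rewrite normr0 mul0r addr0; apply: (@le_lt_trans _ _ (`|s - m| * (gramnorm K y + 1))).
    by rewrite ler_wpM2l // lerDl.
  by rewrite -ltr_pdivlMr // mul1r.
have Sa : S a.
  split; first by rewrite lexx.
  have [|rho rho0 [G GE]] := loc a; first by rewrite lexx.
  exists G => s; rewrite -eq_le => /eqP <-; apply: GE.
  by rewrite subrr normr0.
have Sub : has_sup S by split; [exists a | exists b => u [/andP[]]].
have am : a <= sup S by apply: sup_upper_bound.
have mb : sup S <= b by apply: ge_sup; [exists a | move=> u [/andP[]]].
have [|rho rho0 [G GE]] := loc (sup S); first by rewrite am.
have [u [/andP[au ub] [F FE]] mu] := sup_adherent rho0 Sub.
pose m' := Num.min b (sup S + rho / 2).
have Fm' s : a <= s <= m' -> haspos_in (F ++ G) k (addform H s K).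
  rewrite le_min => /and3P[as_ sb sm]; have [su|us] := leP s u.
    by apply: haspos_in_sub (FE s _); [move=> v vF; rewrite mem_cat vF | rewrite as_].
  apply: haspos_in_sub (GE s _); first by move=> v vG; rewrite mem_cat vG orbT.
  by rewrite ltr_norml; apply/andP; split; lra.
have : m' <= sup S.
  apply: sup_upper_bound => //; split; last by exists (F ++ G).
  by rewrite ge_min lexx /= andbT le_min ab /=; lra.
rewrite ge_min => /orP[bm|]; last by lra.
exists (F ++ G) => s sab; apply: Fm'; move: sab => /andP[-> sb] /=.
by rewrite le_min sb /=; lra.
Qed.

End PositiveFamilies.

(** * Inner product spaces *)

Section InnerProduct.
Variable R : realType.
Local Notation C := R[i].
Local Notation "x %:C" := (real_complex _ x) : ring_scope.
Variable V : lmodType C.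

Definition is_ip (ip : V -> V -> C) : Prop :=
  [/\ hermform ip, (forall x, 0 <= ip x x) & (forall x, ip x x = 0 -> x = 0)].

Variable ip : V -> V -> C.
Hypothesis ipP : is_ip ip.
Local Notation hn := (hnorm ip).

Lemma ip_herm : hermform ip. Proof. by case: ipP. Qed.
Lemma ip_sesq : sesq ip. Proof. exact: hermform_sesq ip_herm. Qed.
Lemma ipC x y : ip y x = conjc (ip x y). Proof. by case: ip_herm. Qed.
Let sq := ip_sesq.

Lemma hnorm_ge0 x : 0 <= hn x. Proof. exact: sqrtr_ge0. Qed.

Lemma ip_hnorm x : ip x x = (hn x ^+ 2)%:C.
Proof.
have [_ ip0 _] := ipP; have := ip0 x; rewrite lecE /= => /andP[/eqP i0 r0].
rewrite /hnorm sqr_sqrtr //; apply/eqP; rewrite eq_complex /= eqxx /=.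
by rewrite i0.
Qed.

Lemma hnorm_sqr x : hn x ^+ 2 = complex.Re (ip x x).
Proof. by rewrite ip_hnorm. Qed.

Lemma hnorm_eq0 x : hn x = 0 -> x = 0.
Proof. by case: ipP => _ _ d e; apply: d; rewrite ip_hnorm e expr0n rmorph0. Qed.

Lemma hnorm0 : hn 0 = 0.
Proof. by rewrite /hnorm (sesq0l sq) sqrtr0. Qed.

Lemma hnorm_gt0 x : x != 0 -> 0 < hn x.
Proof. by move=> x0; rewrite lt_neqAle hnorm_ge0 eq_sym andbT; apply: contra_neq x0 => /hnorm_eq0. Qed.

Lemma rnorm_sqr (z : C) : z * conjc z = (rnorm z ^+ 2)%:C.
Proof. by rewrite -sqr_normc -rnormE rmorphXn. Qed.

Lemma hnormZ a x : hn (a *: x) = rnorm a * hn x.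
Proof.
apply/eqP; rewrite -(eqrXn2 (n := 2)) ?hnorm_ge0 ?mulr_ge0 ?rnorm_ge0 ?hnorm_ge0 //.
apply/eqP/complexI; rewrite -ip_hnorm (sesqZl sq) (sesqZr sq) mulrA rnorm_sqr ip_hnorm.
by rewrite -rmorphM /= -exprMn.
Qed.

Lemma cauchy_schwarz x y : rnorm (ip x y) <= hn x * hn y.
Proof.
have [->|y0] := eqVneq y 0; first by rewrite (sesq0r sq) hnorm0 mulr0 /rnorm normr0.
have hy := hnorm_gt0 y0.
rewrite -ler_sqr ?nnegrE ?mulr_ge0 ?rnorm_ge0 ?hnorm_ge0 //.
have yy : ip y y != 0 by rewrite ip_hnorm -[0](rmorph0 (real_complex R)) (inj_eq (@complexI R)) expf_neq0 // gt_eqF.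
pose z := x - (ip x y / ip y y) *: y.
have [_ /(_ z) + _] := ipP.
have -> : ip z z = ip x x - ip x y * conjc (ip x y) / ip y y.
  rewrite /z !(sesqBl sq) !(sesqBr sq) !(sesqZl sq) !(sesqZr sq) rmorphM fmorphV /=.
  by rewrite -!(ipC y y) (ipC x y); field.
rewrite rnorm_sqr !ip_hnorm subr_ge0 -fmorphV -rmorphM lecR.
by rewrite ler_pdivrMr ?exprn_gt0 // -exprMn.
Qed.

Lemma Re_le_rnorm (z : C) : complex.Re z <= rnorm z.
Proof.
by rewrite -lecR rnormE; apply: le_trans (normc_ge_Re z); rewrite lecR ler_norm.
Qed.

Lemma hnormD_sqr x y : hn (x + y) ^+ 2 = hn x ^+ 2 + hn y ^+ 2 + 2 * complex.Re (ip x y).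
Proof.
rewrite !hnorm_sqr (sesqDl sq) !(sesqDr sq) (ipC x y) !raddfD /=.
by case: (ip x y) => a b /=; ring.
Qed.

Lemma ler_hnormD x y : hn (x + y) <= hn x + hn y.
Proof.
rewrite -ler_sqr ?nnegrE ?addr_ge0 ?hnorm_ge0 // hnormD_sqr sqrrD.
have := le_trans (Re_le_rnorm _) (cauchy_schwarz x y); lra.
Qed.

Lemma hnormN x : hn (- x) = hn x.
Proof. by rewrite -scaleN1r hnormZ /rnorm normrN1 mul1r. Qed.

Lemma hnorm_distC x y : hn (x - y) = hn (y - x).
Proof. by rewrite -hnormN opprB. Qed.

Lemma orthonormal_gram n (e : 'I_n -> V) : orthonormal ip e <-> gram ip e e = 1%:M.
Proof.
split=> [[e1 e0]|/matrixP eE].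
  by apply/matrixP => i j; rewrite !mxE; case: eqVneq => [->|/eqP/e0].
by split=> [i|i j /eqP/negPf ij]; have := eqE; [move: (eE i i)|move: (eE i j)]; rewrite !mxE ?eqxx ?ij.
Qed.

Definition fcons n (v : V) (e : 'I_n -> V) : 'I_n.+1 -> V :=
  fun i => oapp e v (unlift ord0 i).

Lemma fcons0 n v (e : 'I_n -> V) : fcons v e ord0 = v.
Proof. by rewrite /fcons unlift_none. Qed.

Lemma fconsS n v (e : 'I_n -> V) i : fcons v e (lift ord0 i) = e i.
Proof. by rewrite /fcons liftK. Qed.

Lemma lc_fcons n v (e : 'I_n -> V) c :
  lc c (fcons v e) = c 0 ord0 *: v + lc (\row_i c 0 (lift ord0 i)) e.
Proof.
rewrite /lc big_ord_recl fcons0; congr (_ + _); apply: eq_bigr => i _.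
by rewrite mxE fconsS.
Qed.

Lemma orthonormal_fcons n v (e : 'I_n -> V) : orthonormal ip e -> ip v v = 1 ->
  (forall i, ip v (e i) = 0) -> orthonormal ip (fcons v e).
Proof.
move=> [e1 e0] v1 ve; split=> [i|i j].
  by case: (unliftP ord0 i) => [i' ->|->]; rewrite ?fconsS ?fcons0.
case: (unliftP ord0 i) => [i' ->|->]; case: (unliftP ord0 j) => [j' ->|->] ij;
  rewrite ?fconsS ?fcons0 //.
- by apply: e0 => eij; apply: ij; rewrite eij.
- by rewrite ipC ve conjc0.
Qed.

Lemma ip_normalize v : v != 0 -> ip (((hn v)^-1)%:C *: v) (((hn v)^-1)%:C *: v) = 1.
Proof.
move=> v0; rewrite ip_hnorm hnormZ /rnorm normc_def /= expr0n addr0 sqrtr_sqr.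
rewrite ger0_norm ?invr_ge0 ?hnorm_ge0 // mulVf ?gt_eqF ?hnorm_gt0 //.
by rewrite expr1n rmorph1.
Qed.

Lemma ip_lc_orthonormal n (e : 'I_n -> V) c i : orthonormal ip e -> ip (lc c e) (e i) = c 0 i.
Proof.
move=> [e1 e0]; rewrite /lc (sesq_suml sq) (bigD1 i) //= big1 ?addr0.
  by rewrite (sesqZl sq) e1 mulr1.
by move=> j /eqP ji; rewrite (sesqZl sq) e0 // mulr0.
Qed.

Lemma gram_schmidt (F : seq V) : exists n, exists2 e : 'I_n -> V, orthonormal ip e &
  forall v, v \in F -> exists c, v = lc c e.
Proof.
elim: F => [|v F [n [e eo eF]]].
  by exists 0, (fun i => match i with Ordinal m i0 => 0 end) => //; split=> -[].
pose p := lc (\row_i ip v (e i)) e; pose r := v - p.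
have re i : ip r (e i) = 0 by rewrite /r (sesqBl sq) ip_lc_orthonormal // mxE subrr.
have [r0|r0] := eqVneq r 0.
  exists n, e => // u; rewrite inE => /orP[/eqP ->|/eF //].
  by exists (\row_i ip v (e i)); apply/eqP; rewrite -subr_eq0 -/p -/r r0.
pose r' := ((hn r)^-1)%:C *: r.
exists n.+1, (fcons r' e).
  apply: orthonormal_fcons => //; first exact: ip_normalize.
  by move=> i; rewrite (sesqZl sq) re mulr0.
move=> u; rewrite inE => /orP[/eqP ->|/eF [c ->]].
  exists (\row_i oapp (fun j => ip v (e j)) (hn r)%:C (unlift ord0 i)).
  rewrite lc_fcons !mxE unlift_none /= scalerA -rmorphM mulfV ?gt_eqF ?hnorm_gt0 //.
  rewrite rmorph1 scale1r -[LHS](subrK p) -/r; congr (_ + lc _ _).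
  by apply/rowP => i; rewrite !mxE liftK.
exists (\row_i oapp (fun j => c 0 j) 0 (unlift ord0 i)).
rewrite lc_fcons !mxE unlift_none /= scale0r add0r; congr lc.
by apply/rowP => i; rewrite !mxE liftK.
Qed.

End InnerProduct.

(** * Essential values of a form *)

Section FiniteCodimension.
Variable R : realType.
Local Notation C := R[i].
Local Notation "x %:C" := (real_complex _ x) : ring_scope.
Variable V : lmodType C.
Implicit Types (b : V -> V -> C) (M : V -> Prop).

Definition linear_functional (phi : V -> C) : Prop :=
  forall a x y, phi (a *: x + y) = a * phi x + phi y.

(** Orthogonality to a finite family, for [ip] or for either side of a sesquilinear form, is of this
    kind. *)
Definition fincodim M : Prop :=
  exists n, exists2 phi : 'I_n -> V -> C, (forall i, linear_functional (phi i)) &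
    forall x, M x <-> forall i, phi i x = 0.

Lemma linear_functional_lc phi k (c : 'rV_k) (x : 'I_k -> V) : linear_functional phi ->
  phi (lc c x) = \sum_i c 0 i * phi (x i).
Proof.
move=> lin; have phi0 : phi 0 = 0.
  by have := lin (-1) 0 0; rewrite scaler0 addr0 mulN1r addNr.
have phiD u v : phi (u + v) = phi u + phi v.
  by have := lin 1 u v; rewrite scale1r mul1r.
rewrite /lc (big_morph phi phiD phi0); apply: eq_bigr => i _.
by have := lin (c 0 i) (x i) 0; rewrite !addr0 phi0 addr0.
Qed.

Lemma fincodim_lc M k (c : 'rV_k) (x : 'I_k -> V) : fincodim M ->
  (forall i, M (x i)) -> M (lc c x).
Proof.
move=> [n [phi lin ME]] Mx; apply/ME => j; rewrite linear_functional_lc // big1 // => i _.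
by have /ME -> := Mx i; rewrite mulr0.
Qed.

Lemma fincodimZ M a x : fincodim M -> M x -> M (a *: x).
Proof.
move=> MF Mx; have := @fincodim_lc M 1 (const_mx a) (fun=> x) MF (fun=> Mx).
by rewrite /lc big_ord1 mxE.
Qed.

Lemma fincodimT : fincodim (fun=> True).
Proof. by exists 0, (fun=> (fun=> 0)) => [[]|x] //; split=> // _ []. Qed.

Lemma fincodimI M1 M2 : fincodim M1 -> fincodim M2 -> fincodim (fun x => M1 x /\ M2 x).
Proof.
move=> [n1 [phi1 l1 M1E]] [n2 [phi2 l2 M2E]].
exists (n1 + n2)%N, (fun i => match split i with inl j => phi1 j | inr j => phi2 j end).
  by move=> i; case: (split i).
move=> x; rewrite M1E M2E; split=> [[h1 h2] i|h]; first by case: (split i).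
by split=> i; [have := h (lshift n2 i)|have := h (rshift n1 i)];
  rewrite ?(unsplitK (inl i)) ?(unsplitK (inr i)).
Qed.

Lemma fincodim_forall n (M : 'I_n -> V -> Prop) : (forall i, fincodim (M i)) ->
  fincodim (fun x => forall i, M i x).
Proof.
elim: n M => [|n IHn] M MF.
  by exists 0, (fun=> (fun=> 0)) => [[]|x] //; split=> // _ [].
have [m [phi l E]] := fincodimI (MF ord0) (IHn (fun i => M (lift ord0 i)) (fun i => MF _)).
exists m, phi => // x; rewrite -E; split=> [h|[h0 h] i]; first by split.
by case: (unliftP ord0 i) => [j|] ->.
Qed.

Lemma fincodim_kerl b v : sesq b -> fincodim (fun x => b x v = 0).
Proof.
move=> bs; exists 1%N, (fun _ x => b x v) => [_ a x y|x]; first by rewrite bs.1.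
by split=> // h; apply: (h ord0).
Qed.

Lemma fincodim_kerr b v : sesq b -> fincodim (fun x => b v x = 0).
Proof.
move=> bs; exists 1%N, (fun _ x => conjc (b v x)) => [_ a x y|x].
  by rewrite bs.2 rmorphD rmorphM /= conjcK.
split=> [-> _|/(_ ord0) /eqP]; first by rewrite conjc0.
by rewrite conjc_eq0 => /eqP.
Qed.

Section Infinite.
Variable ip : V -> V -> C.
Hypothesis ipP : is_ip ip.
Hypothesis infdim : exists e : nat -> V, orthonormal ip e.

(** n functionals have a common zero among the nonzero combinations of n + 1 orthonormal vectors. *)
Lemma fincodim_unit M : fincodim M -> exists2 x, M x & ip x x = 1.
Proof.
case=> n [phi lin ME]; have [e [e1 e0]] := infdim.
pose X : 'M[C]_(n.+1, n) := \matrix_(i, j) phi j (e i).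
have /rowV0Pn [c /sub_kermxP cX c0] : kermx X != 0.
  rewrite kermx_eq0 /row_free; apply/negP => /eqP rX.
  by have := rank_leq_col X; rewrite rX ltnn.
pose f := fun i : 'I_n.+1 => e i.
have fo : orthonormal ip f.
  by split=> [i|i j ij]; [exact: e1 | apply: e0 => eij; apply: ij; apply: val_inj].
pose x := lc c f.
have Mx : M x.
  apply/ME => j; rewrite /x linear_functional_lc //.
  have := congr1 (fun A : 'rV_n => A 0 j) cX; rewrite mxE [RHS]mxE => cXj; rewrite -[RHS]cXj.
  by apply: eq_bigr => i _; rewrite mxE.
have x0 : x != 0.
  apply: contraNneq c0 => x0; apply/eqP/rowP => i.
  by rewrite -(ip_lc_orthonormal ipP c i fo) -/x x0 (sesq0l (ip_sesq ipP)) mxE.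
exists (((hnorm ip x)^-1)%:C *: x); last exact: ip_normalize.
by apply: fincodimZ => //; exists n, phi.
Qed.

(** A form of the essential numerical range: values close to w persist in every subspace of finite
    codimension. *)
Definition essential b (w : C) : Prop := forall M (eta : R), fincodim M -> 0 < eta ->
  exists x, [/\ M x, ip x x = 1, `|complex.Re (b x x - w)| < eta & `|complex.Im (b x x - w)| < eta].

(* w is found lexicographically: its real part is the infimum of the essential upper
   bounds of Re b, its imaginary part the same for Im b near that real part. *)
Lemma essential_exists b (B : R) : (forall x, ip x x = 1 -> rnorm (b x x) <= B) ->
  exists w, essential b w.
Proof.
move=> bB; pose f x := complex.Re (b x x); pose g x := complex.Im (b x x).
have fB x : ip x x = 1 -> `|f x| <= B.
  by move=> /bB; apply: le_trans; rewrite -lecR rnormE; apply: normc_ge_Re.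
have gB x : ip x x = 1 -> `|g x| <= B.
  move=> /bB; apply: le_trans; rewrite -lecR rnormE normc_def lecR.
  by rewrite -sqrtr_sqr ler_sqrt ?addr_ge0 ?sqr_ge0 // lerDr sqr_ge0.
pose S1 : set R := [set c | exists2 M, fincodim M & forall x, M x -> ip x x = 1 -> f x <= c]%classic.
have S1inf : has_inf S1.
  split; first by exists B, (fun=> True); [exact: fincodimT | move=> x _ /fB; exact: le_trans (ler_norm _)].
  exists (- B) => c [M /fincodim_unit [x Mx x1] /(_ x Mx x1)].
  by apply: le_trans; have := fB x x1; rewrite ler_norml => /andP[].
pose r := inf S1.
have low1 M eta : fincodim M -> 0 < eta -> exists x, [/\ M x, ip x x = 1 & r - eta < f x].
  move=> MF e0; apply: contrapT => no.
  have : r <= r - eta; last by move=> h; lra.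
  apply: ge_inf S1inf.2 _ _; exists M => // x Mx x1; rewrite leNgt; apply/negP => h.
  by apply: no; exists x.
have up1 eta : 0 < eta -> exists2 M, fincodim M & forall x, M x -> ip x x = 1 -> f x < r + eta.
  move=> e0; have [c [M MF Mc] cr] := inf_adherent e0 S1inf.
  by exists M => // x Mx x1; apply: le_lt_trans cr; apply: Mc.
have near1 M eta : fincodim M -> 0 < eta -> exists x, [/\ M x, ip x x = 1 & `|f x - r| < eta].
  move=> MF e0; have [M' M'F M'f] := up1 _ e0.
  have [x [[Mx M'x] x1 fx]] := low1 _ _ (fincodimI MF M'F) e0.
  exists x; split=> //; have := M'f x M'x x1; rewrite ltr_norml => fx'.
  by apply/andP; split; lra.
pose S2 : set R := [set c | exists M, exists eta, [/\ fincodim M, 0 < eta &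
  forall x, M x -> ip x x = 1 -> `|f x - r| < eta -> g x <= c]]%classic.
have S2inf : has_inf S2.
  split.
    exists B, (fun=> True), 1; split; [exact: fincodimT | exact: ltr01 |].
    by move=> x _ /gB + _; exact: le_trans (ler_norm _).
  exists (- B) => c [M [eta [MF e0 Mc]]]; have [x [Mx x1 fx]] := near1 M eta MF e0.
  by apply: le_trans (Mc x Mx x1 fx); have := gB x x1; rewrite ler_norml => /andP[].
pose s := inf S2.
exists (Complex r s) => M eta MF e0.
have [c [M' [eta' [M'F e'0 M'c]]] cs] := inf_adherent e0 S2inf.
pose e2 := Num.min eta eta'.
have e20 : 0 < e2 by rewrite lt_min e0.
suff [x [[Mx M'x] x1 fx gx]] : exists x, [/\ M x /\ M' x, ip x x = 1, `|f x - r| < e2 & s - eta < g x].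
  move: fx; rewrite lt_min => /andP[fx fx']; have := M'c x M'x x1 fx' => gx'.
  have re : complex.Re (b x x - Complex r s) = f x - r by rewrite raddfB.
  have im : complex.Im (b x x - Complex r s) = g x - s by rewrite raddfB.
  exists x; rewrite re im; split=> //; rewrite ltr_norml; apply/andP; split; lra.
apply: contrapT => no.
have : s <= s - eta; last by move=> h; lra.
apply: ge_inf S2inf.2 _ _; exists (fun x => M x /\ M' x), e2; split=> //; first exact: fincodimI.
move=> x Mx x1 fx; rewrite leNgt; apply/negP => h; by apply: no; exists x.
Qed.

End Infinite.
End FiniteCodimension.

(** * Blocks of vectors on which a form is scalar *)

Section ScalarBlocks.
Variable R : realType.
Local Notation C := R[i].
Local Notation "x %:C" := (real_complex _ x) : ring_scope.
Variable V : lmodType C.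
Variables ip b : V -> V -> C.
Hypotheses (ipP : is_ip ip) (bs : sesq b).

Definition offdiag0 n (u : 'I_n -> V) : Prop := forall i j, i <> j -> b (u i) (u j) = 0.

(** Each new vector is taken orthogonal to the earlier ones for [ip] and for both sides of [b],
    which is a condition of finite codimension. *)
Lemma essential_family w m (M : V -> Prop) (eta : R) : essential ip b w ->
  fincodim M -> 0 < eta -> exists u : 'I_m -> V,
  [/\ orthonormal ip u, offdiag0 u & forall i, [/\ M (u i),
    `|complex.Re (b (u i) (u i) - w)| < eta & `|complex.Im (b (u i) (u i) - w)| < eta]].
Proof.
move=> ess MF e0; elim: m => [|m [u [uo ub uM]]].
  by exists (fun=> 0); split=> [|[]//|[]//]; split=> -[].
have isq := ip_sesq ipP.
have MF' := fincodimI MF (fincodimI (fincodim_forall (fun i => fincodim_kerl (u i) isq))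
  (fincodimI (fincodim_forall (fun i => fincodim_kerl (u i) bs))
   (fincodim_forall (fun i => fincodim_kerr (u i) bs)))).
have [x [[Mx [xu [bxu bux]]] x1 bx1 bx2]] := ess _ _ MF' e0.
exists (fcons x u); split; first exact: orthonormal_fcons.
  move=> i j; case: (unliftP ord0 i) => [i' ->|->]; case: (unliftP ord0 j) => [j' ->|->] ij;
    rewrite ?fconsS ?fcons0 //.
  by apply: ub => eij; apply: ij; rewrite eij.
by move=> i; case: (unliftP ord0 i) => [i' ->|->]; rewrite ?fconsS ?fcons0.
Qed.

(* Pairing the i-th smallest key with the i-th above the median makes all the
   intervals contain the median; combining the vectors of each pair then gives
   equal values of f. *)
Lemma median_pairing m (key : 'I_(m + m) -> R) : exists r, exists J L : 'I_m -> 'I_(m + m),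
  [/\ injective J, injective L, forall i i', J i <> L i' &
   forall i, key (J i) <= r <= key (L i)].
Proof.
case: m key => [|m] key; first by exists 0, (fun i => i), (fun i => i); split=> -[].
pose le := fun i j => key i <= key j.
pose s := sort le (enum 'I_(m.+1 + m.+1)).
have le_total : total le by move=> i j; apply: le_total.
have le_tr : transitive le by move=> i j l; apply: le_trans.
have ssz : size s = (m.+1 + m.+1)%N by rewrite size_sort size_enum_ord.
have su : uniq s by rewrite sort_uniq enum_uniq.
have ss : sorted le s by apply: sort_sorted.
pose n i := nth ord0 s i.
have nle i j : (i <= j)%N -> (j < m.+1 + m.+1)%N -> key (n i) <= key (n j).
  move=> ij js; apply: (sorted_leq_nth le_tr _ ord0 ss) => //.
  - by move=> x; apply: lexx.
  - by rewrite inE ssz; apply: leq_ltn_trans js.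
  - by rewrite inE ssz.
have ninj i j : (i < m.+1 + m.+1)%N -> (j < m.+1 + m.+1)%N -> n i = n j -> i = j.
  by move=> im jm /eqP; rewrite /n nth_uniq ?ssz // => /eqP.
have b1 (i : 'I_m.+1) : (i < m.+1 + m.+1)%N by apply: ltn_addr.
have b2 (i : 'I_m.+1) : (m.+1 + i < m.+1 + m.+1)%N by rewrite ltn_add2l.
exists (key (n m)), (fun i => n i), (fun i : 'I_m.+1 => n (m.+1 + i)%N); split.
- by move=> i j /(ninj _ _ (b1 i) (b1 j)) /val_inj.
- by move=> i j /(ninj _ _ (b2 i) (b2 j)) /addnI /val_inj.
- move=> i j /(ninj _ _ (b1 i) (b2 j)) e; have := ltn_ord i.
  by rewrite e ltnNge leq_addr.
- move=> i; rewrite !nle //; first by rewrite addSn ltnW // ltnS leq_addr.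
  + by rewrite -ltnS.
  + by rewrite addSn ltnS leq_addr.
Qed.

(** [f] will be the real part, then the imaginary part. As [b] is diagonal on u, combining a pair
    with coefficients the square roots of s and t gives the convex combination of the two values; s
    and t are solved from f = r. Convexity is recorded because it keeps earlier equalities and the
    closeness to w. *)
Lemma median_family m (u : 'I_(m + m) -> V) (f : C -> R) :
  (forall (s t : R) z1 z2, f (s%:C * z1 + t%:C * z2) = s * f z1 + t * f z2) ->
  orthonormal ip u -> offdiag0 u ->
  exists r, exists y : 'I_m -> V,
  [/\ orthonormal ip y, offdiag0 y & forall i, [/\ f (b (y i) (y i)) = r,
     (forall M : V -> Prop, fincodim M -> (forall j, M (u j)) -> M (y i)) &
     exists s t j l, [/\ 0 <= s, 0 <= t, s + t = 1 &
       b (y i) (y i) = s%:C * b (u j) (u j) + t%:C * b (u l) (u l)]]].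
Proof.
move=> fD uo ub; pose key j := f (b (u j) (u j)).
have [r [J [L [Ji Li JL keyr]]]] := median_pairing key.
exists r.
have st i : exists st : R * R, [/\ 0 <= st.1, 0 <= st.2, st.1 + st.2 = 1 &
    st.1 * key (J i) + st.2 * key (L i) = r].
  have /andP[k1 k2] := keyr i.
  have [e|ne] := eqVneq (key (J i)) (key (L i)).
    exists (1, 0); rewrite /= mul1r mul0r !addr0; split=> //.
    by apply/eqP; rewrite eq_le k1 e.
  have d0 : 0 < key (L i) - key (J i).
    by rewrite subr_gt0 lt_neqAle ne /= (le_trans k1).
  exists ((key (L i) - r) / (key (L i) - key (J i)), (r - key (J i)) / (key (L i) - key (J i))) => /=.
  split; try by apply: divr_ge0; [rewrite subr_ge0 | apply: ltW].
    by field; rewrite gt_eqF.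
  by field; rewrite gt_eqF.
have {st} [st stP] := choice st.
pose al i := Num.sqrt (st i).1; pose be i := Num.sqrt (st i).2.
have al2 i : al i ^+ 2 = (st i).1 by rewrite sqr_sqrtr //; case: (stP i).
have be2 i : be i ^+ 2 = (st i).2 by rewrite sqr_sqrtr //; case: (stP i).
pose P : 'M[C]_(m, m + m) := \matrix_(i, l) (if l == J i then al i else if l == L i then be i else 0)%:C.
have PE (d : 'rV[C]_(m + m)) i i' : (P *m diag_mx d *m P^t*) i i' =
    ((st i).1%:C * d 0 (J i) + (st i).2%:C * d 0 (L i)) *+ (i == i').
  rewrite diag_sandwichE; have [<-|ii'] := eqVneq i i'; last first.
    rewrite big1 // => l _; rewrite !mxE.
    have [->|lJ] := eqVneq l (J i).
      rewrite (inj_eq Ji) (negPf ii'); case: eqP => [/JL//|_].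
      by rewrite !rmorph0 mulr0.
    have [->|lL] := eqVneq l (L i); last by rewrite !mul0r.
    rewrite (inj_eq Li) (negPf ii') eq_sym; case: eqP => [/JL//|_].
    by rewrite !rmorph0 mulr0.
  have LJ : L i != J i by apply/eqP => /esym /JL.
  rewrite (bigD1 (J i)) //= (bigD1 (L i)) //= big1 ?addr0.
    rewrite !mxE !eqxx (negPf LJ) !conj_real_complex -al2 -be2 !rmorphXn /=.
    by ring.
  by move=> l /andP[lJ lL]; rewrite !mxE (negPf lJ) (negPf lL) !mul0r.
have isq := ip_sesq ipP.
pose y i := lc (row i P) u.
have gu : gram ip u u = diag_mx (const_mx 1).
  by rewrite diag_const_mx; apply/orthonormal_gram.
have gb : gram b u u = diag_mx (\row_j b (u j) (u j)).
  apply/matrixP => i j; rewrite !mxE; case: eqVneq => [->|/eqP/ub] //.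
have byE i i' : b (y i) (y i') =
    ((st i).1%:C * b (u (J i)) (u (J i)) + (st i).2%:C * b (u (L i)) (u (L i))) *+ (i == i').
  have := PE (\row_j b (u j) (u j)) i i'; rewrite -gb -gram_lc // !mxE => ->.
  by [].
exists y; split.
- apply/(orthonormal_gram ip); rewrite gram_lc // gu; apply/matrixP => i i'.
  rewrite PE !mxE !mulr1 -rmorphD; have [_ _ -> _] := stP i.
  by rewrite rmorph1.
- by move=> i i' /eqP/negPf ii'; rewrite byE ii'.
- move=> i; have [s0 t0 st1 str] := stP i; split.
  + by rewrite byE eqxx mulr1n fD.
  + by move=> M MF Mu; apply: fincodim_lc.
  + by exists (st i).1, (st i).2, (J i), (L i); rewrite byE eqxx mulr1n.
Qed.

Lemma convex_near (s t x y w eta : R) : 0 <= s -> 0 <= t -> s + t = 1 ->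
  `|x - w| < eta -> `|y - w| < eta -> `|s * x + t * y - w| < eta.
Proof.
move=> s0 t0 st; rewrite !ltr_norml => /andP[x1 x2] /andP[y1 y2].
have -> : t = 1 - s by rewrite -st addrC addKr.
have s1 : s <= 1 by rewrite -st lerDl.
have [->|s_neq0] := eqVneq s 0; first by apply/andP; split; lra.
have {s0 s_neq0} s0 : 0 < s by rewrite lt_neqAle eq_sym s_neq0.
have l1 : 0 < s * (x - w + eta) by apply: mulr_gt0 => //; lra.
have l2 : 0 <= (1 - s) * (y - w + eta) by apply: mulr_ge0; lra.
have u1 : 0 < s * (eta - (x - w)) by apply: mulr_gt0 => //; lra.
have u2 : 0 <= (1 - s) * (eta - (y - w)) by apply: mulr_ge0; lra.
by apply/andP; split; nra.
Qed.

Lemma scalar_block w k (M : V -> Prop) (eta : R) : essential ip b w ->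
  fincodim M -> 0 < eta -> exists d, exists y : 'I_k -> V,
  [/\ orthonormal ip y, (forall i, M (y i)), gram b y y = d%:M,
    `|complex.Re (d - w)| < eta & `|complex.Im (d - w)| < eta].
Proof.
move=> ess MF e0.
(* Equalizing the real parts halves the family, equalizing the imaginary parts halves it again. *)
have [u [uo ub uM]] := essential_family (k + k + (k + k)) ess MF e0.
have reD (s t : R) z1 z2 : complex.Re (s%:C * z1 + t%:C * z2) = s * complex.Re z1 + t * complex.Re z2.
  by case: z1 z2 => [a1 b1] [a2 b2] /=; ring.
have imD (s t : R) z1 z2 : complex.Im (s%:C * z1 + t%:C * z2) = s * complex.Im z1 + t * complex.Im z2.
  by case: z1 z2 => [a1 b1] [a2 b2] /=; ring.
have [r1 [v [vo vb vP]]] := median_family reD uo ub.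
have [r2 [y [yo yb yP]]] := median_family imD vo vb.
have vM i : M (v i) by have [_ + _] := vP i; apply=> // j; have [] := uM j.
have vnear i : `|complex.Re (b (v i) (v i) - w)| < eta /\ `|complex.Im (b (v i) (v i) - w)| < eta.
  have [_ _ [s [t [j [l [s0 t0 st ->]]]]]] := vP i.
  have [_ + +] := uM j; have [_ + +] := uM l.
  by rewrite ![complex.Re (_ - w)]raddfB ![complex.Im (_ - w)]raddfB /= reD imD => *;
    split; apply: convex_near.
(* An empty block has no vector to read d from, so d = w is taken. *)
case: k => [|k] in u uo ub uM v vo vb vP y yo yb yP vM vnear *.
  exists w, y; split=> //; try by [move=> []|apply/matrixP => -[]].
    by rewrite subrr normr0.
  by rewrite subrr normr0.
have yE i : b (y i) (y i) = b (y ord0) (y ord0).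
  have key j : complex.Re (b (y j) (y j)) = r1 /\ complex.Im (b (y j) (y j)) = r2.
    have [-> _ [s [t [j' [l [s0 t0 st ->]]]]]] := yP j; rewrite reD.
    have [-> _ _] := vP j'; have [-> _ _] := vP l; split=> //.
    by rewrite -mulrDl st mul1r.
  apply/eqP; rewrite eq_complex.
  by have [-> ->] := key i; have [-> ->] := key ord0; rewrite !eqxx.
exists (b (y ord0) (y ord0)), y; split=> //.
- by move=> i; have [_ + _] := yP i; apply.
- apply/matrixP => i j; rewrite !mxE; case: eqVneq => [->|/eqP/yb] //.
- have [_ _ [s [t [j [l [s0 t0 st ->]]]]]] := yP ord0.
  have [+ _] := vnear j; have [+ _] := vnear l.
  by rewrite !raddfB /= reD => *; apply: convex_near.
- have [_ _ [s [t [j [l [s0 t0 st ->]]]]]] := yP ord0.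
  have [_ +] := vnear j; have [_ +] := vnear l.
  by rewrite !raddfB /= imD => *; apply: convex_near.
Qed.

End ScalarBlocks.

(** * Forms of finite rank *)

Section PositiveFamilyOperations.
Variable R : realType.
Local Notation C := R[i].
Local Notation "x %:C" := (real_complex _ x) : ring_scope.
Variable V : lmodType C.
Implicit Types q r : V -> V -> C.

Definition negform q : V -> V -> C := fun x y => - q x y.

Lemma hermform_neg q : hermform q -> hermform (negform q).
Proof.
move=> [ql qc]; split=> [a x y z|x y]; rewrite /negform; first by rewrite ql; ring.
by rewrite qc rmorphN.
Qed.

Definition lin2 (a : R) q (c : R) r : V -> V -> C := fun x y => a%:C * q x y + c%:C * r x y.

Lemma hermform_lin2 a q c r : hermform q -> hermform r -> hermform (lin2 a q c r).
Proof.
move=> [ql qc] [rl rc]; split=> [e x y z|x y]; rewrite /lin2.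
  by rewrite ql rl; ring.
by rewrite qc rc rmorphD !rmorphM /= oppr0.
Qed.

Lemma posfam_scale k q (x : 'I_k -> V) (a : R) : 0 < a -> posfam q x ->
  posfam (fun u v => a%:C * q u v) x.
Proof. by move=> a0 p c c0; apply: mulr_gt0; [rewrite ltcR | exact: p]. Qed.

Lemma haspos_scale k q (a : R) : 0 < a -> haspos k q -> haspos k (fun u v => a%:C * q u v).
Proof. by move=> a0 [x p]; exists x; apply: posfam_scale. Qed.

Lemma haspos_in_scale F k q (a : R) : 0 < a -> haspos_in F k q ->
  haspos_in F k (fun u v => a%:C * q u v).
Proof. by move=> a0 [x xF p]; exists x => //; apply: posfam_scale. Qed.

Lemma posfam_row_free k l q (x : 'I_k -> V) (P : 'M_(l, k)) : row_free P -> posfam q x ->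
  posfam q (fun i => lc (row i P) x).
Proof.
move=> Pf p c c0; rewrite -lc_mul; apply: p.
by rewrite mulmx_free_eq0.
Qed.

Lemma posfam_scale_vectors k q (x : 'I_k -> V) (a : 'I_k -> C) : (forall i, a i != 0) ->
  posfam q (fun i => a i *: x i) -> posfam q x.
Proof.
move=> a0 p c c0; have -> : lc c x = lc (\row_i (c 0 i / a i)) (fun i => a i *: x i).
  by apply: eq_bigr => i _; rewrite mxE scalerA divfK.
apply: p; apply: contraNneq c0 => /rowP c0; apply/eqP/rowP => i.
by have /eqP := c0 i; rewrite !mxE mulf_eq0 invr_eq0 (negPf (a0 i)) orbF => /eqP.
Qed.

Lemma posfam_restrict k l q (x : 'I_l -> V) (kl : (k <= l)%N) : posfam q x ->
  posfam q (fun i => x (widen_ord kl i)).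
Proof.
move=> p; pose P : 'M[C]_(k, l) := \matrix_(i, j) (j == widen_ord kl i)%:R.
have rP i : row i P = delta_mx 0 (widen_ord kl i).
  by apply/rowP => j; rewrite !mxE eqxx.
have Pf : row_free P.
  apply/row_freeP; exists (P^T); apply/matrixP => i j; rewrite !mxE.
  rewrite (bigD1 (widen_ord kl i)) //= big1 ?addr0; last first.
    by move=> l0 ne; rewrite !mxE (negPf ne) mul0r.
  by rewrite !mxE eqxx mul1r -(inj_eq val_inj).
have := posfam_row_free Pf p; rewrite /posfam => h c c0.
have -> : lc c (fun i => x (widen_ord kl i)) = lc c (fun i => lc (row i P) x).
  by apply: eq_bigr => i _; rewrite rP lc_delta.
exact: h.
Qed.

Lemma haspos_in_leq F k l q : (k <= l)%N -> haspos_in F l q -> haspos_in F k q.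
Proof.
by move=> kl [x xF p]; exists (fun i => x (widen_ord kl i)) => //; apply: posfam_restrict.
Qed.

Lemma posfam_fcons k q v (x : 'I_k -> V) : hermform q -> posfam q x ->
  0 < q v v -> (forall i, q v (x i) = 0) -> posfam q (fcons v x).
Proof.
move=> qh p v0 vx c c0; have qs := hermform_sesq qh.
rewrite lc_fcons; set d := (\row__ _); set u := lc d x.
have vu : q v u = 0.
  by rewrite /u /lc (sesq_sumr qs) big1 // => i _; rewrite (sesqZr qs) vx mulr0.
have uv : q u v = 0 by rewrite qh.2 vu conjc0.
rewrite (sesqDl qs) !(sesqDr qs) !(sesqZl qs) !(sesqZr qs) vu uv !mulr0 addr0 add0r.
rewrite mulrA -sqr_normc.
have [d0|d0] := eqVneq d 0.
  have c00 : c 0 ord0 != 0.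
    apply: contraNneq c0 => c00; apply/eqP/rowP => i; rewrite [RHS]mxE.
    case: (unliftP ord0 i) => [j|] ->; last by [].
    by have /rowP/(_ j) := d0; rewrite !mxE.
  rewrite /u d0 lc0l (sesq0l qs) addr0 mulr_gt0 // exprn_gt0 // normr_gt0 //.
by rewrite ltr_wpDl ?mulr_ge0 ?exprn_ge0 ?(ltW v0) //; apply: p.
Qed.

Lemma posfam_scalar k q (x : 'I_k -> V) (r : R) : hermform q -> 0 < r ->
  gram q x x = (r%:C)%:M -> posfam q x.
Proof.
move=> qh r0 qr c c0; rewrite (sesq_mxquad _ _ (hermform_sesq qh)) qr.
rewrite /mxquad mul_mx_scalar -scalemxAl mxE; apply: mulr_gt0; first by rewrite ltcR.
have := @near_identity _ _ 1%:M _ _ c c0; rewrite /mxquad mulmx1; apply.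
  by rewrite trmx1 map_mx1.
by rewrite big1 // => i _; rewrite big1 // => j _; rewrite mxE subrr normr0.
Qed.

Lemma hermform_null_polar q (M : V -> Prop) : hermform q -> fincodim M ->
  (forall x, M x -> q x x = 0) -> forall x y, M x -> M y -> q x y = 0.
Proof.
move=> qh MF q0 x y Mx My; have qs := hermform_sesq qh.
have MD a : M (x + a *: y).
  have := @fincodim_lc _ _ M 2 (row_mx (const_mx 1 : 'rV_1) (const_mx a : 'rV_1))
    (fun i => if i == ord0 then x else y) MF.
  rewrite /lc big_ord_recl big_ord1 /= => h.
  have -> : x + a *: y = row_mx (const_mx 1 : 'rV_1) (const_mx a : 'rV_1) 0 ord0 *: x +
     row_mx (const_mx 1 : 'rV_1) (const_mx a : 'rV_1) 0 (lift ord0 ord0) *: y.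
    by rewrite !mxE; case: splitP => [j|j] //= _; case: splitP => [j'|j'] //= ; rewrite ?ord1 // !mxE scale1r.
  by apply: h => i; case: ifP.
have e a : a * q y x + conjc a * q x y = 0.
  have := q0 _ (MD a); rewrite (sesqDl qs) !(sesqDr qs) !(sesqZl qs) !(sesqZr qs).
  by rewrite !q0 // !mulr0 addr0 add0r addrC.
have := e 1; have := e 'i%C; rewrite qh.2; case: (q x y) => u v.
move=> /eqP; rewrite eq_complex /= => /andP[/eqP e1 /eqP e2].
move=> /eqP; rewrite eq_complex /= => /andP[/eqP e3 /eqP e4].
by apply/eqP; rewrite eq_complex /=; apply/andP; split; apply/eqP; lra.
Qed.

End PositiveFamilyOperations.

Section FiniteRankForm.
Variable R : realType.
Local Notation C := R[i].
Local Notation "x %:C" := (real_complex _ x) : ring_scope.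
Variable V : lmodType C.
Variables ip H K : V -> V -> C.
Hypotheses (ipP : is_ip ip) (Hh : hermform H) (Kh : hermform K).
Local Notation hn := (hnorm ip).
Let Ks := hermform_sesq Kh.

Lemma maximal_index (P : nat -> Prop) k : P 0 -> ~ P k -> exists p, [/\ (p < k)%N, P p & ~ P p.+1].
Proof.
elim: k => [//|k IHk] P0 Pk; have [Pk'|/IHk [//|p [pk Pp Pp']]] := pselect (P k).
  by exists k.
by exists p; split=> //; apply: ltnW.
Qed.

(** The signature of K: f is a K-positive family that cannot be enlarged, so K <= 0 on its
    orthogonal; g is the same for - K inside that orthogonal. On the orthogonal of both, the
    quadratic form of K vanishes, and polarization gives the last clause. *)
Lemma finite_rank_families k : ~ haspos k K -> ~ haspos k (negform K) ->
  exists p q, exists (f : 'I_p -> V) (g : 'I_q -> V),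
  [/\ (p < k)%N, gram K f f = 1%:M, gram K g g = - 1%:M, (forall i j, K (g j) (f i) = 0) &
   (forall x y, (forall i, K x (f i) = 0) -> (forall j, K x (g j) = 0) ->
     (forall i, K y (f i) = 0) -> (forall j, K y (g j) = 0) -> K x y = 0)].
Proof.
move=> Kp Kn.
have [|p [pk Pp Pp1]] := @maximal_index (fun p => haspos p K) k _ Kp.
  by exists (fun=> 0) => c; rewrite [c]thinmx0 eqxx.
have [f fK] := haspos_normalize Kh Pp.
have fpos : posfam K f by apply: (@posfam_scalar _ _ _ _ _ 1).
pose M1 x := forall i, K x (f i) = 0.
have M1F : fincodim M1 by apply: fincodim_forall => i; apply: fincodim_kerl.
have nonpos x : M1 x -> K x x <= 0.
  move=> Mx; have Kr : K x x \is Num.real by apply/CrealP; exact: (esym (Kh.2 _ _)).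
  rewrite real_leNgt ?real0 //; apply/negP => Kx.
  by apply: Pp1; exists (fcons x f); apply: posfam_fcons.
have nKh := hermform_neg Kh.
pose P2 q := exists2 g : 'I_q -> V, (forall j, M1 (g j)) & posfam (negform K) g.
have [| |q [qk [g0 g0M g0pos] Pq1]] := @maximal_index P2 k.
- by exists (fun=> 0) => [[]|] // c; rewrite [c]thinmx0 eqxx.
- by move=> [g _ gp]; apply: Kn; exists g.
have [P PE] := posfam_normalize nKh g0pos.
pose g j := lc (row j P) g0.
have gM j : M1 (g j) by apply: fincodim_lc.
have gpos : posfam (negform K) g by apply: (@posfam_scalar _ _ _ _ _ 1).
exists p, q, f, g; split=> // [|i j|]; last 1 first.
- move=> x y xf xg yf yg.
  pose M2 x := M1 x /\ forall j, K x (g j) = 0.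
  have M2F : fincodim M2.
    by apply: fincodimI => //; apply: fincodim_forall => j; apply: fincodim_kerl.
  apply: (hermform_null_polar Kh M2F) => // z [zf zg].
  apply/eqP; rewrite eq_le nonpos //=.
  have Kr : K z z \is Num.real by apply/CrealP; exact: (esym (Kh.2 _ _)).
  rewrite real_leNgt ?real0 //; apply/negP => Kz.
  apply: Pq1; exists (fcons z g).
    by move=> j; case: (unliftP ord0 j) => [j' ->|->]; rewrite ?fconsS ?fcons0.
  apply: posfam_fcons => //; first by rewrite /negform oppr_gt0.
  by move=> j; rewrite /negform zg oppr0.
- by apply/matrixP => i j; have /matrixP/(_ i j) := PE; rewrite !mxE => <-; rewrite opprK.
- exact: gM.
Qed.

Variable B : R.
Hypothesis HB : forall x y, rnorm (H x y) <= B * hn x * hn y.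

(** The terms mixed in n and y are at most 2 (B + e) |n| |y|. The arithmetic-geometric inequality
    splits this into e |n|^2, which turns e into 2 e, and a multiple of |y|^2, controlled by G T. *)
Lemma absorb_cross_term (n y : V) (e T G : R) : 0 < e -> 0 <= B -> 0 <= G ->
  hn y ^+ 2 <= G * T ->
  complex.Re (H (n - y) (n - y)) + e * hn (n - y) ^+ 2 <=
  complex.Re (H n n) + 2 * e * hn n ^+ 2 + ((B + e) ^+ 2 / e + (B + e)) * (G * T).
Proof.
move=> e0 B0 G0 yT.
have Hs := hermform_sesq Hh.
have c1 := HB n y; have c2 := HB y y.
have c3 := cauchy_schwarz ipP n y.
have r1 := Re_le_rnorm (- H n y); have r2 := Re_le_rnorm (H y y).
have r3 := Re_le_rnorm (- ip n y).
have nN z : rnorm (- z) = rnorm z by rewrite /rnorm normrN.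
have hy : hn (n - y) ^+ 2 = hn n ^+ 2 + hn y ^+ 2 + 2 * complex.Re (- ip n y).
  by rewrite hnormD_sqr // hnormN // (sesqNr (ip_sesq ipP)).
have Hy : complex.Re (H (n - y) (n - y)) =
    complex.Re (H n n) + complex.Re (H y y) + 2 * complex.Re (- H n y).
  rewrite (sesqBl Hs) !(sesqBr Hs) (Hh.2 n y).
  by case: (H n n) (H n y) (H y y) => [a1 a2] [b1 b2] [d1 d2] /=; ring.
rewrite !nN in r1 r3; rewrite Hy hy.
have n0 := hnorm_ge0 ip n; have y0 := hnorm_ge0 ip y.
move: (hn n) (hn y) n0 y0 c1 c2 c3 yT => a c a0 c0' c1 c2 c3 yT.
have amgm : 2 * (B + e) * (a * c) <= e * a ^+ 2 + (B + e) ^+ 2 / e * c ^+ 2.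
  have : 0 <= (e * a - (B + e) * c) ^+ 2 / e by rewrite divr_ge0 ?sqr_ge0 // ltW.
  have -> : (e * a - (B + e) * c) ^+ 2 / e = e * a ^+ 2 + (B + e) ^+ 2 / e * c ^+ 2 - 2 * (B + e) * (a * c).
    by field; rewrite gt_eqF.
  by rewrite subr_ge0.
have D0 : 0 <= (B + e) ^+ 2 / e + (B + e).
  by rewrite addr_ge0 ?divr_ge0 ?sqr_ge0 ?addr_ge0 // ltW.
have := ler_wpM2l D0 yT; nra.
Qed.

End FiniteRankForm.

Section FiniteRankSide.
Variable R : realType.
Local Notation C := R[i].
Local Notation "x %:C" := (real_complex _ x) : ring_scope.
Variable V : lmodType C.
Variables ip H K : V -> V -> C.
Hypotheses (ipP : is_ip ip) (Hh : hermform H) (Kh : hermform K).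
Local Notation hn := (hnorm ip).
Let Ks := hermform_sesq Kh.
Let Hs := hermform_sesq Hh.
Let iph := ip_herm ipP.
Variable B : R.
Hypotheses (B0 : 0 <= B) (HB : forall x y, rnorm (H x y) <= B * hn x * hn y).

Lemma hermform_real (q : V -> V -> C) x : hermform q -> (complex.Re (q x x))%:C = q x x :> C.
Proof. by move=> qh; apply: RRe_real; apply/CrealP; exact: (esym (qh.2 _ _)). Qed.

Lemma hermform_gt0 (q : V -> V -> C) x : hermform q -> (0 < q x x) = (0 < complex.Re (q x x)).
Proof. by move=> qh; rewrite -(hermform_real x qh) ltcR. Qed.

Lemma ler_hnorm_lc n (c : 'rV[C]_n) x : hn (lc c x) <= \sum_i rnorm (c 0 i) * hn (x i).
Proof.
rewrite /lc; elim/big_ind2: _ => [|a u a' u' h h'|i _].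
- by rewrite hnorm0.
- exact: le_trans (ler_hnormD ipP _ _) (lerD h h').
- by rewrite hnormZ.
Qed.

Lemma hnorm_lc_sqr n (c : 'rV[C]_n) x :
  hn (lc c x) ^+ 2 <= (\sum_i hn (x i)) ^+ 2 * \sum_i rnorm (c 0 i) ^+ 2.
Proof.
set T := \sum_i _ ^+ 2; have T0 : 0 <= T by apply: sumr_ge0 => i _; apply: sqr_ge0.
have cT i : rnorm (c 0 i) <= Num.sqrt T.
  rewrite -ler_sqr ?nnegrE ?sqrtr_ge0 ?rnorm_ge0 // sqr_sqrtr //.
  by rewrite /T (bigD1 i) //= lerDl; apply: sumr_ge0 => j _; apply: sqr_ge0.
have -> : (\sum_i hn (x i)) ^+ 2 * T = ((\sum_i hn (x i)) * Num.sqrt T) ^+ 2.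
  by rewrite exprMn sqr_sqrtr.
rewrite ler_sqr ?nnegrE ?hnorm_ge0 ?mulr_ge0 ?sqrtr_ge0 //; last first.
  by apply: sumr_ge0 => i _; apply: hnorm_ge0.
apply: le_trans (ler_hnorm_lc c x) _; rewrite mulr_suml; apply: ler_sum => i _.
by rewrite mulrC ler_wpM2l ?hnorm_ge0.
Qed.

Lemma sesq_lcl (b : V -> V -> C) n (c : 'rV[C]_n) x v : sesq b -> b (lc c x) v = \sum_i c 0 i * b (x i) v.
Proof. by move=> bs; rewrite /lc sesq_suml //; apply: eq_bigr => i _; rewrite sesqZl. Qed.

(* For large s, positivity of H + e + s K at a vector K-orthogonal to f forces its
   g-components to be small, so H + 2 e is positive on its projection to the radical
   of K. *)
Lemma null_family k p q (f : 'I_p -> V) (g : 'I_q -> V) (e : R) : 0 < e ->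
  gram K g g = - 1%:M -> (forall i j, K (g j) (f i) = 0) ->
  (forall x y, (forall i, K x (f i) = 0) -> (forall j, K x (g j) = 0) ->
     (forall i, K y (f i) = 0) -> (forall j, K y (g j) = 0) -> K x y = 0) ->
  (forall s, haspos k (addform (addform H e ip) s K)) ->
  exists r, exists n : 'I_r -> V, [/\ (k <= p + r)%N, posfam (addform H (2 * e) ip) n,
    (forall i j, K (n i) (f j) = 0) & (forall i j, K (n i) (n j) = 0)].
Proof.
move=> e0 gg gf null pos.
pose G := (\sum_j hn (g j)) ^+ 2; have G0 : 0 <= G by apply: sqr_ge0.
(* The constant of [absorb_cross_term]: s K contributes - s T, which cancels its last term
   exactly. *)
pose s := ((B + e) ^+ 2 / e + (B + e)) * G.
have [x xpos] := pos s.
(* The combinations of x that are K-orthogonal to f; their dimension is at least k - p. *)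
pose X := gram K x f; pose Y := row_base (kermx X).
pose u := fun i => lc (row i Y) x.
have upos : posfam (addform (addform H e ip) s K) u.
  by apply: posfam_row_free => //; apply: row_base_free.
have uf i j : K (u i) (f j) = 0.
  have : (row i Y <= kermx X)%MS by rewrite -(eq_row_base (kermx X)) row_sub.
  move=> /sub_kermxP /(congr1 (fun A : 'rV_p => A 0 j)); rewrite mxE [RHS]mxE => e1.
  by rewrite sesq_lcl // -[RHS]e1; apply: eq_bigr => l _; congr (_ * _); rewrite mxE.
(* K is - 1 on g, so adding the coefficients K (u i) (g j) removes the g-components. *)
pose n i := u i + lc (\row_j K (u i) (g j)) g.
have ngE (c : 'rV_(\rank (kermx X))) : lc c n = lc c u + lc (\row_j K (lc c u) (g j)) g.
  rewrite /n lcDr; congr (_ + _); rewrite -[RHS]/(lc _ g).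
  have -> : (\row_j K (lc c u) (g j)) = c *m \matrix_(i, j) K (u i) (g j).
    by apply/rowP => j; rewrite !mxE sesq_lcl //; apply: eq_bigr => i _; rewrite mxE.
  by rewrite lc_mul; congr lc; apply/funext => i; congr lc; apply/rowP => j; rewrite !mxE.
have nf i j : K (n i) (f j) = 0.
  by rewrite /n (sesqDl Ks) uf add0r sesq_lcl // big1 // => l _; rewrite gf mulr0.
have ng i j : K (n i) (g j) = 0.
  rewrite /n (sesqDl Ks) sesq_lcl // (bigD1 j) //= big1 ?addr0.
    have := congr1 (fun A : 'M_q => A j j) gg; rewrite !mxE eqxx => ->.
    by rewrite mulrN1 subrr.
  move=> l lj; have := congr1 (fun A : 'M_q => A l j) gg; rewrite !mxE (negPf lj) => ->.
  by rewrite oppr0 mulr0.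
have nn i j : K (n i) (n j) = 0 by apply: null => ?; rewrite ?nf ?ng.
exists (\rank (kermx X)), n; split=> //.
  rewrite mxrank_ker addnC -leq_subLR subKn.
    exact: rank_leq_col.
  exact: rank_leq_row.
move=> c c0; have h1 := hermform_add s (hermform_add e Hh iph) Kh.
have := upos c c0; rewrite hermform_gt0 // hermform_gt0; last exact: hermform_add.
set U := lc c u; set N := lc c n; pose kap := \row_j K U (g j); pose y := lc kap g.
have UE : U = N - y by rewrite /N ngE -/kap -/y addrK.
have NN : K N N = 0.
  by rewrite /N sesq_lcl // big1 // => i _; rewrite Kh.2 sesq_lcl // big1 ?conjc0 ?mulr0 // => j _; rewrite nn mulr0.
have Nv v : (forall i, K (n i) v = 0) -> K N v = 0.
  by move=> nv; rewrite /N sesq_lcl // big1 // => i _; rewrite nv mulr0.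
have Ny : K N y = 0.
  by rewrite Kh.2 /y sesq_lcl // big1 ?conjc0 // => j _; rewrite Kh.2 Nv // conjc0 mulr0.
have yN : K y N = 0 by rewrite Kh.2 Ny conjc0.
pose T := \sum_j rnorm (kap 0 j) ^+ 2.
have yy : K y y = - T%:C.
  rewrite /y (sesq_mxquad _ _ Ks) gg /mxquad mulmxN mulmx1 mulNmx mxE; congr (- _).
  rewrite mxE /T rmorph_sum; apply: eq_bigr => j _; apply: etrans (rnorm_sqr (kap 0 j)).
  by congr (_ * _); rewrite !mxE.
have UU : K U U = - T%:C.
  by rewrite UE (sesqBl Ks) !(sesqBr Ks) NN Ny yN yy; ring.
have yT : hn y ^+ 2 <= G * T by apply: hnorm_lc_sqr.
have := absorb_cross_term ipP Hh HB N e0 B0 G0 yT.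
rewrite /addform UU UE !(ip_hnorm ipP) !raddfD /=.
case: (H _ _) => a1 a2; case: (H _ _) => b1 b2 /=; rewrite /s mulrA -/s => h.
set D := ((B + e) ^+ 2 / e + (B + e)) in h *.
by rewrite !mul0r !subr0; nra.
Qed.

Lemma finite_rank_null k : ~ haspos k K -> ~ haspos k (negform K) ->
  exists2 M : V -> Prop, fincodim M & forall x y, M x -> M y -> K x y = 0.
Proof.
move=> Kp Kn; have [p [q [f [g [_ _ _ _ null]]]]] := finite_rank_families Kh Kp Kn.
exists (fun x => (forall i, K x (f i) = 0) /\ (forall j, K x (g j) = 0)).
  by apply: fincodimI; apply: fincodim_forall => i; apply: fincodim_kerl.
by move=> x y [xf xg] [yf yg]; apply: null.
Qed.

(** One list serves all large s: f, on which s K dominates, followed by a K-null family on which H +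
    t is already positive. The level t / 2 is used because [null_family] doubles it. *)
Lemma finite_rank_side k t : ~ haspos k K -> ~ haspos k (negform K) ->
  (forall s e, 0 < e -> haspos k (addform (addform H e ip) s K)) -> 0 < t ->
  exists S F, forall s, S <= s -> haspos_in F k (addform (addform H t ip) s K).
Proof.
move=> Kp Kn pos t0.
have [p [q [f [g [_ ff gg gf null]]]]] := finite_rank_families Kh Kp Kn.
have t20 : 0 < t / 2 by rewrite divr_gt0.
have [r [n0 [kr n0pos n0f n0n]]] := null_family t20 gg gf null (fun s => pos s _ t20).
have te : 2 * (t / 2) = t by field.
rewrite te in n0pos; pose Ht := addform H t ip.
have Hth : hermform Ht by apply: hermform_add.
have Hts := hermform_sesq Hth.
have [P PE] := posfam_normalize Hth n0pos.
pose n i := lc (row i P) n0.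
have nf i j : K (n i) (f j) = 0.
  by rewrite sesq_lcl // big1 // => l _; rewrite n0f mulr0.
have fn i j : K (f j) (n i) = 0 by rewrite Kh.2 nf conjc0.
have nn i j : K (n i) (n j) = 0.
  rewrite sesq_lcl // big1 // => l _; rewrite Kh.2 sesq_lcl // big1 ?conjc0 ?mulr0 // => m _.
  by rewrite n0n mulr0.
have ffE i j : K (f i) (f j) = (i == j)%:R.
  by have := congr1 (fun A : 'M_p => A i j) ff; rewrite !mxE.
have nnE i j : Ht (n i) (n j) = (i == j)%:R.
  by have := congr1 (fun A : 'M_r => A i j) PE; rewrite !mxE.
pose z (i : 'I_(p + r)) := match split i with inl j => f j | inr j => n j end.
pose N := gramnorm Ht z; have N0 : 0 <= N by apply: gramnorm_ge0.
(* Scaling f by w = s^(-1/2) makes the Gram matrix differ from the identity by at most w N in total,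
   and s >= (N + 1)^2 gives w N < 1. *)
exists ((N + 1) ^+ 2), (codom z) => s sN.
apply: haspos_in_leq kr _; exists z; first by move=> i; apply: codom_f.
have s1 : 1 <= s by apply: le_trans sN; rewrite -[leLHS](expr1n _ 2) ler_sqr ?nnegrE; lra.
have s0 : 0 < s by apply: lt_le_trans s1.
pose w := (Num.sqrt s)^-1.
have w0 : 0 < w by rewrite invr_gt0 sqrtr_gt0.
have ws : w ^+ 2 * s = 1 by rewrite exprVn sqr_sqrtr ?mulVf ?gt_eqF // ltW.
have w1 : w <= 1.
  by rewrite invf_le1 ?sqrtr_gt0 // -[leLHS]sqrtr1 ler_sqrt // ltW.
pose a (i : 'I_(p + r)) : R := match split i with inl j => w | inr j => 1 end.
have a0 i : (a i)%:C != 0 :> C.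
  rewrite -[0](rmorph0 (real_complex R)) (inj_eq (@complexI R)) /a.
  by case: (split i) => _; rewrite ?oner_eq0 // gt_eqF.
apply: (posfam_scale_vectors a0) => c c0.
have qh : hermform (addform Ht s K) by apply: hermform_add.
rewrite (sesq_mxquad _ _ (hermform_sesq qh)); apply: near_identity c0; first exact: gram_herm.
apply: (@le_lt_trans _ _ (w * N)%:C); last first.
  rewrite -[1](rmorph1 (real_complex R)) ltcR mulrC -ltr_pdivlMr // mul1r invrK.
  apply: (@lt_le_trans _ _ (N + 1)); first by rewrite ltrDl.
  by rewrite -(ger0_norm (_ : 0 <= N + 1)) ?addr_ge0 // -sqrtr_sqr ler_sqrt // ltW.
rewrite /N /gramnorm !mulr_sumr rmorph_sum; apply: ler_sum => i _.
rewrite !mulr_sumr rmorph_sum; apply: ler_sum => j _.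
rewrite mxE (sesqZl (hermform_sesq qh)) (sesqZr (hermform_sesq qh)) rmorphM /= rnormE oppr0.
have wn : `|w%:C| = w%:C :> C by rewrite ger0_norm // ler0c ltW.
have small (x : C) : `|w%:C * (w%:C * x)| <= w%:C * `|x|.
  rewrite !normrM wn ler_wpM2l ?ler0c ?(ltW w0) // -[leRHS]mul1r ler_wpM2r //.
  by rewrite -[1](rmorph1 (real_complex R)) lecR.
have zl l : z (lshift r l) = f l by rewrite /z (unsplitK (inl l)).
have zr l : z (rshift p l) = n l by rewrite /z (unsplitK (inr l)).
have al l : a (lshift r l) = w by rewrite /a (unsplitK (inl l)).
have ar l : a (rshift p l) = 1 by rewrite /a (unsplitK (inr l)).
rewrite -/((a j)%:C) /addform.
case: (split_ordP i) => i' ->; case: (split_ordP j) => j' ->; rewrite ?zl ?zr ?al ?ar.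
- rewrite ffE; apply: le_trans (small (Ht (f i') (f j'))); rewrite eq_lshift.
  have -> : forall d x : C, (w%:C * (w%:C * (x + s%:C * d)) - d = w%:C * (w%:C * x)).
    move=> d x; have : (w ^+ 2 * s)%:C = 1 by rewrite ws rmorph1.
    rewrite !rmorphM /= => e; transitivity (w%:C * (w%:C * x) + (w%:C * w%:C * s%:C - 1) * d); first by ring.
    by rewrite e subrr mul0r addr0.
  by [].
- rewrite fn eq_lrshift subr0 mulr0 addr0 mul1r normrM wn //.
- rewrite nf eq_rlshift subr0 mulr0 addr0 rmorph1 mul1r normrM wn //.
- rewrite nn nnE eq_rshift mulr0 addr0 rmorph1 !mul1r subrr normr0.
  by rewrite mulr_ge0 // ler0c ltW.
Qed.

End FiniteRankSide.

(** * Compressions to scalars *)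

Section NeutralFamilies.
Variable R : realType.
Local Notation C := R[i].
Local Notation "x %:C" := (real_complex _ x) : ring_scope.
Variable V : lmodType C.
Implicit Types b : V -> V -> C.

Definition hre b : V -> V -> C := fun x y => (b x y + conjc (b y x)) / 2.
Definition him b : V -> V -> C := fun x y => (b x y - conjc (b y x)) / (2 * 'i%C).

Lemma hermform_hre b : sesq b -> hermform (hre b).
Proof.
move=> bs; split=> [a x y z|x y]; rewrite /hre.
  by rewrite bs.1 bs.2 rmorphD rmorphM /= conjcK; field.
by rewrite fmorph_div rmorph_nat rmorphD /= conjcK addrC.
Qed.

Lemma i_neq0 : 'i%C != 0 :> C.
Proof. by rewrite eq_complex /= oner_eq0 andbF. Qed.

Lemma hermform_him b : sesq b -> hermform (him b).
Proof.
move=> bs; split=> [a x y z|x y]; rewrite /him.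
  by rewrite bs.1 bs.2 rmorphD rmorphM /= conjcK; field; rewrite i_neq0.
have e : conjc ((2 * 'i%C)^-1) = - (2 * 'i%C)^-1 :> C.
  rewrite conjc_inv -invrN; congr (_^-1).
  by apply/eqP; rewrite eq_complex /=; apply/andP; split; apply/eqP; ring.
transitivity (conjc (b x y - conjc (b y x)) * conjc ((2 * 'i%C)^-1)).
  by rewrite e rmorphB /= conjcK; field; rewrite i_neq0.
exact: esym (rmorphM _ _ _).
Qed.

Lemma hre_him b x y : b x y = hre b x y + 'i%C * him b x y.
Proof. by rewrite /hre /him; field; rewrite i_neq0. Qed.

Lemma hre_quad b x : hre b x x = (complex.Re (b x x))%:C.
Proof. by rewrite /hre addcJ mulrC mulKf // pnatr_eq0. Qed.

Lemma him_quad b x : him b x x = (complex.Im (b x x))%:C.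
Proof.
rewrite /him subcJ; field; exact: i_neq0.
Qed.

Lemma posidx_gram k n (e : 'I_n -> V) (F : seq V) q : hermform q ->
  (forall v, v \in F -> exists c, v = lc c e) -> haspos_in F k q -> posidx k (gram q e e).
Proof.
move=> qh eF [x xF qx]; have qs := hermform_sesq qh.
have [c cE] := choice (fun i => eF _ (xF i)).
pose P : 'M[C]_(k, n) := \matrix_(i, j) c i 0 j.
have xE : x = fun i => lc (row i P) e.
  by apply/funext => i; rewrite cE; congr lc; apply/rowP => j; rewrite !mxE.
have posP d : d != 0 -> 0 < mxquad (gram q e e) (d *m P).
  by move=> d0; rewrite -sesq_mxquad // lc_mul -xE; apply: qx.
exists k, P.
  suff /eqP -> : row_free P by [].
  apply/inj_row_free => d dP; apply/eqP/negPn/negP => /posP.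
  by rewrite dP /mxquad !mul0mx mxE ltxx.
move=> u /submxP[d ->] dP0; apply: posP.
by apply: contraNneq dP0 => ->; rewrite mul0mx.
Qed.

Variable ip : V -> V -> C.
Hypothesis ipP : is_ip ip.

Lemma neutral_family k n (e : 'I_n -> V) (F : seq V) b (w : 'I_k -> V) : sesq b ->
  orthonormal ip e -> (forall v, v \in F -> exists c, v = lc c e) ->
  (forall s, haspos_in F k (addform (hre b) s (him b))) ->
  gram b w w = - 1%:M ->
  (forall i j, [/\ ip (w i) (e j) = 0, b (w i) (e j) = 0 & b (e j) (w i) = 0]) ->
  exists2 y : 'I_k -> V, (forall c, lc c y = 0 -> c = 0) & gram b y y = 0.
Proof.
move=> bs eo eF pos ww we.
have Hh := hermform_hre bs; have Kh := hermform_him bs.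
have [|L Lfree [LK [d d0 LH]]] := @pencil_neutral _ _ k _ _ (gram_herm e Hh) (gram_herm e Kh).
  move=> s; have := posidx_gram (hermform_add s Hh Kh) eF (pos s).
  congr posidx; apply/matrixP => i j; rewrite !mxE //.
(* The added vector has value - d 0 i, against + d 0 i for the combination of e. Being
   [ip]-orthogonal to e, it leaves the e-components alone, and independence is read off those. *)
pose y i := lc (row i L) e + sqrtC (d 0 i) *: w i.
have ipw c j : ip (lc c (fun i => sqrtC (d 0 i) *: w i)) (e j) = 0.
  rewrite sesq_lcl ?big1 //; last exact: ip_sesq.
  by move=> i _; rewrite (sesqZl (ip_sesq ipP)); have [-> _ _] := we i j; rewrite !mulr0.
exists y.
  move=> c; rewrite /y lcDr -lc_mul => e0.
  have cL : c *m L = 0.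
    apply/rowP => j; rewrite -(ip_lc_orthonormal ipP _ j eo) [RHS]mxE.
    have := congr1 (fun v => ip v (e j)) e0.
    by rewrite (sesqDl (ip_sesq ipP)) ipw addr0 (sesq0l (ip_sesq ipP)).
  by apply/eqP; rewrite -(mulmx_free_eq0 c Lfree) cL.
have eE : L *m gram b e e *m L^t* = diag_mx d.
  have -> : gram b e e = gram (hre b) e e + 'i%C *: gram (him b) e e.
    by apply/matrixP => i j; rewrite !mxE -hre_him.
  by rewrite mulmxDr mulmxDl -scalemxAr -scalemxAl LH LK scaler0 addr0.
apply/matrixP => i j; rewrite !mxE /y.
have ew l v : b (lc l e) (w v) = 0.
  by rewrite sesq_lcl // big1 // => m _; have [_ _ ->] := we v m; rewrite mulr0.
have wl l v : b (w v) (lc l e) = 0.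
  rewrite /lc sesq_sumr // big1 // => m _; rewrite sesqZr //.
  by have [_ -> _] := we v m; rewrite mulr0.
rewrite (sesqDl bs) !(sesqDr bs) !(sesqZl bs) !(sesqZr bs) ew wl !mulr0 addr0 add0r.
have -> : b (lc (row i L) e) (lc (row j L) e) = d 0 i *+ (i == j).
  by have /matrixP/(_ i j) := eE; rewrite -gram_lc // !mxE.
have -> : b (w i) (w j) = - ((i == j)%:R).
  by have /matrixP/(_ i j) := ww; rewrite !mxE.
case: eqVneq => [<-|_]; last by rewrite mulr0n oppr0 !mulr0 addr0.
rewrite mulr1n mulrA mulrN mulr1; apply/eqP; rewrite subr_eq0; apply/eqP.
have -> : conjc (sqrtC (d 0 i)) = sqrtC (d 0 i).
  by apply/CrealP; rewrite ger0_real // sqrtC_ge0.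
by rewrite -expr2 sqrtCK.
Qed.

End NeutralFamilies.

Section CompressionToScalar.
Variable R : realType.
Local Notation C := R[i].
Local Notation "x %:C" := (real_complex _ x) : ring_scope.
Variable V : lmodType C.
Implicit Types q : V -> V -> C.

Lemma hreE (b : V -> V -> C) x y : hre b x y = (2^-1)%:C * (b x y + conjc (b y x)).
Proof. by rewrite /hre mulrC fmorphV rmorph_nat. Qed.

Lemma himE (b : V -> V -> C) x y : him b x y = (Complex 0 (- 2^-1)) * (b x y - conjc (b y x)).
Proof.
rewrite /him mulrC; congr (_ * _); apply: (@mulfI _ (2 * 'i%C)).
  by rewrite mulf_neq0 ?pnatr_eq0 ?i_neq0.
rewrite mulfV ?mulf_neq0 ?pnatr_eq0 ?i_neq0 //.
by apply/eqP; rewrite eq_complex /=; apply/andP; split; apply/eqP; field.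
Qed.

Lemma hre_scale (z : C) (c : V -> V -> C) x y :
  hre (fun x y => z * c x y) x y = (complex.Re z)%:C * hre c x y - (complex.Im z)%:C * him c x y.
Proof.
rewrite !hreE himE; case: z => p q; case: (c x y) => a1 a2; case: (c y x) => b1 b2.
by apply/eqP; rewrite eq_complex /=; apply/andP; split; apply/eqP; field.
Qed.

Lemma him_scale (z : C) (c : V -> V -> C) x y :
  him (fun x y => z * c x y) x y = (complex.Im z)%:C * hre c x y + (complex.Re z)%:C * him c x y.
Proof.
rewrite !himE hreE; case: z => p q; case: (c x y) => a1 a2; case: (c y x) => b1 b2.
by apply/eqP; rewrite eq_complex /=; apply/andP; split; apply/eqP; field.
Qed.

(** By homogeneity the larger of |a| and |c| can be scaled to 1, so four compact segments, the sides
    of a square, cover all directions. *)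
Lemma haspos_circle k (H K : V -> V -> C) : hermform H -> hermform K ->
  (forall a c, (a != 0) || (c != 0) -> haspos k (lin2 a H c K)) ->
  exists F, forall a c, (a != 0) || (c != 0) -> haspos_in F k (lin2 a H c K).
Proof.
move=> Hh Kh pos.
have seg (H' K' : V -> V -> C) : hermform H' -> hermform K' ->
    (forall s, haspos k (addform H' s K')) ->
    exists F, forall s, - 1 <= s <= 1 -> haspos_in F k (addform H' s K').
  by move=> Hh' Kh' p; apply: haspos_segment => //; lra.
have [F1 F1P] : exists F, forall s, - 1 <= s <= 1 -> haspos_in F k (addform H s K).
  apply: seg => // s; apply: haspos_ext (pos 1 s _); last by rewrite oner_eq0.
  by move=> u v; rewrite /lin2 /addform rmorph1 mul1r.
have [F2 F2P] : exists F, forall s, - 1 <= s <= 1 -> haspos_in F k (addform (negform H) s K).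
  apply: seg => // [|s]; first exact: hermform_neg.
  apply: haspos_ext (pos (- 1) s _); last by rewrite oppr_eq0 oner_eq0.
  by move=> u v; rewrite /lin2 /addform /negform rmorphN1 mulN1r.
have [F3 F3P] : exists F, forall s, - 1 <= s <= 1 -> haspos_in F k (addform K s H).
  apply: seg => // s; apply: haspos_ext (pos s 1 _); last by rewrite oner_eq0 orbT.
  by move=> u v; rewrite /lin2 /addform rmorph1 mul1r addrC.
have [F4 F4P] : exists F, forall s, - 1 <= s <= 1 -> haspos_in F k (addform (negform K) s H).
  apply: seg => // [|s]; first exact: hermform_neg.
  apply: haspos_ext (pos s (- 1) _); last by rewrite oppr_eq0 oner_eq0 orbT.
  by move=> u v; rewrite /lin2 /addform /negform rmorphN1 mulN1r addrC.
exists (F1 ++ F2 ++ F3 ++ F4) => a c ac.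
have sub1 : {subset F1 <= F1 ++ F2 ++ F3 ++ F4} by move=> v vF; rewrite !mem_cat vF.
have sub2 : {subset F2 <= F1 ++ F2 ++ F3 ++ F4} by move=> v vF; rewrite !mem_cat vF orbT.
have sub3 : {subset F3 <= F1 ++ F2 ++ F3 ++ F4} by move=> v vF; rewrite !mem_cat vF !orbT.
have sub4 : {subset F4 <= F1 ++ F2 ++ F3 ++ F4} by move=> v vF; rewrite !mem_cat vF !orbT.
have ratio (x y : R) : 0 < x -> `|y| <= x -> - 1 <= y / x <= 1.
  move=> x0; rewrite ler_norml => /andP[y1 y2].
  by rewrite ler_pdivlMr // ler_pdivrMr // mulN1r y1 mul1r y2.
have [ca|ca] := leP `|c| `|a|.
  have a0 : a != 0.
    by apply: contraTneq ac => a0; move: ca; rewrite a0 normr0 normr_le0 eqxx => ->.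
  have [apos|aneg] := ltP 0 a.
    rewrite (gtr0_norm apos) in ca.
    apply: haspos_in_ext (haspos_in_scale apos (haspos_in_sub sub1 (F1P _ (ratio _ _ apos ca)))).
    by move=> u v; rewrite /lin2 /addform mulrDr mulrA -rmorphM mulrCA mulfV // mulr1.
  have an : 0 < - a by rewrite oppr_gt0 lt_neqAle a0.
  rewrite (ler0_norm aneg) in ca.
  apply: haspos_in_ext (haspos_in_scale an (haspos_in_sub sub2 (F2P _ (ratio _ _ an ca)))).
  move=> u v; rewrite /lin2 /addform /negform mulrDr mulrA -rmorphM mulrCA mulfV ?oppr_eq0 // mulr1.
  by rewrite rmorphN mulrNN.
have c0 : c != 0 by apply: contraTneq ca => ->; rewrite normr0 -leNgt.
have [cpos|cneg] := ltP 0 c.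
  rewrite (gtr0_norm cpos) in ca.
  apply: haspos_in_ext (haspos_in_scale cpos (haspos_in_sub sub3 (F3P _ (ratio _ _ cpos (ltW ca))))).
  by move=> u v; rewrite /lin2 /addform mulrDr mulrA -rmorphM mulrCA mulfV // mulr1 addrC.
have cn : 0 < - c by rewrite oppr_gt0 lt_neqAle c0.
rewrite (ler0_norm cneg) in ca.
apply: haspos_in_ext (haspos_in_scale cn (haspos_in_sub sub4 (F4P _ (ratio _ _ cn (ltW ca))))).
move=> u v; rewrite /lin2 /addform /negform mulrDr mulrA -rmorphM mulrCA mulfV ?oppr_eq0 // mulr1.
by rewrite rmorphN mulrNN addrC.
Qed.

End CompressionToScalar.

Section ScalarCompression.
Variable R : realType.
Local Notation C := R[i].
Local Notation "x %:C" := (real_complex _ x) : ring_scope.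
Variable V : lmodType C.
Variable ip : V -> V -> C.
Hypothesis ipP : is_ip ip.
Let iph := ip_herm ipP.
Let ips := ip_sesq ipP.
Local Notation hn := (hnorm ip).

Lemma rnorm_le_ReIm (z : C) : rnorm z <= `|complex.Re z| + `|complex.Im z|.
Proof.
rewrite /rnorm normc_def /= -[leRHS]ger0_norm ?addr_ge0 // -sqrtr_sqr ler_sqrt ?sqr_ge0 //.
rewrite sqrrD !real_normK ?num_real // -addrA lerD2l lerDr.
by rewrite mulrn_wge0 // mulr_ge0.
Qed.

Definition indep k (y : 'I_k -> V) : Prop := forall c, lc c y = 0 -> c = 0.

(** Taken at z = 1 / (mu - d), it sends a unit vector of value d to -1, as [neutral_family]
    requires. *)
Definition shifted (z mu : C) (b : V -> V -> C) : V -> V -> C :=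
  fun x y => z * (b x y - mu * ip x y).

Lemma sesq_shifted z mu b : sesq b -> sesq (shifted z mu b).
Proof.
move=> bs; split=> a x y v; rewrite /shifted.
  by rewrite bs.1 ips.1; ring.
by rewrite bs.2 ips.2; ring.
Qed.

Lemma orthonormal_indep k (y : 'I_k -> V) : orthonormal ip y -> indep y.
Proof.
by move=> yo c c0; apply/rowP => i; rewrite -(ip_lc_orthonormal ipP c i yo) c0 (sesq0l ips) mxE.
Qed.

(** The block is chosen orthogonal to F, so its value d is known only after F; the hypothesis
    therefore asks that one F serve every d near -1 attained on a unit vector of M. *)
Lemma neutral_at k b mu F (M : V -> Prop) (eta : R) : sesq b -> essential ip b (-1) ->
  fincodim M -> 0 < eta ->
  (forall d x, `|complex.Re (d + 1)| < eta -> `|complex.Im (d + 1)| < eta ->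
     M x -> ip x x = 1 -> b x x = d ->
     d != mu /\ forall s, haspos_in F k (addform (hre (shifted (mu - d)^-1 mu b)) s
                                                 (him (shifted (mu - d)^-1 mu b)))) ->
  exists2 y : 'I_k -> V, indep y & gram b y y = mu *: gram ip y y.
Proof.
case: k => [|k] bs ess MF e0 posd.
  exists (fun=> 0); first by move=> c _; apply: thinmx0.
  by apply/matrixP => -[].
have [n [e eo eF]] := gram_schmidt ipP F.
have MF' := fincodimI MF (fincodimI (fincodim_forall (fun i => fincodim_kerl (e i) ips))
  (fincodimI (fincodim_forall (fun i => fincodim_kerl (e i) bs))
   (fincodim_forall (fun i => fincodim_kerr (e i) bs)))).
have [d [w [wo wM wb d1 d2]]] := scalar_block ipP bs k.+1 ess MF' e0.
rewrite opprK in d1 d2.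
have w1 : ip (w ord0) (w ord0) = 1 by case: wo => ->.
have wd : b (w ord0) (w ord0) = d by have /matrixP/(_ ord0 ord0) := wb; rewrite !mxE.
have [dmu pos] := posd d (w ord0) d1 d2 (wM ord0).1 w1 wd.
have dm : mu - d != 0 by rewrite subr_eq0 eq_sym.
have [||y yi yb] := neutral_family ipP (sesq_shifted (mu - d)^-1 mu bs) eo eF pos (w := w).
- apply/matrixP => i j; rewrite !mxE /shifted.
  have := congr1 (fun A : 'M_k.+1 => A i j) wb; rewrite !mxE => ->.
  have /(orthonormal_gram ip) := wo => /(congr1 (fun A : 'M_k.+1 => A i j)); rewrite !mxE => ->.
  case: eqP => _; first by rewrite !mulr1n mulr1; field.
  by rewrite !mulr0n; ring.
- move=> i j; have [_ [h1 [h2 h3]]] := wM i; rewrite /shifted h1 h2 h3.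
  by rewrite iph.2 h1 conjc0; split=> //; ring.
exists y => //; apply/matrixP => i j; rewrite !mxE.
have := congr1 (fun A : 'M_k.+1 => A i j) yb; rewrite !mxE /shifted => /eqP.
by rewrite mulf_eq0 invr_eq0 (negPf dm) /= subr_eq0 => /eqP.
Qed.

Section Normalized.
Variables (b : V -> V -> C) (k : nat).
Hypotheses (bs : sesq b) (ess : essential ip b (-1)).
Let H := hre b.
Let K := him b.
Let Hh : hermform H := hermform_hre bs.
Let Kh : hermform K := hermform_him bs.

Definition form3 (al be ga : R) := addform (lin2 al H be K) ga ip.

Lemma hermform_form3 al be ga : hermform (form3 al be ga).
Proof. by apply: hermform_add => //; apply: hermform_lin2. Qed.

Hypothesis slack : forall al be ga, 0 < ga -> haspos k (form3 al be ga).

(** On a scalar block of value near -1, H is near -1 and K near 0, so the form is near ga - al. *)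
Lemma haspos_essential_side al be ga : al < ga -> haspos k (form3 al be ga).
Proof.
move=> ag; pose D := `|al| + `|be| + 1.
have D0 : 0 < D by rewrite ltr_wpDl // addr_ge0.
have e0 : 0 < (ga - al) / D by rewrite divr_gt0 ?subr_gt0.
have [d [w [wo _ wb d1 d2]]] := scalar_block ipP bs k ess (fincodimT V) e0.
exists w; apply: (@posfam_scalar _ _ _ _ _ (al * complex.Re d + be * complex.Im d + ga)).
- exact: hermform_form3.
- rewrite opprK in d1 d2.
  have {}d2 : `|complex.Im d| < (ga - al) / D by move: d2; rewrite raddfD /= addr0.
  have {}d1 : `|complex.Re d + 1| < (ga - al) / D by move: d1; rewrite raddfD.
  have a1 : `|al * (complex.Re d + 1) + be * complex.Im d| < ga - al.
    apply: le_lt_trans (ler_normD _ _) _; rewrite !normrM.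
    apply: (@le_lt_trans _ _ ((`|al| + `|be|) * ((ga - al) / D))).
      by rewrite mulrDl lerD // ler_wpM2l // ltW.
    rewrite mulrCA -[ltRHS]mulr1 ltr_pM2l ?subr_gt0 // ltr_pdivrMr // mul1r.
    by rewrite /D ltrDl.
  move: a1; rewrite ltr_norml => /andP[a1 _]; lra.
- apply/matrixP => i j; rewrite !mxE /form3 /addform /lin2.
  have /(orthonormal_gram ip)/(congr1 (fun A : 'M_k => A i j)) := wo; rewrite !mxE => ->.
  have bE i' j' : b (w i') (w j') = d *+ (i' == j').
    by have := congr1 (fun A : 'M_k => A i' j') wb; rewrite !mxE.
  case: eqVneq => [<-|ij].
    rewrite /H /K hre_quad him_quad bE eqxx !mulr1n mulr1 !rmorphD !rmorphM.
    by [].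
  have ji : (j == i) = false by rewrite eq_sym (negPf ij).
  by rewrite /H /K /hre /him !bE (negPf ij) ji !mulr0n conjc0 subr0 addr0 !mul0r; ring.
Qed.

(* The target is mu = - t - i sg eta. The only directions in which neither the slack
   nor the essential value -1 gives positivity are close to that of - sg K, where the
   assumption persists by openness. *)
Lemma full_circle (sg delta : R) : sg ^+ 2 = 1 -> haspos k (form3 0 (- sg) 0) -> 0 < delta ->
  exists t eta, [/\ 0 < t < delta, 0 < eta < delta &
    forall al be, (al != 0) || (be != 0) -> haspos k (form3 al be (al * t + be * (sg * eta)))].
Proof.
move=> sg2 Kpos d0.
have [y yE] := haspos_normalize (hermform_form3 0 (- sg) 0) Kpos.
pose N := gramnorm H y + gramnorm ip y + 1.
have N0 : 1 <= N by rewrite /N lerDr addr_ge0 ?gramnorm_ge0.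
(* The ratio eta / t = 1 / (2 N) bounds the coefficients of H and [ip] in the remaining directions,
   once divided by |be|; this is within reach of [posfam_perturb]. The bound t <= 1 / 2 is for the
   lower estimate of a'. *)
pose t := Num.min (delta / 2) (1 / 2); pose eta := t / (2 * N).
have t0 : 0 < t by rewrite lt_min !divr_gt0.
have td : t <= delta / 2 by rewrite ge_min lexx.
have t2 : t <= 1 / 2 by rewrite ge_min lexx orbT.
have eta0 : 0 < eta by rewrite divr_gt0 //; lra.
have etaN : 2 * N * eta = t by rewrite /eta; field; lra.
have etat : eta <= t by rewrite -etaN; nra.
exists t, eta; split; first by apply/andP; split; lra.
  by apply/andP; split; lra.
have sg0 : sg != 0 by apply: contraTneq isT => s0; move: sg2; rewrite s0 expr0n => /eqP; rewrite eq_sym oner_eq0.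
move=> al be ne; pose be' := be * sg.
have beE : be = be' * sg by rewrite /be' -mulrA -expr2 sg2 mulr1.
set ga := al * t + _; have gaE : ga = al * t + be' * eta by rewrite /ga /be' mulrA.
have [g0|g0] := ltP 0 ga; first exact: slack.
have [ga1|ga1] := ltP al ga; first exact: haspos_essential_side.
have bneg : be' < 0.
  rewrite ltNge; apply/negP => be0.
  have [a0|a0] := leP al 0; last by nra.
  have [e|a1] := eqVneq al 0; last first.
    have : al < 0 by rewrite lt_neqAle a1.
    nra.
  have : 0 < be'.
    rewrite lt_neqAle be0 andbT eq_sym /be' mulf_neq0 //.
    by move: ne; rewrite e eqxx.
  nra.
pose a' := al / - be'.
have bn : 0 < - be' by rewrite oppr_gt0.
have alE : al = - be' * a' by rewrite /a' mulrCA mulfV ?mulr1 // gt_eqF.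
pose g' := a' * t - eta.
have gaE' : ga = - be' * g' by rewrite gaE {1}alE /g'; ring.
have h1 : g' <= 0 by move: g0; rewrite gaE' pmulr_rle0.
have h2 : g' <= a' by move: ga1; rewrite gaE' alE ler_pM2l.
pose X := (2 * N)^-1; have X0 : 0 < X by rewrite invr_gt0; lra.
have XN : 2 * N * X = 1 by rewrite mulfV //; lra.
have Xt : X * t = eta by rewrite /eta mulrC.
have h3 : - (2 * eta) <= a' by rewrite /g' in h1 h2; nra.
have h4 : 2 * eta <= X by rewrite -Xt; nra.
have aX : `|a'| <= X.
  rewrite ler_norml; apply/andP; split; first by lra.
  by rewrite -(ler_pM2r t0) Xt; move: h1; rewrite /g' subr_le0.
have gX : `|g'| <= X.
  rewrite ler_norml; apply/andP; split; last by lra.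
  rewrite /g'; nra.
have small : `|a'| * gramnorm H y + `|g'| * gramnorm ip y < 1.
  have H0 := gramnorm_ge0 H y; have I0 := gramnorm_ge0 ip y.
  apply: (@le_lt_trans _ _ (X * (gramnorm H y + gramnorm ip y))).
    by rewrite mulrDr lerD // ler_wpM2r.
  by move: XN; rewrite /N; nra.
have pf := posfam_perturb (hermform_form3 0 (- sg) 0) Hh iph yE small.
apply: haspos_ext (haspos_scale bn (ex_intro _ y pf)) => u v.
have gen (x a g : R) : x%:C * addform (addform (form3 0 (- sg) 0) a H) g ip u v =
    form3 (x * a) (- x * sg) (x * g) u v.
  by rewrite /form3 /addform /lin2 !rmorphM !rmorphN rmorph0 /=; ring.
by rewrite gen opprK -beE -alE -gaE'.
Qed.


Lemma shifted_parts z mu x y :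
  hre (shifted z mu b) x y = (complex.Re z)%:C * form3 1 0 (- complex.Re mu) x y
    - (complex.Im z)%:C * form3 0 1 (- complex.Im mu) x y /\
  him (shifted z mu b) x y = (complex.Im z)%:C * form3 1 0 (- complex.Re mu) x y
    + (complex.Re z)%:C * form3 0 1 (- complex.Im mu) x y.
Proof.
pose c x y := b x y - mu * ip x y.
have [h1 h2] : hre c x y = form3 1 0 (- complex.Re mu) x y /\
    him c x y = form3 0 1 (- complex.Im mu) x y.
  rewrite /form3 /addform /lin2 /H /K !hreE !himE /c (iph.2 x y).
  case: (mu) => m n; case: (b x y) => a1 a2; case: (b y x) => b1 b2; case: (ip x y) => c1 c2.
  by split; apply/eqP; rewrite eq_complex /=; apply/andP; split; apply/eqP; field.
by rewrite -h1 -h2 /shifted -hre_scale -him_scale.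
Qed.

Lemma indefinite_case (sg delta : R) : sg ^+ 2 = 1 -> haspos k (form3 0 (- sg) 0) -> 0 < delta ->
  exists2 mu, rnorm mu < delta &
    exists2 y : 'I_k -> V, indep y & gram b y y = mu *: gram ip y y.
Proof.
(* Each of the two components of mu gets half of delta; the bound 1 / 4 keeps mu away from d, whose
   real part is below - 3 / 4. *)
move=> sg2 Kpos d0; pose de := Num.min (delta / 2) (1 / 4).
have de0 : 0 < de by rewrite lt_min !divr_gt0.
have [t [eta [/andP[t0 td] /andP[e0 ed] circ]]] := full_circle sg2 Kpos de0.
move: td ed; rewrite !lt_min => /andP[td t4] /andP[ed e4].
pose mu : C := Complex (- t) (- (sg * eta)).
have Hh1 : hermform (form3 1 0 t) by apply: hermform_form3.
have Kh1 : hermform (form3 0 1 (sg * eta)) by apply: hermform_form3.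
have [a c ac|F FP] := @haspos_circle _ _ k _ _ Hh1 Kh1.
  apply: haspos_ext (circ a c ac) => u v.
  by rewrite /form3 /addform /lin2 rmorphD !rmorphM rmorph0 rmorph1 /=; ring.
exists mu.
  apply: le_lt_trans (rnorm_le_ReIm mu) _; rewrite /mu /= !normrN normrM.
  have -> : `|sg| = 1 by apply/eqP; rewrite -(eqrXn2 (n := 2)) // -normrX sg2 normr1 expr1n.
  rewrite mul1r !gtr0_norm //; lra.
have q4 : 0 < 1 / 4 :> R by rewrite divr_gt0.
apply: (neutral_at (F := F) bs ess (fincodimT V) q4) => d x d1 d2 _ _ _.
have dmu : mu - d != 0.
  apply: contraTneq d1 => /eqP; rewrite subr_eq0 => /eqP <-.
  rewrite /mu /= -leNgt; apply: le_trans (ler_norm _); lra.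
split; first by rewrite eq_sym -subr_eq0.
move=> s; set z := (mu - d)^-1; set p := complex.Re z; set q := complex.Im z.
(* Up to conjugation these are the coordinates of z (1 - i s), a product of nonzero numbers. *)
have pq : (p + s * q != 0) || (s * p - q != 0).
  rewrite -negb_and; apply/negP => /andP[/eqP e1 /eqP e2].
  have q0 : q * (1 + s ^+ 2) = 0 by rewrite -[RHS]subr0 -{2}e2 (_ : p = - (s * q)); [ring | lra].
  have {}q0 : q = 0.
    move/eqP: q0; rewrite mulf_eq0 => /orP[/eqP //|/eqP h].
    by have := sqr_ge0 s; lra.
  have p0 : p = 0 by rewrite q0 mulr0 addr0 in e1.
  have : z = 0 by apply/eqP; rewrite eq_complex -/p -/q p0 q0 /= eqxx.
  by apply/eqP; rewrite invr_eq0.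
apply: haspos_in_ext (FP _ _ pq) => u v; rewrite /addform.
have [-> ->] := shifted_parts z mu u v; rewrite -/p -/q /mu /= !opprK /lin2.
by rewrite !rmorphD !rmorphN !rmorphM /=; ring.
Qed.

Variable B : R.
Hypotheses (B0 : 0 <= B) (HB : forall x y, rnorm (H x y) <= B * hn x * hn y).

(** Here mu = - t moves along the real axis only. Blocks are taken in the radical M of K, so d is
    real and 1 / (mu - d) is a positive factor. What remains is the pencil (H + t) + s K, served by
    F1 for large s, F2 for large - s and F3 in between. *)
Lemma finite_rank_case (delta : R) : ~ haspos k K -> ~ haspos k (negform K) -> 0 < delta ->
  exists2 mu, rnorm mu < delta &
    exists2 y : 'I_k -> V, indep y & gram b y y = mu *: gram ip y y.
Proof.
move=> Kp Kn d0; pose t := Num.min (delta / 2) (1 / 4).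
have t0 : 0 < t by rewrite lt_min !divr_gt0.
have td : t <= delta / 2 by rewrite ge_min lexx.
have t4 : t <= 1 / 4 by rewrite ge_min lexx orbT.
have pos1 s e : 0 < e -> haspos k (addform (addform H e ip) s K).
  move=> e0; apply: haspos_ext (slack 1 s e0) => u v.
  by rewrite /form3 /addform /lin2 rmorph1; ring.
have [S1 [F1 F1P]] := finite_rank_side ipP Hh Kh B0 HB Kp Kn pos1 t0.
have [M MF MK] := finite_rank_null Kh Kp Kn.
have Kn' : ~ haspos k (negform (negform K)).
  by move=> h; apply: Kp; apply: haspos_ext h => u v; rewrite /negform opprK.
have pos2 s e : 0 < e -> haspos k (addform (addform H e ip) s (negform K)).
  move=> e0; apply: haspos_ext (pos1 (- s) e e0) => u v.
  by rewrite /addform /negform rmorphN mulrN mulNr.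
have [S2 [F2 F2P]] := finite_rank_side ipP Hh (hermform_neg Kh) B0 HB Kn Kn' pos2 t0.
pose S := `|S1| + `|S2|.
have Hth : hermform (addform H t ip) by apply: hermform_add.
have [|s _|F3 F3P] := @haspos_segment _ _ k _ _ (- S) S Hth Kh.
- have : 0 <= S by rewrite addr_ge0.
  lra.
- exact: pos1.
pose F := F1 ++ F2 ++ F3.
have FP s : haspos_in F k (addform (addform H t ip) s K).
  have [s1|s1] := leP S1 s.
    by apply: haspos_in_sub (F1P s s1) => v vF; rewrite mem_cat vF.
  have [s2|s2] := leP S2 (- s).
    apply: haspos_in_sub (_ : haspos_in F2 k _); first by move=> v vF; rewrite !mem_cat vF orbT.
    apply: haspos_in_ext (F2P _ s2) => u v.
    by rewrite /addform /negform rmorphN mulrNN.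
  apply: haspos_in_sub (F3P s _); first by move=> v vF; rewrite !mem_cat vF !orbT.
  have := ler_norm S1; have := ler_norm S2; have := normr_ge0 S1; have := normr_ge0 S2.
  rewrite /S => *; apply/andP; split; lra.
exists (- t%:C).
  rewrite /rnorm normrN ger0_norm ?ler0c ?ltW //=; lra.
have q4 : 0 < 1 / 4 :> R by rewrite divr_gt0.
apply: (neutral_at (F := F) bs ess MF q4) => d x d1 d2 Mx x1 bxd.
have dIm : complex.Im d = 0.
  have := MK x x Mx Mx; rewrite /K him_quad bxd => /eqP.
  by rewrite -[0](rmorph0 (real_complex R)) (inj_eq (@complexI R)) => /eqP.
have dE : d = (complex.Re d)%:C by apply/eqP; rewrite eq_complex /= dIm !eqxx.
move: d1; rewrite raddfD /= => /ltr_normlP[_ d1].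
have p0 : 0 < - t - complex.Re d by lra.
have zE : (- t%:C - d)^-1 = ((- t - complex.Re d)^-1)%:C.
  by rewrite {1}dE fmorphV rmorphB rmorphN.
split.
  rewrite -subr_eq0 dE -rmorphN -rmorphB -[0](rmorph0 (real_complex R)) (inj_eq (@complexI R)).
  by lra.
move=> s; rewrite zE.
have p1 : 0 < (- t - complex.Re d)^-1 by rewrite invr_gt0.
apply: haspos_in_ext (haspos_in_scale p1 (FP s)) => u v; rewrite /addform.
have [-> ->] := shifted_parts ((- t - complex.Re d)^-1)%:C (- t%:C) u v.
set w := (- t - _)^-1.
have -> : complex.Im w%:C = 0 by [].
have -> : complex.Im (- t%:C) = 0 by rewrite /= oppr0.
have -> : complex.Re w%:C = w by [].
have -> : complex.Re (- t%:C) = - t by [].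
by rewrite opprK oppr0 /form3 /addform /lin2 !rmorph0 rmorph1; ring.
Qed.

Lemma normalized_scalar (delta : R) : 0 < delta ->
  exists2 mu, rnorm mu < delta &
    exists2 y : 'I_k -> V, indep y & gram b y y = mu *: gram ip y y.
Proof.
move=> d0; have [Kp|Kp] := pselect (haspos k K).
  apply: (@indefinite_case (- 1)) => //; first by rewrite sqrrN expr1n.
  apply: haspos_ext Kp => u v.
  by rewrite /form3 /addform /lin2 opprK !rmorph0 rmorph1; ring.
have [Kn|Kn] := pselect (haspos k (negform K)); last exact: finite_rank_case.
apply: (@indefinite_case 1) => //; first by rewrite expr1n.
apply: haspos_ext Kn => u v.
by rewrite /form3 /addform /lin2 /negform !rmorph0 rmorphN1; ring.
Qed.

End Normalized.
End ScalarCompression.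

(** * From families of vectors to the higher rank numerical range *)

Section HigherRankRange.
Variable R : realType.
Local Notation C := R[i].
Local Notation "x %:C" := (real_complex _ x) : ring_scope.
Variable V : lmodType C.
Variable ip : V -> V -> C.
Hypothesis ipP : is_ip ip.
Let iph := ip_herm ipP.
Let ips := ip_sesq ipP.
Local Notation hn := (hnorm ip).

Lemma rnormM (z w : C) : rnorm (z * w) = rnorm z * rnorm w.
Proof. by apply: complexI; rewrite rmorphM /= !rnormE normrM. Qed.

Lemma rnorm_gt0 (z : C) : (0 < rnorm z) = (z != 0).
Proof. by rewrite -ltcR rnormE normr_gt0. Qed.

Lemma Re_abs_le_rnorm (z : C) : `|complex.Re z| <= rnorm z.
Proof. by rewrite -lecR rnormE; apply: normc_ge_Re. Qed.

Lemma Im_abs_le_rnorm (z : C) : `|complex.Im z| <= rnorm z.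
Proof.
rewrite -lecR rnormE normc_def lecR -sqrtr_sqr ler_sqrt ?addr_ge0 ?sqr_ge0 //.
by rewrite lerDr sqr_ge0.
Qed.

Lemma essential_scale (b : V -> V -> C) (w z : C) :
  essential ip b w -> essential ip (fun x y => z * b x y) (z * w).
Proof.
move=> ess M eta MF e0; pose D := 2 * (rnorm z + 1).
have z0 := rnorm_ge0 z; have D0 : 0 < D by rewrite /D; lra.
have [x [Mx x1 r1 r2]] := ess M _ MF (divr_gt0 e0 D0).
have small : rnorm (z * b x x - z * w) < eta.
  rewrite -mulrBr rnormM; have := rnorm_le_ReIm (b x x - w) => h.
  apply: (@le_lt_trans _ _ ((rnorm z + 1) * rnorm (b x x - w))).
    by rewrite ler_wpM2r ?rnorm_ge0 // lerDl.
  have -> : eta = (rnorm z + 1) * (eta / D + eta / D) by rewrite /D; field; lra.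
  by rewrite ltr_pM2l; lra.
exists x; split=> //; apply: le_lt_trans small; first exact: Re_abs_le_rnorm.
exact: Im_abs_le_rnorm.
Qed.

Theorem scalar_compression k (b : V -> V -> C) (B : R) :
  (exists e : nat -> V, orthonormal ip e) -> sesq b -> 0 <= B ->
  (forall x y, rnorm (b x y) <= B * hn x * hn y) ->
  (forall (z : C) (ga : R), 0 < ga -> haspos k (addform (hre (fun x y => z * b x y)) ga ip)) ->
  forall delta : R, 0 < delta -> exists2 mu, rnorm mu < delta &
    exists2 y : 'I_k -> V, indep y & gram b y y = mu *: gram ip y y.
Proof.
move=> infdim bs B0 bB slack delta d0.
have [|w ess] := @essential_exists _ _ _ ipP infdim b B.
  move=> x x1; have := bB x x; suff -> : hn x = 1 by rewrite !mulr1.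
  by rewrite /hnorm x1 sqrtr1.
have [w0|w0] := eqVneq w 0.
  have d20 : 0 < delta / 2 by rewrite divr_gt0.
  have [d [y [yo _ yb d1 d2]]] := scalar_block ipP bs k ess (fincodimT V) d20.
  exists d.
    rewrite w0 subr0 in d1 d2; apply: le_lt_trans (rnorm_le_ReIm d) _; lra.
  exists y; first exact: orthonormal_indep yo.
  by have /(orthonormal_gram ip) -> := yo; rewrite yb scalemx1.
pose z := - w^-1; pose b1 x y := z * b x y.
have b1s : sesq b1 by split=> a x y v; rewrite /b1 ?bs.1 ?bs.2; ring.
have ess1 : essential ip b1 (-1).
  by have := essential_scale z ess; rewrite /z mulNr mulVf.
have slack1 al be ga : 0 < ga -> haspos k (form3 ip b1 al be ga).
  (* The hermitian part of (al - i be) (H + i K) is al H + be K. *)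
  move=> g0; apply: haspos_ext (slack (Complex al (- be) * z) ga g0) => u v.
  rewrite /form3 /addform; congr (_ + _).
  have -> : hre (fun x y => Complex al (- be) * z * b x y) u v =
      hre (fun x y => Complex al (- be) * b1 x y) u v.
    by rewrite /hre /b1 !mulrA.
  by rewrite hre_scale /lin2 /= rmorphN mulNr opprK.
have B10 : 0 <= rnorm z * B by rewrite mulr_ge0 ?rnorm_ge0.
have HB x y : rnorm (hre b1 x y) <= rnorm z * B * hn x * hn y.
  have e1 : rnorm (b1 x y) <= rnorm z * B * hn x * hn y.
    by rewrite /b1 rnormM -!mulrA ler_wpM2l ?rnorm_ge0 // !mulrA.
  have e2 : rnorm (conjc (b1 y x)) <= rnorm z * B * hn x * hn y.
    rewrite /rnorm normcJ -/(rnorm _) /b1 rnormM -!mulrA ler_wpM2l ?rnorm_ge0 //.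
    by rewrite [hn x * _]mulrC !mulrA.
  rewrite hreE rnormM.
  have -> : rnorm ((2^-1 : R)%:C) = 2^-1 by rewrite /rnorm ger0_norm // ler0c invr_ge0.
  have : rnorm (b1 x y + conjc (b1 y x)) <= rnorm (b1 x y) + rnorm (conjc (b1 y x)).
    by rewrite -lecR rmorphD /= !rnormE ler_normD.
  lra.
have nw : 0 < rnorm w by rewrite rnorm_gt0.
have [mu mud [y yi yb]] := normalized_scalar ipP b1s ess1 slack1 B10 HB (divr_gt0 d0 nw).
exists (- w * mu).
  by rewrite mulNr /rnorm normrN -/(rnorm _) rnormM mulrC -ltr_pdivlMr.
exists y => //; apply/matrixP => i j.
have := congr1 (fun A : 'M_k => A i j) yb; rewrite !mxE /b1 /z => e.
by rewrite -mulrA -e mulrA mulrNN mulfV // mul1r.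
Qed.

Lemma linearf_lc (T : V -> V) k (c : 'rV_k) (x : 'I_k -> V) : linearf T ->
  T (lc c x) = lc c (fun i => T (x i)).
Proof.
move=> Tl; have TD u v : T (u + v) = T u + T v.
  by have := Tl 1 u v; rewrite !scale1r.
have T0 : T 0 = 0.
  by have := TD 0 0; rewrite addr0 => /eqP; rewrite -subr_eq0 opprD addNKr oppr_eq0 => /eqP.
rewrite /lc (big_morph T TD T0); apply: eq_bigr => i _.
by have := Tl (c 0 i) (x i) 0; rewrite !addr0 T0 addr0.
Qed.

Lemma projection_bounded (P : V -> V) : linearf P -> is_adjoint ip P P ->
  (forall x, P (P x) = P x) -> bounded_op ip P.
Proof.
move=> Pl Pa PP; split=> //; exists 1 => x; rewrite mul1r.
have [e|ne] := eqVneq (P x) 0; first by rewrite e hnorm0 ?hnorm_ge0.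
have n0 := hnorm_gt0 ipP ne.
rewrite -(ler_pM2l n0) -expr2 hnorm_sqr // Pa PP.
have -> : ip x (P x) = conjc (ip (P x) x) by rewrite iph.2.
apply: le_trans (Re_le_rnorm _) _; rewrite /rnorm normcJ -/(rnorm _).
exact: cauchy_schwarz.
Qed.

(** The relation is sesquilinear in y, so it survives orthonormalization; P projects onto the
    resulting span. *)
Lemma higher_rank_nr_family (T : V -> V) k (y : 'I_k -> V) mu : linearf T -> indep y ->
  (forall i j, ip (T (y i)) (y j) = mu * ip (y i) (y j)) ->
  higher_rank_nr ip T (Some k) mu.
Proof.
move=> Tl yi yT.
have bs : sesq (fun u v => ip (T u) v).
  by split=> a x u v; [rewrite Tl ips.1 | rewrite ips.2].
have ypos : posfam ip y.
  move=> c c0; rewrite ip_hnorm // -[0](rmorph0 (real_complex R)) ltcR exprn_gt0 // hnorm_gt0 //.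
  by apply: contraNneq c0 => /yi ->.
have [Q QE] := posfam_normalize iph ypos.
pose e i := lc (row i Q) y.
have eo : orthonormal ip e by apply/(orthonormal_gram ip).
have eT i j : ip (T (e i)) (e j) = mu *+ (i == j).
  have -> : ip (T (e i)) (e j) = mu * ip (e i) (e j).
    have := gram_lc Q Q y y bs.
    have -> : gram (fun u v => ip (T u) v) y y = mu *: gram ip y y.
      by apply/matrixP => i' j'; rewrite !mxE yT.
    rewrite -scalemxAr -scalemxAl -gram_lc // => /matrixP/(_ i j).
    by rewrite !mxE.
  have /matrixP/(_ i j) := QE; rewrite !mxE => ->.
  by case: eqP => _; rewrite ?mulr1 ?mulr0.
pose P x := lc (\row_i ip x (e i)) e.
have Pl : linearf P.
  move=> a x u; rewrite /P -lcZl -lcDl; congr lc; apply/rowP => i.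
  by rewrite !mxE ips.1.
have Pe x i : ip (P x) (e i) = ip x (e i) by rewrite ip_lc_orthonormal // mxE.
have PP x : P (P x) = P x.
  by rewrite /P; congr lc; apply/rowP => i; rewrite !mxE -/(P x) Pe.
have Pa : is_adjoint ip P P.
  have aux x u : ip (P x) u = ip (P x) (P u).
    rewrite {1}/P sesq_lcl // [in RHS]/P sesq_lcl //; apply: eq_bigr => i _; congr (_ * _).
    by rewrite [LHS]iph.2 [RHS]iph.2 Pe.
  by move=> x u; rewrite aux [RHS]iph.2 [ip (P u) x]aux -iph.2.
exists P; split.
- by split=> //; apply: projection_bounded.
- exists e; split=> //; apply/seteqP; split=> x /=.
    move=> [u _ <-]; exists (fun i => ip u (e i)).
    by apply: eq_bigr => i _; rewrite mxE.
  move=> [c ->]; exists (lc (\row_i c i) e) => //.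
  rewrite /P; transitivity (lc (\row_i c i) e).
    by congr lc; apply/rowP => i; rewrite mxE ip_lc_orthonormal.
  by apply: eq_bigr => i _; rewrite mxE.
- move=> x; rewrite -lcZl {1}/P; congr lc; apply/rowP => i; rewrite !mxE.
  rewrite {1}/P linearf_lc // sesq_lcl // (bigD1 i) //= big1 ?addr0.
    by rewrite eT eqxx mulr1n mxE mulrC.
  by move=> j ji; rewrite eT (negPf ji) mulr0.
Qed.

End HigherRankRange.

(** * Unitary dilations *)

Section Unitaries.
Variable R : realType.
Local Notation C := R[i].
Local Notation "x %:C" := (real_complex _ x) : ring_scope.
Variable V : lmodType C.
Variable ip : V -> V -> C.
Hypothesis ipP : is_ip ip.
Let iph := ip_herm ipP.
Let ips := ip_sesq ipP.

Lemma ip_ext x y : (forall z, ip z x = ip z y) -> x = y.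
Proof.
move=> e; apply/eqP; rewrite -subr_eq0; apply/eqP; case: (ipP) => _ _; apply.
by rewrite (sesqBr ips) e subrr.
Qed.

Lemma linearfD (T : V -> V) x y : linearf T -> T (x + y) = T x + T y.
Proof. by move=> Tl; have := Tl 1 x y; rewrite !scale1r. Qed.

Lemma linearf0 (T : V -> V) : linearf T -> T 0 = 0.
Proof.
move=> Tl; have := linearfD 0 0 Tl; rewrite addr0 => /eqP.
by rewrite -subr_eq0 opprD addNKr oppr_eq0 => /eqP.
Qed.

Lemma linearfZ (T : V -> V) a x : linearf T -> T (a *: x) = a *: T x.
Proof. by move=> Tl; have := Tl a x 0; rewrite !addr0 linearf0 // addr0. Qed.

Lemma linearfB (T : V -> V) x y : linearf T -> T (x - y) = T x - T y.
Proof. by move=> Tl; rewrite linearfD // -scaleN1r linearfZ // scaleN1r. Qed.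

Lemma adjoint_sym (T S : V -> V) x y : is_adjoint ip T S -> ip (S x) y = ip x (T y).
Proof. by move=> TS; rewrite iph.2 -TS -iph.2. Qed.

Lemma adjoint_linear (T S : V -> V) : is_adjoint ip T S -> linearf S.
Proof.
move=> TS a x y; apply: ip_ext => z.
by rewrite -TS !ips.2 !TS.
Qed.

Lemma adjoint_unique (T S S' : V -> V) x : is_adjoint ip T S -> is_adjoint ip T S' -> S x = S' x.
Proof. by move=> h h'; apply: ip_ext => z; rewrite -h h'. Qed.

Lemma unitary_of_isometry (U : V -> V) : linearf U ->
  (forall x y, ip (U x) (U y) = ip x y) -> (forall y, exists x, U x = y) ->
  bounded_op ip U /\
  exists Us, [/\ is_adjoint ip U Us, (forall w, U (Us w) = w) & (forall w, Us (U w) = w)].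
Proof.
move=> Ul iso surj; split.
  by split=> //; exists 1 => x; rewrite mul1r /hnorm iso.
have [Us UUs] := choice surj; exists Us; split=> // [x y|w].
  by rewrite -{1}(UUs y) iso.
apply/eqP; rewrite -subr_eq0; apply/eqP; case: (ipP) => _ _; apply.
by rewrite -iso linearfB // UUs subrr (sesq0l ips).
Qed.

Lemma zero_of_small_pairing (x v : V) (A : set V) : nclosure ip A v ->
  (forall a, A a -> ip x a = 0) -> ip x v = 0.
Proof.
move=> Av xA; apply/eqP; rewrite -normr_eq0 -rnormE -[0](rmorph0 (real_complex R)) (inj_eq (@complexI R)).
rewrite eq_le rnorm_ge0 andbT; apply/ler_addgt0Pr => eps e0; rewrite add0r.
have h0 := hnorm_ge0 ip x.
have [a Aa va] := Av (eps / (hnorm ip x + 1)) (divr_gt0 e0 (ltr_wpDl h0 ltr01)).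
rewrite -[ip x v]subr0 -(xA a Aa) -(sesqBr ips); apply: le_trans (cauchy_schwarz ipP _ _) _.
have h1 := hnorm_ge0 ip (v - a).
have : hnorm ip (v - a) * (hnorm ip x + 1) < eps by rewrite -ltr_pdivlMr // ltr_wpDl.
nra.
Qed.

End Unitaries.

Section DirectSum.
Variable R : realType.
Local Notation C := R[i].
Local Notation "x %:C" := (real_complex _ x) : ring_scope.
Variable V : lmodType C.
Variable ip : V -> V -> C.
Hypothesis ipP : is_ip ip.
Let iph := ip_herm ipP.
Let ips := ip_sesq ipP.
Variable N : nat.
Local Notation K := (V * 'cV[C]_N)%type.
Local Notation ipK := (ip_sum ip (N:=N)).

Lemma is_ip_sum : is_ip ipK.
Proof.
have sq0 (z : C) : 0 <= z * conjc z by rewrite -sqr_normc exprn_ge0.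
case: (ipP) => _ p0 pd; split.
- split=> [a x y z|x y]; rewrite /ip_sum /=.
    rewrite ips.1 mulrDr addrACA mulr_sumr -big_split /=; congr (_ + _ + _).
    by apply: eq_bigr => i _; rewrite !mxE; ring.
  rewrite rmorphD rmorph_sum /= -iph.2; congr (_ + _); apply: eq_bigr => i _.
  by rewrite rmorphM /= conjcK mulrC.
- by move=> x; rewrite addr_ge0 // sumr_ge0.
- move=> [x u] /eqP; rewrite /ip_sum /= paddr_eq0 ?sumr_ge0 // => /andP[/eqP /pd -> s0].
  congr (_, _); apply/colP => i; rewrite mxE.
  move: s0; rewrite psumr_eq0 // => /allP /(_ i (mem_index_enum _)) /=.
  by rewrite mulf_eq0 conjc_eq0 orbb => /eqP.
Qed.

Lemma ip_sum_l x (w : K) : ipK (x, 0) w = ip x w.1.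
Proof. by rewrite /ip_sum big1 ?addr0 // => i _; rewrite mxE mul0r. Qed.

Lemma fst_lc k (c : 'rV[C]_k) (g : 'I_k -> K) : (lc c g).1 = lc c (fun i => (g i).1).
Proof. by rewrite /lc (big_morph (fun w : K => w.1) (fun x y => erefl) erefl). Qed.

Lemma snd_lc k (c : 'rV[C]_k) (g : 'I_k -> K) : (lc c g).2 = \sum_i c 0 i *: (g i).2.
Proof. by rewrite /lc (big_morph (fun w : K => w.2) (fun x y => erefl) erefl). Qed.

End DirectSum.

Section Defect.
Variable R : realType.
Local Notation C := R[i].
Local Notation "x %:C" := (real_complex _ x) : ring_scope.
Variable V : lmodType C.
Variable ip : V -> V -> C.
Hypothesis ipP : is_ip ip.
Let iph := ip_herm ipP.
Let ips := ip_sesq ipP.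
Let ipd : forall x, ip x x = 0 -> x = 0. Proof. by case: ipP. Qed.

Variable N : nat.

(** The content of [defect_number_eq], whose own adjoint is identified with a given S. *)
Definition defect_data (T S D : V -> V) (e : 'I_N -> V) : Prop :=
  [/\ linearf D, is_adjoint ip D D, (forall x, D (D x) = x - S (T x)), orthonormal ip e &
    nclosure ip (range D) = fspan e].

Lemma defect_number_data T S : is_adjoint ip T S -> defect_number_eq ip T N ->
  exists D e, defect_data T S D e.
Proof.
move=> TS [D [[S' [TS' [Dl _] Da _ DD] [e [eo De]]]]].
by exists D, e; split=> // x; rewrite DD (adjoint_unique ipP (T x) TS' TS).
Qed.

Section Data.
Variables (T S D : V -> V) (e : 'I_N -> V).
Hypotheses (TS : is_adjoint ip T S) (Sl : linearf S) (Tl : linearf T).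
Hypothesis data : defect_data T S D e.

Definition coords (x : V) : 'rV[C]_N := \row_i ip x (e i).

Lemma defect_span x : D x = lc (coords (D x)) e.
Proof.
case: data => _ _ _ eo De.
have : nclosure ip (range D) (D x).
  by move=> eps e0; exists (D x); [exists x | rewrite subrr (hnorm0 ipP)].
rewrite De => -[c cE].
have {}cE : D x = lc (\row_i c i) e.
  by rewrite cE; apply: eq_bigr => i _; rewrite mxE.
by rewrite {1}cE; congr lc; apply/rowP => i; rewrite [RHS]mxE cE ip_lc_orthonormal.
Qed.

(** The span of e is the closed range of the self-adjoint D, so its orthogonal is the kernel. *)
Lemma defect_ker x : D x = 0 <-> coords x = 0.
Proof.
case: data => Dl Da DD eo De; split=> [Dx|cx].
  apply/rowP => i; rewrite !mxE; apply: (zero_of_small_pairing ipP (A := range D)).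
    rewrite De; exists (fun j => (j == i)%:R).
    rewrite (bigD1 i) //= big1 ?addr0 ?eqxx ?scale1r // => j /negPf ->.
    by rewrite scale0r.
  by move=> _ [y _ <-]; rewrite -Da Dx (sesq0l ips).
apply: ipd; rewrite Da (defect_span (D x)) /lc (sesq_sumr ips) big1 // => i _.
by rewrite (sesqZr ips); move/rowP/(_ i): cx; rewrite !mxE => ->; rewrite mulr0.
Qed.

Lemma defect_ker_fix x : D x = 0 <-> S (T x) = x.
Proof.
case: data => Dl Da DD eo De; split=> [Dx|STx].
  by apply/eqP; rewrite eq_sym -subr_eq0 -DD Dx linearf0.
by apply: ipd; rewrite Da DD STx subrr (sesq0r ips).
Qed.

Lemma coords_lc c : coords (lc c e) = c.
Proof. by case: data => _ _ _ eo _; apply/rowP => i; rewrite mxE ip_lc_orthonormal. Qed.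

Lemma coordsB x y : coords (x - y) = coords x - coords y.
Proof. by apply/rowP => i; rewrite !mxE (sesqBl ips). Qed.

Lemma defect_inj c : D (lc c e) = 0 -> c = 0.
Proof. by move/defect_ker; rewrite coords_lc. Qed.

(** D maps the span of e into itself, injectively, hence onto by finite dimension. *)
Lemma defect_solve (a : 'rV[C]_N) : exists v, D (lc v e) = lc a e.
Proof.
case: data => Dl Da DD eo De.
pose X : 'M[C]_N := \matrix_(i, l) ip (D (e i)) (e l).
have XE c : coords (D (lc c e)) = c *m X.
  by rewrite linearf_lc //; apply/rowP => l; rewrite !mxE sesq_lcl //; apply: eq_bigr => i _; rewrite mxE.
have Xu : X \in unitmx.
  rewrite -row_free_unit; apply/inj_row_free => c cX; apply: defect_inj.
  by rewrite defect_span XE cX lc0l.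
exists (a *m invmx X).
by rewrite defect_span XE mulmxKV.
Qed.

Lemma defect_norm x y : ip (T x) (T y) + ip (D x) (D y) = ip x y.
Proof.
case: data => Dl Da DD eo De.
by rewrite TS [ip (D x) _]Da DD (sesqBr ips) addrC subrK.
Qed.

End Data.

(** T maps the kernel of D into that of D'. The part z of S (f j) in the kernel of D therefore
    satisfies ip z (S (f j)) = ip (T z) (f j) = 0, which is ip z z = 0. *)
Lemma adjoint_maps_defect (T S D D' : V -> V) e f : is_adjoint ip T S -> linearf T -> linearf S ->
  defect_data T S D e -> defect_data S T D' f -> forall j, S (f j) = lc (coords e (S (f j))) e.
Proof.
move=> TS Tl Sl dT dS j; apply/eqP; rewrite -subr_eq0; apply/eqP; set z := _ - _.
have ze : coords e z = 0 by rewrite /z coordsB (coords_lc dT) subrr.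
have zl c : ip z (lc c e) = 0.
  rewrite /lc (sesq_sumr ips) big1 // => i _; rewrite (sesqZr ips).
  by move/rowP/(_ i): ze; rewrite !mxE => ->; rewrite mulr0.
have STz : S (T z) = z by apply/(defect_ker_fix dT)/(defect_ker dT).
have Tzf : coords f (T z) = 0.
  by apply/(defect_ker dS)/(defect_ker_fix dS); rewrite STz.
apply: ipd; rewrite {2}/z (sesqBr ips) zl subr0 -TS.
by move/rowP/(_ j): Tzf; rewrite !mxE.
Qed.

Local Notation K := (V * 'cV[C]_N)%type.
Local Notation ipK := (ip_sum ip (N:=N)).

(* J x = (A x, D x) is an isometry. Its range has the orthogonal complement spanned by
   the (f j, v j) with D (v j) = - A* (f j), since A* maps the defect space of A* to
   that of A. *)
Theorem unitary_dilation_exists (A As : V -> V) : linearf A -> is_adjoint ip A As ->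
  defect_number_eq ip A N -> defect_number_eq ip As N -> exists U, unitary_dilation ip (N := N) A U.
Proof.
move=> Al AAs dA dAs.
have Asl := adjoint_linear ipP AAs.
have AsA : is_adjoint ip As A by move=> x y; exact: (adjoint_sym ipP x y AAs).
have [D [e de]] := defect_number_data AAs dA.
have [D' [f df]] := defect_number_data AsA dAs.
have [Dl Da DD eo De] := de; have [Dl' Da' DD' fo Df] := df.
have ipKP := is_ip_sum ipP N; have ipKh := ip_herm ipKP; have ipKs := ip_sesq ipKP.
pose J x : K := (A x, \col_i ip (D x) (e i)).
pose Js (w : K) := As w.1 + D (lc (\row_i w.2 i 0) e).
have JJs x w : ipK (J x) w = ip x (Js w).
  rewrite /ip_sum /Js (sesqDr ips) AAs -Da /lc (sesq_sumr ips); congr (_ + _).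
  by apply: eq_bigr => i _; rewrite (sesqZr ips) !mxE mulrC.
have Jiso x y : ipK (J x) (J y) = ip x y.
  rewrite JJs /Js /= (sesqDr ips) -AAs.
  have -> : (\row_i (\col_i0 ip (D y) (e i0)) i 0) = coords e (D y).
    by apply/rowP => i; rewrite !mxE.
  by rewrite -(defect_span de) -Da (defect_norm AAs de).
have vex j : exists v, D (lc v e) = - As (f j).
  have [v vE] := defect_solve de (- coords e (As (f j))).
  exists v; rewrite vE {2}(adjoint_maps_defect AAs Al Asl de df j).
  by rewrite -[- coords _ _]scaleN1r lcZl scaleN1r.
have [v vE] := choice vex.
pose g j : K := (f j, (v j)^T).
have Jg x j : ipK (J x) (g j) = 0.
  rewrite JJs /Js /=; have -> : (\row_i (v j)^T i 0) = v j by apply/rowP => i; rewrite !mxE.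
  by rewrite vE subrr (sesq0r ips).
have gpos : posfam ipK g.
  move=> c c0; rewrite (ip_hnorm ipKP) -[0](rmorph0 (real_complex R)) ltcR exprn_gt0 // hnorm_gt0 //.
  apply: contraNneq c0 => e0; have : (lc c g).1 = 0 by rewrite e0.
  by rewrite fst_lc => /(orthonormal_indep ipP fo) ->.
have [Q QE] := posfam_normalize ipKh gpos.
pose g' j := lc (row j Q) g.
have g'o : orthonormal ipK g' by apply/(orthonormal_gram ipK).
have Qu : Q \in unitmx.
  move: QE; rewrite gram_lc // => /mulmx1_unit [+ _].
  by rewrite unitmx_mul => /andP[].
have Jg' x j : ipK (J x) (g' j) = 0.
  by rewrite /g' /lc (sesq_sumr ipKs) big1 // => i _; rewrite (sesqZr ipKs) Jg mulr0.
(* Subtracting a combination of g puts the first component in the kernel of D'. Then t = As w2.1 is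
   in the kernel of D, and [Js] w2 = 0 puts it in the range of D as well, so t = 0 and w is a
   combination of g. *)
have complete w : (forall x, ipK (J x) w = 0) -> (forall j, ipK w (g' j) = 0) -> w = 0.
  move=> Jw wg'; pose c := coords f w.1.
  have Jw2 x : ipK (J x) (w - lc c g) = 0.
    rewrite (sesqBr ipKs) Jw /lc (sesq_sumr ipKs) big1 ?subr0 // => i _.
    by rewrite (sesqZr ipKs) Jg mulr0.
  set w2 := w - lc c g in Jw2.
  have w21 : coords f w2.1 = 0 by rewrite /= fst_lc coordsB (coords_lc df) subrr.
  have AAw : A (As w2.1) = w2.1 by apply/(defect_ker_fix df)/(defect_ker df).
  have Jsw2 : Js w2 = 0 by apply: ipd; rewrite -JJs.
  pose t := As w2.1; have tD : t = - D (lc (\row_i w2.2 i 0) e).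
    by apply/eqP; rewrite -addr_eq0; apply/eqP.
  have t0 : coords e t = 0.
    by apply/(defect_ker de)/(defect_ker_fix de); rewrite /t AAw.
  have tz : t = 0.
    have td : t = D (- lc (\row_i w2.2 i 0) e) by rewrite tD -[in RHS]scaleN1r linearfZ // scaleN1r.
    by rewrite td (defect_span de) -td t0 lc0l.
  have w21z : w2.1 = 0 by rewrite -AAw -/t tz linearf0.
  have w22z : w2.2 = 0.
    have /(defect_inj de) h : D (lc (\row_i w2.2 i 0) e) = 0.
      by apply/eqP; rewrite -oppr_eq0 -tD tz.
    by apply/colP => i; move/rowP/(_ i): h; rewrite !mxE.
  have wE : w = lc (c *m invmx Q) g'.
    have -> : lc (c *m invmx Q) g' = lc c g by rewrite /g' -lc_mul mulmxKV.
    apply/eqP; rewrite -subr_eq0 -/w2; apply/eqP.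
    by move: w21z w22z; case: (w2) => a b /= -> ->.
  have : c *m invmx Q = 0.
    by apply/rowP => j; rewrite -(ip_lc_orthonormal ipKP _ j g'o) -wE wg' mxE.
  by move=> h; rewrite wE h lc0l.
(* The second summand is sent onto the complement of the range of J, whose dimension N is the defect
   number of the adjoint. *)
pose U (w : K) := J w.1 + lc w.2^T g'.
have Jl a x y : J (a *: x + y) = a *: J x + J y.
  rewrite /J Al; congr (_, _); apply/colP => i; rewrite !mxE Dl ips.1 //.
have Ul : linearf U.
  move=> a x y; rewrite /U /= Jl linearD linearZ /= lcDl lcZl scalerDr.
  by rewrite addrACA.
have lcg' (c d : 'rV_N) : ipK (lc c g') (lc d g') = \sum_i c 0 i * conjc (d 0 i).
  rewrite [in X in ipK _ X]/lc (sesq_sumr ipKs); apply: eq_bigr => i _.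
  by rewrite (sesqZr ipKs) ip_lc_orthonormal // mulrC.
have Jlc x c : ipK (J x) (lc c g') = 0.
  by rewrite /lc (sesq_sumr ipKs) big1 // => i _; rewrite (sesqZr ipKs) Jg' mulr0.
have Ujiso w w' : ipK (U w) (U w') = ipK w w'.
  rewrite /U (sesqDl ipKs) !(sesqDr ipKs) Jiso Jlc addr0.
  have -> : ipK (lc w.2^T g') (J w'.1) = 0 by rewrite ipKh.2 Jlc conjc0.
  rewrite add0r lcg' /ip_sum; congr (_ + _); apply: eq_bigr => i _.
  by rewrite !mxE.
have Usurj w : exists w0, U w0 = w.
  exists (Js w, \col_j ipK w (g' j)); apply/eqP; rewrite -subr_eq0 -opprB oppr_eq0; apply/eqP.
  apply: complete => [x|j].
    by rewrite /U /= (sesqBr ipKs) (sesqDr ipKs) Jiso Jlc addr0 JJs subrr.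
  rewrite /U /= (sesqBl ipKs) (sesqDl ipKs) Jg' add0r ip_lc_orthonormal // !mxE.
  by rewrite subrr.
have [Ub Ua] := unitary_of_isometry ipKP Ul Ujiso Usurj.
exists U; split=> // x; rewrite /U /= fst_lc.
have -> : lc (0 : 'cV[C]_N)^T (fun i => (g' i).1) = 0 by rewrite trmx0 lc0l.
by rewrite addr0.
Qed.

End Defect.

(** * Dilations with a prescribed unimodular eigenvalue *)

Section EigenDilation.
Variable R : realType.
Local Notation C := R[i].
Local Notation "x %:C" := (real_complex _ x) : ring_scope.
Variable V : lmodType C.
Variable ip : V -> V -> C.
Hypothesis ipP : is_ip ip.
Let iph := ip_herm ipP.
Let ips := ip_sesq ipP.
Variables (N : nat) (A : V -> V).
Hypothesis Al : linearf A.
Local Notation K := (V * 'cV[C]_N)%type.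
Local Notation ipK := (ip_sum ip (N:=N)).
Let ipKP := is_ip_sum ipP N.
Let ipKh := ip_herm ipKP.
Let ipKs := ip_sesq ipKP.

Lemma unitary_dilation_iso U : unitary_dilation ip A U ->
  [/\ linearf U, (forall x y, ipK (U x) (U y) = ipK x y) & forall y, exists x, U x = y].
Proof.
move=> [[Ul _] [Us [UUs UUsw UsUw]] _]; split=> // [x y|y]; first by rewrite UUs UsUw.
by exists (Us y).
Qed.

(* [Th] is the value at a of the characteristic function of A; the dilation is U0
   composed with 1 (+) a [Th]^*. *)
Lemma eigen_dilation (U0 : K -> K) (a : C) (h : 'I_N -> V) : unitary_dilation ip A U0 ->
  a * conjc a = 1 ->
  (forall j, a *: h j - A (h j) = (U0 (0, delta_mx j 0)).1) ->
  exists U : K -> K, exists G : 'cV[C]_N -> V,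
    [/\ unitary_dilation ip A U, (forall c u v, G (c *: u + v) = c *: G u + G v) &
     forall v, U (G v, v) = a *: ((G v, v) : K)].
Proof.
move=> U0d aa hE; have [U0l U0iso U0surj] := unitary_dilation_iso U0d.
have [_ _ U0A] := U0d.
pose p j : K := (h j, delta_mx j 0).
pose Th : 'M[C]_N := \matrix_(i, j) (U0 (p j)).2 i 0.
have U0p j : U0 (p j) = (a *: h j, \col_i Th i j).
  have e1 : (U0 (p j)).1 = a *: h j.
    have -> : p j = (h j, 0) + (0, delta_mx j 0).
      by rewrite /p; congr (_, _) => /=; rewrite ?addr0 ?add0r.
    by rewrite linearfD //= U0A -hE addrC subrK.
  rewrite -e1 [LHS]surjective_pairing; congr (_, _); apply/colP => i.
  by rewrite !mxE.
have sumE (u v : 'cV[C]_N) : \sum_i u i 0 * conjc (v i 0) = (v^t* *m u) 0 0.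
  by rewrite mxE; apply: eq_bigr => i _; rewrite !mxE mulrC.
(* The first components of p i and U0 (p i) differ by the unimodular factor a, so they drop out of
   the isometry relation and leave that of the columns of [Th]. *)
have ThTh : Th^t* *m Th = 1%:M.
  apply/matrixP => j i; have := U0iso (p i) (p j).
  rewrite !U0p /ip_sum /= (sesqZl ips) (sesqZr ips) mulrA aa mul1r => /addrI.
  rewrite !sumE => e; transitivity (((\col_i Th i j)^t* *m (\col_l Th l i)) 0 0).
    by rewrite !mxE; apply: eq_bigr => l _; rewrite !mxE.
  rewrite e mxE (bigD1 j) //= big1 ?addr0; last first.
    by move=> l lj; rewrite !mxE (negPf lj) rmorph0 mul0r.
  by rewrite !mxE !eqxx rmorph1 mul1r andbT.
have ThTh' : Th *m Th^t* = 1%:M by apply: mulmx1C.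
pose Y := a *: Th^t*.
have Yc : Y^t* = conjc a *: Th by rewrite /Y [_^T]linearZ /= map_mxZ trmxCK.
have YY : Y^t* *m Y = 1%:M.
  by rewrite Yc /Y -scalemxAl -scalemxAr scalerA mulrC aa scale1r.
have YY' : Y *m Y^t* = 1%:M by apply: mulmx1C.
pose U (w : K) : K := U0 (w.1, Y *m w.2).
pose G v := lc (Y *m v)^T h.
have Gl c u v : G (c *: u + v) = c *: G u + G v.
  by rewrite /G mulmxDr -scalemxAr linearD linearZ /= lcDl lcZl.
exists U, G; split=> //.
  have Ul : linearf U.
    move=> c x y; rewrite /U /= mulmxDr -scalemxAr -U0l; congr U0.
  have Uiso x y : ipK (U x) (U y) = ipK x y.
    rewrite /U U0iso /ip_sum /= !sumE ctrmxM -mulmxA (mulmxA (Y^t*)) YY mul1mx //.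
  have Usurj y : exists x, U x = y.
    have [x xy] := U0surj y; exists (x.1, Y^t* *m x.2).
    by rewrite /U /= mulmxA YY' mul1mx -xy; congr U0; case: (x).
  have [Ub Ua] := unitary_of_isometry ipKP Ul Uiso Usurj.
  by split=> // x; rewrite /U /= mulmx0 U0A.
move=> v; rewrite /U /=.
have -> : (G v, Y *m v) = lc (Y *m v)^T p :> K.
  rewrite [RHS]surjective_pairing fst_lc snd_lc; congr (_, _).
  apply/colP => i; rewrite summxE (bigD1 i) //= big1 ?addr0.
    by rewrite !mxE !eqxx mulr1.
  by move=> l li; rewrite !mxE eq_sym (negPf li) mulr0.
rewrite linearf_lc // [LHS]surjective_pairing fst_lc snd_lc /=.
congr (_, _).
  rewrite /G /lc scaler_sumr; apply: eq_bigr => j _.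
  by rewrite U0p /= !scalerA mulrC.
transitivity (Th *m (Y *m v)).
  apply/colP => i; rewrite summxE [RHS]mxE; apply: eq_bigr => j _.
  by rewrite U0p /= !mxE mulrC.
by rewrite mulmxA /Y -scalemxAr ThTh' scalemx1 mul_scalar_mx.
Qed.

Lemma eigen_dilation_transfer (U : K -> K) (G : 'cV[C]_N -> V) (a xi : C) (c : R) k :
  unitary_dilation ip A U -> a * conjc a = 1 ->
  (forall c u v, G (c *: u + v) = c *: G u + G v) ->
  (forall v, U (G v, v) = a *: ((G v, v) : K)) -> complex.Re (xi * a) = c ->
  haspos k (addform (hre (fun x y => xi * ipK (U x) y)) (- c) ipK) ->
  haspos k (addform (hre (fun x y => xi * ip (A x) y)) (- c) ip).
Proof.
move=> Ud aa Gl Ue rea [x xpos]; have [Ul Uiso _] := unitary_dilation_iso Ud.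
have [_ _ UA] := Ud.
exists (fun i => (x i).1 - G (x i).2) => d d0.
pose w := lc d x; have := xpos d d0; rewrite -/w.
have G0 : G 0 = 0 by have := Gl (-1) 0 0; rewrite scaler0 addr0 scaleN1r addNr.
have GD u v : G (u + v) = G u + G v by have := Gl 1 u v; rewrite !scale1r.
have GZ b u : G (b *: u) = b *: G u by have := Gl b u 0; rewrite !addr0 G0 addr0.
have -> : lc d (fun i => (x i).1 - G (x i).2) = w.1 - G w.2.
  rewrite lcBr fst_lc; congr (_ - _); rewrite snd_lc (big_morph G GD G0).
  by apply: eq_bigr => i _; rewrite GZ.
(* e is the eigenvector over w.2. By isometry ipK (U z') e = a ipK z' e, so all terms containing e
   carry the factor Re (xi a) - c = 0. *)
set z := w.1 - G w.2; set e : K := (G w.2, w.2); pose z' : K := (z, 0).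
have we : w = z' + e.
  by rewrite /z' /e [LHS]surjective_pairing; congr (_, _) => /=; rewrite ?add0r // subrK.
have Uze : ipK (U z') e = a * ipK z' e.
  by rewrite -[ipK z' e]Uiso Ue (sesqZr ipKs) mulrA aa mul1r.
have zz : ipK z' z' = ip z z by rewrite ip_sum_l.
have Uzz : ipK (U z') z' = ip (A z) z.
  by rewrite ipKh.2 ip_sum_l /z' UA -iph.2.
suff -> : addform (hre (fun x y => xi * ipK (U x) y)) (- c) ipK w w =
   addform (hre (fun x y => xi * ip (A x) y)) (- c) ip z z by [].
rewrite /addform !hre_quad we (linearfD _ _ Ul) [U e]Ue -/e.
rewrite !(sesqDl ipKs) !(sesqDr ipKs) !(sesqZl ipKs) Uze zz Uzz (ipKh.2 z' e).
rewrite (ip_hnorm ipKP e); move: (ip (A z) z) (ip z z) (ipK z' e) (hnorm _ _ ^+ 2) => t1 t2 t3 t4.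
rewrite -rea; move: xi a {xpos Ue Uze rea aa} => [x1 x2] [a1 a2].
case: t1 t2 t3 => b1 b2 [d1 d2] [f1 f2].
by apply/eqP; rewrite eq_complex /=; apply/andP; split; apply/eqP; ring.
Qed.

End EigenDilation.

(** * Completeness and invertibility *)

Section Completeness.
Variable R : realType.
Local Notation C := R[i].
Local Notation "x %:C" := (real_complex _ x) : ring_scope.
Variable V : lmodType C.
Variable ip : V -> V -> C.
Hypothesis ipP : is_ip ip.
Hypothesis compl : complete_ip ip.
Let iph := ip_herm ipP.
Let ips := ip_sesq ipP.
Local Notation hn := (hnorm ip).

Lemma inv_succ_small (eps : R) : 0 < eps -> exists M : nat, forall n, (M <= n)%N -> n.+1%:R^-1 < eps.
Proof.
move=> e0; exists (Num.bound eps^-1) => n Mn.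
have b := archi_boundP (ltW (_ : 0 < eps^-1)).
rewrite invf_plt ?posrE ?ltr0n //; apply: lt_le_trans (b _) _; first by rewrite invr_gt0.
by rewrite ler_nat ltnW.
Qed.

Lemma parallelogram x y : hn (x + y) ^+ 2 + hn (x - y) ^+ 2 = 2 * hn x ^+ 2 + 2 * hn y ^+ 2.
Proof.
rewrite !(hnormD_sqr ipP) (hnormN ipP) (sesqNr ips) raddfN /=; ring.
Qed.

Lemma le_of_small (x y : R) : (forall eps, 0 < eps -> x <= y + eps) -> x <= y.
Proof. by move=> h; apply/ler_addgt0Pr. Qed.

Lemma sqr_small (eps D : R) : 0 < eps -> 0 <= D -> exists2 r, 0 < r & r <= 1 /\ D * r < eps ^+ 2.
Proof.
move=> e0 D0; pose r := Num.min 1 (eps ^+ 2 / (D + 1)).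
have D1 : 0 < D + 1 by rewrite ltr_wpDl.
have q0 : 0 < eps ^+ 2 / (D + 1) by rewrite divr_gt0 ?exprn_gt0.
exists r; first by rewrite lt_min ltr01.
split; first by rewrite ge_min lexx.
have : r <= eps ^+ 2 / (D + 1) by rewrite ge_min lexx orbT.
have e2 : 0 < eps ^+ 2 by rewrite exprn_gt0.
rewrite ler_pdivlMr // => h.
have r0 : 0 < r by rewrite lt_min ltr01.
nra.
Qed.

(** A minimizing sequence is Cauchy by the parallelogram law; orthogonality follows by comparing the
    limit l with l + t m at the optimal t. *)
Lemma projection_exists (M : V -> Prop) :
  M 0 -> (forall a x y, M x -> M y -> M (a *: x + y)) ->
  (forall x, (forall eps : R, 0 < eps -> exists2 m, M m & hn (x - m) < eps) -> M x) ->
  forall x, exists2 p, M p & forall m, M m -> ip (x - p) m = 0.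
Proof.
move=> M0 Ml Mc x.
pose S : set R := [set r | exists2 m, M m & r = hn (x - m)]%classic.
have Sinf : has_inf S.
  split; first by exists (hn (x - 0)), 0.
  by exists 0 => r [m _ ->]; apply: hnorm_ge0.
pose d := inf S.
have d0 : 0 <= d by apply: lb_le_inf; [case: Sinf | move=> r [m _ ->]; apply: hnorm_ge0].
have dle m : M m -> d <= hn (x - m) by move=> Mm; apply: ge_inf Sinf.2 _ _; exists m.
have seqP n : exists m, M m /\ hn (x - m) < d + n.+1%:R^-1.
  have n0 : 0 < n.+1%:R^-1 :> R by rewrite invr_gt0 ltr0n.
  by have [r [m Mm ->] h] := inf_adherent n0 Sinf; exists m.
have [u uP] := choice seqP.
have umM n : M (u n) by case: (uP n).
(* From 4 (d + r)^2 - 4 d^2 = 8 d r + 4 r^2 and r <= 1. *)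
have close (r : R) m n : 0 < r -> r <= 1 -> m.+1%:R^-1 < r -> n.+1%:R^-1 < r ->
    hn (u m - u n) ^+ 2 <= (8 * d + 4) * r.
  move=> r0 r1 mr nr.
  have := parallelogram (x - u n) (x - u m).
  have -> : x - u n - (x - u m) = u m - u n by rewrite opprB addrC addrA subrK.
  have -> : x - u n + (x - u m) = 2 *: (x - 2^-1 *: (1 *: u n + u m)).
    rewrite scalerBr scalerA mulfV ?pnatr_eq0 // !scale1r scaler_nat mulr2n.
    by rewrite opprD addrACA.
  rewrite (hnormZ ipP).
  have -> : rnorm (2 : C) = 2 by rewrite /rnorm normr_nat raddfMn.
  have mid : M (2^-1 *: (1 *: u n + u m)).
    by have := Ml 2^-1 _ _ (Ml 1 _ _ (umM n) (umM m)) M0; rewrite addr0.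
  have := dle _ mid; set D := hn (x - _) => dD.
  have [_ hm] := uP m; have [_ hn'] := uP n.
  have h1 : hn (x - u m) ^+ 2 <= (d + r) ^+ 2.
    by rewrite ler_sqr ?nnegrE ?hnorm_ge0 ?addr_ge0 ?(ltW r0) //; apply: ltW; apply: lt_trans hm _; rewrite ltrD2l.
  have h2 : hn (x - u n) ^+ 2 <= (d + r) ^+ 2.
    by rewrite ler_sqr ?nnegrE ?hnorm_ge0 ?addr_ge0 ?(ltW r0) //; apply: ltW; apply: lt_trans hn' _; rewrite ltrD2l.
  have h3 : d ^+ 2 <= D ^+ 2 by rewrite ler_sqr ?nnegrE // (le_trans d0).
  rewrite exprMn => e; nra.
have [l ul] : exists l : V, forall eps : R, 0 < eps -> exists M : nat, forall n : nat,
    (M <= n)%N -> hn (u n - l) < eps.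
  apply: compl => eps e0.
  have D0 : 0 <= 8 * d + 4 by lra.
  have [r r0 [r1 rD]] := sqr_small e0 D0.
  have [n0 nP] := inv_succ_small r0; exists n0 => m n mn nn.
  rewrite -ltr_sqr ?nnegrE ?hnorm_ge0 ?(ltW e0) //; apply: le_lt_trans rD.
  by apply: close => //; apply: nP.
have Mlim : M l.
  apply: Mc => eps e0; have [n nP] := ul eps e0; exists (u n) => //.
  by rewrite (hnorm_distC ipP); apply: nP.
have ld : hn (x - l) <= d.
  apply: le_of_small => eps e0; have e2 : 0 < eps / 2 by rewrite divr_gt0.
  have [n1 h1] := ul _ e2; have [n2 h2] := inv_succ_small e2.
  pose n := maxn n1 n2.
  have := h1 n (leq_maxl _ _); have := h2 n (leq_maxr _ _); have [_] := uP n.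
  have := ler_hnormD ipP (x - u n) (u n - l); rewrite addrA subrK.
  by move: (n.+1%:R^-1) => qn; lra.
exists l => // m Mm.
have [->|m0] := eqVneq m 0; first by rewrite (sesq0r ips).
pose w := ip (x - l) m; pose q := hn m ^+ 2; pose t := w * (q^-1)%:C.
have q0 : 0 < q by rewrite exprn_gt0 ?hnorm_gt0.
have Mt : M (t *: m + l) by apply: Ml.
have : d ^+ 2 <= hn (x - (t *: m + l)) ^+ 2 by rewrite ler_sqr ?nnegrE ?hnorm_ge0 ?dle.
have -> : x - (t *: m + l) = (x - l) + - (t *: m) by rewrite opprD addrCA addrC.
rewrite (hnormD_sqr ipP) (hnormN ipP) (hnormZ ipP) (sesqNr ips) (sesqZr ips) -/w exprMn -/q.
have -> : - (conjc t * w) = - ((rnorm w ^+ 2 / q)%:C).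
  by rewrite /t rmorphM /= oppr0 mulrAC [conjc w * w]mulrC rnorm_sqr -rmorphM.
have -> : rnorm t ^+ 2 * q = rnorm w ^+ 2 / q.
  rewrite /t rnormM exprMn; have -> : rnorm (q^-1)%:C = q^-1.
    by rewrite /rnorm ger0_norm // ler0c invr_ge0 ltW.
  by field; rewrite gt_eqF.
have ld2 : hn (x - l) ^+ 2 <= d ^+ 2 by rewrite ler_sqr ?nnegrE ?hnorm_ge0.
rewrite raddfN /= => h.
have : rnorm w ^+ 2 / q <= 0 by lra.
rewrite pmulr_lle0 ?invr_gt0 // => w2.
apply/eqP; rewrite -normr_eq0 -rnormE -[0](rmorph0 (real_complex R)) (inj_eq (@complexI R)) -/w.
by rewrite -sqrf_eq0 eq_le w2 sqr_ge0.
Qed.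

Variables (A As : V -> V).
Hypotheses (Al : linearf A) (Ac : forall x, hn (A x) <= hn x) (AAs : is_adjoint ip A As).

(** Expanding, |A y - a y|^2 = |A y|^2 - |y|^2, which is at most 0 for a contraction. *)
Lemma eigen_adjoint a y : a * conjc a = 1 -> As y = conjc a *: y -> A y = a *: y.
Proof.
move=> aa e; apply/eqP; rewrite -subr_eq0; apply/eqP/(hnorm_eq0 ipP)/eqP.
rewrite -sqrf_eq0 eq_le sqr_ge0 andbT hnormD_sqr // hnormN // (sesqNr ips) (sesqZr ips) AAs e (sesqZr ips) conjcK.
rewrite mulrA [conjc a * a]mulrC aa mul1r raddfN /= -hnorm_sqr // (hnormZ ipP) exprMn.
have -> : rnorm a ^+ 2 = 1 by apply: complexI; rewrite -rnorm_sqr aa.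
have : hn (A y) ^+ 2 <= hn y ^+ 2 by rewrite ler_sqr ?nnegrE ?hnorm_ge0.
lra.
Qed.

(** The lower bound and completeness make the range of a - A closed. A vector orthogonal to it is an
    eigenvector of the adjoint, hence of A for the eigenvalue a, and the lower bound kills it. *)
Lemma bounded_below_surj (a : C) (m : R) : a * conjc a = 1 -> 0 < m ->
  (forall x, m * hn x <= hn (a *: x - A x)) -> forall g, exists h, a *: h - A h = g.
Proof.
move=> aa m0 low g; pose T x := a *: x - A x.
have ra : rnorm a = 1.
  by apply/eqP; rewrite -(eqrXn2 (n := 2)) ?rnorm_ge0 // expr1n; apply/eqP/complexI; rewrite -rnorm_sqr aa.
have Tl : linearf T.
  move=> c x y; rewrite /T Al scalerDr !scalerA [a * c]mulrC -scalerA scalerBr.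
  by rewrite opprD addrACA.
have TB x : hn (T x) <= 2 * hn x.
  apply: le_trans (ler_hnormD ipP _ _) _; rewrite (hnormN ipP) (hnormZ ipP) ra.
  have := Ac x; lra.
pose M x := exists y, T y = x.
have [|c x y [x' <-] [y' <-]|x xlim|p [h hp] orth] := @projection_exists M _ _ _ g.
- by exists 0; apply: linearf0.
- by exists (c *: x' + y'); rewrite Tl.
- have seqP n : exists y, hn (x - T y) < n.+1%:R^-1.
    have n0 : 0 < n.+1%:R^-1 :> R by rewrite invr_gt0 ltr0n.
    by have [_ [y <-] h] := xlim _ n0; exists y.
  have [y yP] := choice seqP.
  have [l yl] : exists l : V, forall eps : R, 0 < eps -> exists M : nat, forall n : nat,
    (M <= n)%N -> hn (y n - l) < eps.
    apply: compl => eps e0; have e2 : 0 < m * eps / 2 by rewrite divr_gt0 // mulr_gt0.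
    have [n0 nP] := inv_succ_small e2; exists n0 => i j ni nj.
    rewrite -(ltr_pM2l m0); apply: le_lt_trans (low _) _; rewrite -/(T _) linearfB //.
    have -> : T (y i) - T (y j) = (T (y i) - x) + (x - T (y j)) by rewrite addrA subrK.
    apply: le_lt_trans (ler_hnormD ipP _ _) _; rewrite (hnorm_distC ipP (T _)).
    have := yP i; have := yP j; have := nP i ni; have := nP j nj.
    by move: (i.+1%:R^-1) (j.+1%:R^-1) => qi qj; lra.
  exists l; apply/eqP; rewrite eq_sym -subr_eq0; apply/eqP/(hnorm_eq0 ipP)/eqP.
  rewrite eq_le hnorm_ge0 andbT; apply: le_of_small => eps e0; rewrite add0r.
  have e4 : 0 < eps / 4 by rewrite divr_gt0.
  have [n1 h1] := yl _ e4; have [n2 h2] := inv_succ_small e4.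
  pose n := maxn n1 n2.
  have := h1 n (leq_maxl _ _); have := h2 n (leq_maxr _ _); have := yP n.
  have := ler_hnormD ipP (x - T (y n)) (T (y n - l)).
  have := TB (y n - l); rewrite [T (_ - l)]linearfB // addrA subrK.
  by move: (n.+1%:R^-1) => qn; lra.
- exists h; rewrite -/(T h) hp; apply/eqP; rewrite eq_sym -subr_eq0; apply/eqP.
  set r := g - p in orth *.
  have Asr : As r = conjc a *: r.
    apply/eqP; rewrite eq_sym -subr_eq0; apply/eqP; apply: (ip_ext ipP) => z.
    have : ip r (T z) = 0 by apply: orth; exists z.
    rewrite /T (sesqBr ips) (sesqZr ips) (sesq0r ips) => e0.
    rewrite (sesqBr ips) (sesqZr ips) conjcK -AAs.
    by rewrite (iph.2 r z) (iph.2 r (A z)) -[a]conjcK -rmorphM -rmorphB /= e0 conjc0.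
  apply: (hnorm_eq0 ipP); apply/eqP; rewrite eq_le hnorm_ge0 andbT -(ler_pM2l m0) mulr0.
  by apply: le_trans (low r) _; rewrite (eigen_adjoint aa Asr) subrr (hnorm0 ipP).
Qed.

End Completeness.

(** * Ranges of dilations *)

Section ApproximateEigenvectors.
Variable R : realType.
Local Notation C := R[i].
Local Notation "x %:C" := (real_complex _ x) : ring_scope.
Variable V : lmodType C.
Variable ip : V -> V -> C.
Hypothesis ipP : is_ip ip.
Let iph := ip_herm ipP.
Let ips := ip_sesq ipP.
Local Notation hn := (hnorm ip).
Variables (A As : V -> V).
Hypotheses (Al : linearf A) (Ac : forall x, hn (A x) <= hn x) (AAs : is_adjoint ip A As).

Lemma adjoint_contraction x : hn (As x) <= hn x.
Proof.
have [->|n0] := eqVneq (As x) 0; first by rewrite (hnorm0 ipP) hnorm_ge0.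
have p := hnorm_gt0 ipP n0; rewrite -(ler_pM2l p) -expr2 (hnorm_sqr ipP) -AAs.
apply: le_trans (Re_le_rnorm _) _; apply: le_trans (cauchy_schwarz ipP _ _) _.
by rewrite ler_wpM2r ?hnorm_ge0.
Qed.

Lemma unimodular_rnorm (a : C) : a * conjc a = 1 -> rnorm a = 1.
Proof.
move=> aa; apply/eqP; rewrite -(eqrXn2 (n := 2)) ?rnorm_ge0 // expr1n.
by apply/eqP/complexI; rewrite -rnorm_sqr aa.
Qed.

(** |As x - conj a x|^2 exceeds |a x - A x|^2 by |As x|^2 - |A x|^2, where |As x| <= 1 and |A x| >=
    1 - r^2 / 2. The total is at most (r^2 / 2)^2 + 1 - (1 - r^2 / 2)^2 = r^2. *)
Lemma adjoint_approx_eigen a x (r : R) : a * conjc a = 1 -> hn x = 1 -> 0 < r -> r <= 1 ->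
  hn (a *: x - A x) <= r ^+ 2 / 2 -> hn (As x - conjc a *: x) <= r.
Proof.
move=> aa x1 r0 r1 h.
have ra := unimodular_rnorm aa; have rca : rnorm (conjc a) = 1 by rewrite /rnorm normcJ.
have A1 : hn (As x) <= 1 by rewrite -x1 adjoint_contraction.
have A0 := hnorm_ge0 ip (As x).
have low : 1 - r ^+ 2 / 2 <= hn (A x).
  have := ler_hnormD ipP (a *: x - A x) (A x); rewrite subrK (hnormZ ipP) ra x1 mul1r; lra.
have Ax0 := hnorm_ge0 ip (A x); have d0 := hnorm_ge0 ip (a *: x - A x).
have e1 := hnormD_sqr ipP (a *: x) (- A x).
rewrite (hnormN ipP) (hnormZ ipP) ra x1 mul1r (sesqNr ips) (sesqZl ips) in e1.
have e2 := hnormD_sqr ipP (As x) (- (conjc a *: x)).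
rewrite (hnormN ipP) (hnormZ ipP) rca x1 mul1r (sesqNr ips) (sesqZr ips) conjcK in e2.
have e3 : complex.Re (- (a * ip (As x) x)) = complex.Re (- (a * ip x (A x))).
  by rewrite (adjoint_sym ipP x x AAs).
rewrite -ler_sqr ?nnegrE ?hnorm_ge0 ?(ltW r0) // e2 e3.
have r20 : 0 <= r ^+ 2 by apply: sqr_ge0.
have r21 : r ^+ 2 <= 1 by nra.
have hd : hn (a *: x - A x) ^+ 2 <= (r ^+ 2 / 2) ^+ 2.
  by rewrite ler_sqr ?nnegrE //; lra.
have hA : (1 - r ^+ 2 / 2) ^+ 2 <= hn (A x) ^+ 2.
  by rewrite ler_sqr ?nnegrE //; lra.
have hAs : hn (As x) ^+ 2 <= 1 by nra.
nra.
Qed.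

(** The approximate eigenvectors also serve the adjoint, so those for separated a i are nearly
    orthogonal, and the form is nearly diagonal with entries at least g. *)
Lemma haspos_of_approx_eigen k (xi : C) (c g : R) (a : 'I_k -> C) :
  rnorm xi = 1 -> -1 <= c <= 1 -> 0 < g ->
  (forall i, a i * conjc (a i) = 1) -> (forall i, c + g <= complex.Re (xi * a i)) ->
  (forall i j, i != j -> g <= rnorm (a i - a j)) ->
  (forall i (m : R), 0 < m -> exists x, hn (a i *: x - A x) < m * hn x) ->
  haspos k (addform (hre (fun x y => xi * ip (A x) y)) (- c) ip).
Proof.
move=> xi1 /andP[c1 c2] g0 aa ag gap approx.
(* r E bounds the error of an entry; normalizing the diagonal costs a factor 1 / g, and W makes the
   sum of the k^2 errors less than 1. *)
pose E : R := 4 / g + 1; have E0 : 0 < E by rewrite addr_gt0 // divr_gt0.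
pose W : R := k%:R ^+ 2 + 1; have W0 : 0 < W by rewrite ltr_wpDl // sqr_ge0.
pose r : R := Num.min 1 (g / (2 * W * E)).
have r0 : 0 < r by rewrite lt_min ltr01 divr_gt0 // !mulr_gt0.
have r1 : r <= 1 by rewrite ge_min lexx.
have rg : r * (2 * W * E) <= g by rewrite -ler_pdivlMr ?mulr_gt0 // ge_min lexx orbT.
have rr : r ^+ 2 / 2 <= r by nra.
have unit i : exists x, hn x = 1 /\ hn (a i *: x - A x) <= r ^+ 2 / 2.
  have rr0 : 0 < r ^+ 2 / 2 by rewrite divr_gt0 ?exprn_gt0.
  have [x h] := approx i _ rr0.
  have x0 : x != 0.
    apply: contraTneq h => ->; rewrite scaler0 (linearf0 Al) subr0 (hnorm0 ipP) mulr0 ltxx //.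
  have n0 := hnorm_gt0 ipP x0; pose t := ((hn x)^-1)%:C.
  have rt : rnorm t = (hn x)^-1 by rewrite /rnorm ger0_norm // ler0c invr_ge0 ltW.
  exists (t *: x); split; first by rewrite (hnormZ ipP) rt mulVf // gt_eqF.
  rewrite (linearfZ _ _ Al) scalerA [a i * t]mulrC -scalerA -scalerBr (hnormZ ipP) rt.
  by rewrite mulrC ler_pdivrMr // ltW.
have [x xP] := choice unit.
have x1 i : hn (x i) = 1 by case: (xP i).
have xA i : hn (a i *: x i - A (x i)) <= r.
  by have [_ h] := xP i; apply: le_trans h rr.
have xAs i : hn (As (x i) - conjc (a i) *: x i) <= r.
  by have [_ h] := xP i; apply: adjoint_approx_eigen => //.
have ipA i j : rnorm (ip (A (x i)) (x j) - a i * ip (x i) (x j)) <= r.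
  rewrite -(sesqZl ips) -(sesqBl ips); apply: le_trans (cauchy_schwarz ipP _ _) _.
  by rewrite x1 mulr1 (hnorm_distC ipP).
have rnD (u v : C) : rnorm (u + v) <= rnorm u + rnorm v.
  by rewrite -lecR rmorphD /= !rnormE ler_normD.
have rnN (u : C) : rnorm (- u) = rnorm u by rewrite /rnorm normrN.
have rnJ (u : C) : rnorm (conjc u) = rnorm u by rewrite /rnorm normcJ.
have ipx i j : i != j -> rnorm (ip (x i) (x j)) <= 2 * r / g.
  move=> ij; rewrite ler_pdivlMr //.
  have e : (a i - a j) * ip (x i) (x j) =
      ip (a i *: x i - A (x i)) (x j) + ip (x i) (As (x j) - conjc (a j) *: x j).
    by rewrite (sesqBl ips) (sesqBr ips) (sesqZl ips) (sesqZr ips) conjcK AAs; ring.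
  have : rnorm ((a i - a j) * ip (x i) (x j)) <= r + r.
    rewrite e; apply: le_trans (rnD _ _) _; apply: lerD.
      by apply: le_trans (cauchy_schwarz ipP _ _) _; rewrite x1 mulr1.
    by apply: le_trans (cauchy_schwarz ipP _ _) _; rewrite x1 mul1r.
  rewrite rnormM; have := gap i j ij; have := rnorm_ge0 (ip (x i) (x j)); nra.
pose q := addform (hre (fun x y => xi * ip (A x) y)) (- c) ip.
have fs : sesq (fun x y => xi * ip (A x) y).
  by split=> b u v w; rewrite ?Al ?ips.1 ?ips.2; ring.
have qh : hermform q by apply: hermform_add => //; apply: hermform_hre.
have qs := hermform_sesq qh.
pose kap i := complex.Re (xi * a i) - c.
have kapg i : g <= kap i by have := ag i; rewrite /kap; lra.
have kap0 i : 0 < kap i by apply: lt_le_trans (kapg i).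
have qE i j : rnorm (q (x i) (x j) - (kap i)%:C * (i == j)%:R) <= r * E.
  have [<-|ij] := eqVneq i j.
    have xx : ip (x i) (x i) = 1 by rewrite (ip_hnorm ipP) x1 expr1n rmorph1.
    have -> : q (x i) (x i) - (kap i)%:C * 1 =
        (complex.Re (xi * (ip (A (x i)) (x i) - a i * ip (x i) (x i))))%:C.
      have ReB (u v : C) : complex.Re (u - v) = complex.Re u - complex.Re v by rewrite raddfB.
      rewrite /q /addform hre_quad xx !mulr1 mulrBr ReB /kap -rmorphD -rmorphB.
      by congr (_%:C); ring.
    rewrite /rnorm normc_def /= expr0n addr0 sqrtr_sqr.
    apply: le_trans (Re_abs_le_rnorm _) _; rewrite rnormM xi1 mul1r.
    apply: le_trans (ipA i i) _; rewrite -[leLHS]mulr1 ler_wpM2l ?(ltW r0) // /E lerDr.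
    by rewrite divr_ge0 // ltW.
  rewrite mulr0 subr0 /q /addform hreE.
  have off i' j' : i' != j' -> rnorm (xi * ip (A (x i')) (x j')) <= r + 2 * r / g.
    move=> ne; rewrite rnormM xi1 mul1r.
    rewrite -[ip (A _) _](subrK (a i' * ip (x i') (x j'))).
    apply: le_trans (rnD _ _) _; apply: lerD; first exact: ipA.
    by rewrite rnormM unimodular_rnorm // mul1r ipx.
  apply: le_trans (rnD _ _) _; rewrite !rnormM.
  have -> : rnorm ((2^-1 : R)%:C) = 2^-1 by rewrite /rnorm ger0_norm // ler0c invr_ge0.
  have rc : rnorm ((- c)%:C) <= 1.
    by rewrite /rnorm normc_def /= expr0n addr0 sqrtr_sqr normrN ler_norml c1.
  have h1 := off i j ij; have h2 : rnorm (conjc (xi * ip (A (x j)) (x i))) <= r + 2 * r / g.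
    by rewrite rnJ off // eq_sym.
  have h3 := le_trans (rnD _ _) (lerD h1 h2).
  have h4 := ipx i j ij; have h5 := rnorm_ge0 (ip (x i) (x j)); have h6 := rnorm_ge0 ((- c)%:C).
  have -> : r * E = r + 2 * r / g + 2 * r / g by rewrite /E; field; rewrite gt_eqF.
  apply: lerD; first by lra.
  by apply: le_trans h4; rewrite -[leRHS]mul1r ler_wpM2r.
pose s i : R := (Num.sqrt (kap i))^-1.
have s0 i : 0 < s i by rewrite invr_gt0 sqrtr_gt0.
have s2 i : s i ^+ 2 * kap i = 1.
  by rewrite /s exprVn sqr_sqrtr ?(ltW (kap0 i)) // mulVf // gt_eqF.
have sC i : (s i)%:C != 0 :> C.
  by rewrite -[0](rmorph0 (real_complex R)) (inj_eq (@complexI R)) gt_eqF.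
exists x; apply: (posfam_scale_vectors sC) => d d0.
rewrite -/q (sesq_mxquad _ _ qs); apply: near_identity d0; first exact: gram_herm.
have sg i : s i ^+ 2 * g <= 1 by rewrite -(s2 i) ler_wpM2l ?sqr_ge0.
have ssg i j : s i * s j * g <= 1.
  have := sg i; have := sg j; have := sqr_ge0 (s i - s j); nra.
apply: (@le_lt_trans _ _ (\sum_(i < k) \sum_(j < k) (r * E / g)%:C)).
  apply: ler_sum => i _; apply: ler_sum => j _; rewrite mxE (sesqZl qs) (sesqZr qs).
  have -> : conjc ((s j)%:C) = (s j)%:C by exact: conjc_real.
  have -> : (s i)%:C * ((s j)%:C * q (x i) (x j)) - (i == j)%:R =
     (s i * s j)%:C * (q (x i) (x j) - (kap i)%:C * (i == j)%:R).
    case: eqVneq => [<-|_]; last by rewrite mulr0 !subr0 rmorphM /= mulrA.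
    have : (s i ^+ 2 * kap i)%:C = 1 by rewrite s2 rmorph1.
    rewrite !rmorphM /= => e; rewrite mulr1 mulrBr -e; ring.
  rewrite -rnormE lecR rnormM.
  have -> : rnorm (s i * s j)%:C = s i * s j.
    by rewrite /rnorm ger0_norm // ler0c mulr_ge0 // ltW.
  rewrite ler_pdivlMr //; have := qE i j; set Q := rnorm _ => hQ.
  have Q0 : 0 <= Q by apply: rnorm_ge0.
  have := ssg i j; have : 0 < s i * s j by rewrite mulr_gt0.
  move: (s i * s j) => ss ss0 ssg1.
  have : ss * g * Q <= 1 * Q by rewrite ler_wpM2r.
  lra.
rewrite !sumr_const !card_ord -mulrnA -rmorphMn /= -[1](rmorph1 (real_complex R)) ltcR.
rewrite -mulr_natr natrM -expr2 mulrAC ltr_pdivrMr // mul1r.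
have k0 : 0 <= k%:R ^+ 2 :> R by apply: sqr_ge0.
have rE0 : 0 < r * E by rewrite mulr_gt0.
have : 2 * W * (r * E) <= g by have -> : 2 * W * (r * E) = r * (2 * W * E) by ring.
rewrite /W; nra.
Qed.

End ApproximateEigenvectors.

Section RangeIndex.
Variable R : realType.
Local Notation C := R[i].
Local Notation "x %:C" := (real_complex _ x) : ring_scope.
Variable V : lmodType C.
Variable ip : V -> V -> C.
Hypothesis ipP : is_ip ip.
Let iph := ip_herm ipP.
Let ips := ip_sesq ipP.
Local Notation hn := (hnorm ip).

Lemma projected_scalar (T P : V -> V) mu x y : is_adjoint ip P P ->
  (forall x, P (T (P x)) = mu *: P x) -> P x = x -> P y = y -> ip (T x) y = mu * ip x y.
Proof.
move=> Pa PTP Px Py; rewrite -{1}Py -Pa -{1}Px PTP (sesqZl ips) Px //.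
Qed.

Lemma range_fixed (P : V -> V) x : (forall x, P (P x) = P x) -> range P x -> P x = x.
Proof. by move=> PP [z _ <-]. Qed.

Lemma rank_family (P : V -> V) k : orth_proj ip P -> proj_rank ip P (Some k) ->
  exists2 e : 'I_k -> V, orthonormal ip e & forall i, P (e i) = e i.
Proof.
move=> [_ _ PP] [e [eo Pe]]; exists e => // i; apply: range_fixed => //.
rewrite Pe; exists (fun j => (j == i)%:R).
rewrite (bigD1 i) //= big1 ?addr0 ?eqxx ?scale1r // => j /negPf ->.
by rewrite scale0r.
Qed.

Lemma haspos_of_range (T : V -> V) k (xi mu : C) (c : R) :
  higher_rank_nr ip T (Some k) mu -> c < complex.Re (xi * mu) ->
  haspos k (addform (hre (fun x y => xi * ip (T x) y)) (- c) ip).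
Proof.
move=> [P [Po Pr PTP]] cmu; have [e eo ef] := rank_family Po Pr.
have [[Pl _] Pa PP] := Po.
exists e => d d0; set u := lc d e.
have Pu : P u = u by rewrite /u linearf_lc //; congr lc; apply/funext => i; rewrite ef.
have u0 : u != 0 by apply: contraNneq d0 => /(orthonormal_indep ipP eo) ->.
rewrite /addform hre_quad (projected_scalar Pa PTP Pu Pu) (ip_hnorm ipP) mulrA.
have -> : complex.Re (xi * mu * (hn u ^+ 2)%:C) = complex.Re (xi * mu) * hn u ^+ 2.
  by case: (xi * mu) => a b /=; rewrite mulr0 subr0.
rewrite -rmorphM -rmorphD -[0](rmorph0 (real_complex R)) ltcR -mulrDl mulr_gt0 //.
  by rewrite subr_gt0.
by rewrite exprn_gt0 // hnorm_gt0.
Qed.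

Lemma range_unit_disc (T : V -> V) k mu : (0 < k)%N -> (forall x, hn (T x) <= hn x) ->
  higher_rank_nr ip T (Some k) mu -> rnorm mu <= 1.
Proof.
case: k => // k _ Tc [P [Po Pr PTP]]; have [e [e1 _] ef] := rank_family Po Pr.
have [_ Pa PP] := Po.
have := projected_scalar Pa PTP (ef ord0) (ef ord0); rewrite e1 mulr1 => <-.
have h1 : hn (e ord0) = 1 by rewrite /hnorm e1 sqrtr1.
apply: le_trans (cauchy_schwarz ipP _ _) _; rewrite h1 mulr1.
by apply: le_trans (Tc _) _; rewrite h1.
Qed.

Lemma haspos_mono (f : V -> V -> C) k (c d : R) : c <= d ->
  haspos k (addform f c ip) -> haspos k (addform f d ip).
Proof.
move=> cd [x xp]; exists x => u u0; apply: lt_le_trans (xp u u0) _.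
rewrite /addform lerD2l (ip_hnorm ipP) -!rmorphM lecR.
by rewrite ler_wpM2r ?sqr_ge0.
Qed.

Lemma orthonormal_posfam k (e : 'I_k -> V) : orthonormal ip e -> posfam ip e.
Proof.
move=> eo c c0; rewrite (ip_hnorm ipP) -[0](rmorph0 (real_complex R)) ltcR exprn_gt0 // hnorm_gt0 //.
by apply: contraNneq c0 => /(orthonormal_indep ipP eo) ->.
Qed.

Lemma infinite_orthonormal k : (exists e : nat -> V, orthonormal ip e) ->
  exists e : 'I_k -> V, orthonormal ip e.
Proof.
move=> [e [e1 e0]]; exists (fun i => e i); split=> // i j ij; apply: e0 => h.
by apply: ij; apply: val_inj.
Qed.

End RangeIndex.

(** * The inclusion for finite k *)

Section FiniteIndex.
Variable R : realType.
Local Notation C := R[i].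
Local Notation "x %:C" := (real_complex _ x) : ring_scope.
Variable V : lmodType C.
Variable ip : V -> V -> C.
Hypothesis ipP : is_ip ip.
Hypothesis compl : complete_ip ip.
Hypothesis infdim : exists e : nat -> V, orthonormal ip e.
Let iph := ip_herm ipP.
Let ips := ip_sesq ipP.
Local Notation hn := (hnorm ip).
Variables (A As : V -> V) (N k : nat) (lam : C).
Hypotheses (Al : linearf A) (Ac : forall x, hn (A x) <= hn x) (AAs : is_adjoint ip A As).
Hypothesis k0 : (0 < k)%N.
Local Notation K := (V * 'cV[C]_N)%type.
Local Notation ipK := (ip_sum ip (N:=N)).
Let ipKP := is_ip_sum ipP N.
Hypothesis U0 : exists U, unitary_dilation ip (N := N) A U.
Hypothesis lamP : forall U, unitary_dilation ip (N := N) A U ->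
  cclosure (higher_rank_nr ipK U (Some k)) lam.

Lemma Re_close (xi mu : C) (e : R) : rnorm xi = 1 -> `|lam - mu| < e%:C ->
  complex.Re (xi * lam) - e < complex.Re (xi * mu).
Proof.
move=> x1; rewrite -rnormE ltcR => h.
have ReB (u v : C) : complex.Re (u - v) = complex.Re u - complex.Re v by rewrite raddfB.
have := Re_le_rnorm (xi * (lam - mu)); rewrite mulrBr ReB -mulrBr rnormM x1 mul1r; lra.
Qed.

Lemma slack_direction (xi : C) (e : R) : rnorm xi = 1 -> 0 < e ->
  haspos k (addform (hre (fun x y => xi * ip (A x) y)) (- (complex.Re (xi * lam) - e)) ip).
Proof.
move=> x1 e0; set c0 := _ - e.
(* Below level -1 the form is positive everywhere, A being a contraction. *)
have [c0low|c0low] := ltP c0 (-1).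
  have [f fo] := infinite_orthonormal k infdim; exists f => d d0.
  have u0 := orthonormal_posfam ipP fo d0; set u := lc d f in u0 *.
  rewrite /addform hre_quad (ip_hnorm ipP) -rmorphM -rmorphD -[0](rmorph0 (real_complex R)) ltcR.
  have h1 : `|complex.Re (xi * ip (A u) u)| <= hn u ^+ 2.
    apply: le_trans (Re_abs_le_rnorm _) _; rewrite rnormM x1 mul1r.
    by apply: le_trans (cauchy_schwarz ipP _ _) _; rewrite expr2 ler_wpM2r ?hnorm_ge0.
  have h2 : 0 < hn u ^+ 2 by rewrite -ltcR -ip_hnorm.
  move: h1; rewrite ler_norml => /andP[h1 _]; nra.
have e2 : 0 < e / 2 by rewrite divr_gt0.
(* The range of a unitary lies in the unit disc and comes within e / 2 of lam. The levels c j are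
   then below 1, so the circle has points a j with Re (xi a j) = c j. *)
have c0up : c0 + e / 2 < 1.
  have [V0 V0d] := U0; have [mu muP mul] := lamP V0d e2.
  have [_ V0iso _] := unitary_dilation_iso V0d.
  have m1 : rnorm mu <= 1.
    apply: (range_unit_disc ipKP k0 _ muP) => x; by rewrite /hnorm V0iso.
  have := Re_close x1 mul; have := Re_le_rnorm (xi * mu); rewrite rnormM x1 mul1r /c0; lra.
(* k + 1 steps of length g fill e / 2, so the k levels c j lie strictly between c0 and c0 + e /
   2. *)
pose g := e / (2 * k.+1%:R).
have kp : 0 < k.+1%:R :> R by rewrite ltr0n.
have g0 : 0 < g by rewrite divr_gt0 // mulr_gt0.
have gk : g * k.+1%:R = e / 2 by rewrite /g; move: (k.+1%:R) kp => q q0; field; rewrite gt_eqF.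
pose c (j : 'I_k) := c0 + j.+1%:R * g.
have cE (j : 'I_k) : c0 + g <= c j /\ c j < c0 + e / 2.
  rewrite /c lerD2l ltrD2l -gk [g * _]mulrC; split.
    by rewrite -[leLHS]mul1r ler_pM2r // ler1n.
  by rewrite ltr_pM2r // ltr_nat ltnS.
have xx : xi * conjc xi = 1 by rewrite rnorm_sqr x1 expr1n rmorph1.
pose a (j : 'I_k) : C := conjc xi * Complex (c j) (Num.sqrt (1 - c j ^+ 2)).
have xa j : xi * a j = Complex (c j) (Num.sqrt (1 - c j ^+ 2)) by rewrite /a mulrA xx mul1r.
have cc j : 0 <= 1 - c j ^+ 2 by have [? ?] := cE j; nra.
have aa j : a j * conjc (a j) = 1.
  have e1 : xi * a j * conjc (xi * a j) = 1.
    rewrite xa; apply/eqP; rewrite eq_complex /=; apply/andP; split; apply/eqP; last by ring.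
    by rewrite mulrN opprK -!expr2 sqr_sqrtr // addrC subrK.
  by rewrite -[RHS]e1 [conjc (xi * _)]rmorphM /= mulrACA xx mul1r.
have [[j [m [m0 low]]]|approx] := pselect (exists j, exists m : R, 0 < m /\
    forall x, m * hn x <= hn (a j *: x - A x)); last first.
  apply: (haspos_of_approx_eigen ipP Al Ac AAs (a := a) (g := g)) => //.
  - apply/andP; split; lra.
  - by move=> j; rewrite xa /=; have [] := cE j.
  - move=> i j ij; have -> : rnorm (a i - a j) = rnorm (xi * (a i - a j)).
      by rewrite rnormM x1 mul1r.
    apply: le_trans (Re_abs_le_rnorm _); rewrite mulrBr !xa.
    have -> (p q u v : R) : complex.Re (Complex p u - Complex q v) = p - q by [].
    have lt_gap (p q : 'I_k) : (p < q)%N -> g <= c q - c p.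
      move=> pq; rewrite /c opprD addrACA subrr add0r -mulrBl -[leLHS]mul1r ler_pM2r //.
      have e3 : 1 + p.+1%:R = p.+2%:R :> R by rewrite -[p.+2]addn1 natrD addrC.
      by rewrite lerBrDr e3 ler_nat.
    have := ij; rewrite -(inj_eq val_inj) neq_ltn => /orP[] /lt_gap h.
      by rewrite distrC; apply: le_trans h (ler_norm _).
    by apply: le_trans h (ler_norm _).
  - move=> i m m0; apply: contrapT => no; apply: approx; exists i, m; split=> // x.
    by rewrite leNgt; apply/negP => h; apply: no; exists x.
have [V0 V0d] := U0.
have hP (i : 'I_N) : exists h, a j *: h - A h = (V0 (0, delta_mx i 0)).1.
  exact: (bounded_below_surj ipP compl Al Ac AAs (aa j) m0 low).
have [h hE] := choice hP.
have [U [G [Ud Gl UG]]] := eigen_dilation ipP V0d (aa j) hE.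
have [cj1 cj2] := cE j.
(* Approximating lam within this distance in the range of U gives a mu still beyond the level c j of
   the eigenvalue. *)
have cj : 0 < complex.Re (xi * lam) - c j by move: cj2; rewrite /c0; lra.
have [mu muP mul] := lamP Ud cj.
have := Re_close x1 mul; rewrite opprB addrC subrK => muc.
have := haspos_of_range ipKP muP muc.
move=> /(eigen_dilation_transfer ipP Ud (aa j) Gl UG).
rewrite xa => /(_ erefl); apply: haspos_mono => //.
rewrite lerN2; lra.
Qed.

Theorem finite_index_inclusion : cclosure (higher_rank_nr ip A (Some k)) lam.
Proof.
pose b x y := ip (A x) y - lam * ip x y.
have bs : sesq b by split=> a x y z; rewrite /b ?Al ?ips.1 ?ips.2; ring.
have B0 : 0 <= 1 + rnorm lam by rewrite addr_ge0 ?rnorm_ge0.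
have bB x y : rnorm (b x y) <= (1 + rnorm lam) * hn x * hn y.
  have : rnorm (b x y) <= rnorm (ip (A x) y) + rnorm (lam * ip x y).
    by rewrite -lecR rmorphD /= !rnormE /b ler_normB.
  have := cauchy_schwarz ipP (A x) y; have := cauchy_schwarz ipP x y.
  rewrite rnormM; have := Ac x; have := hnorm_ge0 ip x; have := hnorm_ge0 ip y.
  have := rnorm_ge0 lam; have := hnorm_ge0 ip (A x); nra.
have slack (z : C) (ga : R) : 0 < ga ->
    haspos k (addform (hre (fun x y => z * b x y)) ga ip).
  move=> g0; have [->|z0] := eqVneq z 0.
    have [f fo] := infinite_orthonormal k infdim; exists f => d d0.
    have u0 := orthonormal_posfam ipP fo d0.
    by rewrite /addform hre_quad mul0r add0r mulr_gt0 // ltcR.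
  have r0 : 0 < rnorm z by rewrite rnorm_gt0.
  pose xi := (rnorm z)^-1%:C * z.
  have x1 : rnorm xi = 1.
    rewrite rnormM; have -> : rnorm (rnorm z)^-1%:C = (rnorm z)^-1.
      by rewrite /rnorm ger0_norm // ler0c invr_ge0 ltW.
    by rewrite mulVf // gt_eqF.
  have zE : z = (rnorm z)%:C * xi by rewrite /xi mulrA -rmorphM mulfV ?gt_eqF // mul1r.
  pose e := ga / rnorm z; have e0 : 0 < e by rewrite divr_gt0.
  have gaE : ga = rnorm z * e by rewrite /e mulrC divfK // gt_eqF.
  apply: haspos_ext (haspos_scale r0 (slack_direction x1 e0)) => u v.
  rewrite /addform gaE !hreE /b (iph.2 u v) {2 3}zE.
  clear x1 zE; move: (rnorm z) (xi) (ip (A u) v) (ip (A v) u) (ip u v) => r [a1 a2] [b1 b2] [c1 c2] [d1 d2].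
  case: lam => l1 l2.
  by apply/eqP; rewrite eq_complex /=; apply/andP; split; apply/eqP; field.
move=> eps e0.
have [mu mue [y yi yb]] := scalar_compression ipP infdim bs B0 bB slack e0.
exists (lam + mu); last by rewrite opprD addNKr normrN -rnormE ltcR.
apply: (higher_rank_nr_family ipP Al yi) => i j.
have := congr1 (fun M : 'M_k => M i j) yb; rewrite !mxE /b => e.
by rewrite mulrDl -e addrC subrK.
Qed.

End FiniteIndex.

(** * Extension to a dilation, and compression in infinite rank *)

Section InfiniteRank.
Variable R : realType.
Local Notation C := R[i].
Local Notation "x %:C" := (real_complex _ x) : ring_scope.
Variable V : lmodType C.
Variable ip : V -> V -> C.
Hypothesis ipP : is_ip ip.
Let iph := ip_herm ipP.
Let ips := ip_sesq ipP.
Local Notation hn := (hnorm ip).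
Variables (A : V -> V) (N : nat).
Local Notation K := (V * 'cV[C]_N)%type.
Local Notation ipK := (ip_sum ip (N:=N)).
Let ipKP := is_ip_sum ipP N.
Let ipKh := ip_herm ipKP.
Let ipKs := ip_sesq ipKP.
Variable U : K -> K.
Hypothesis Ud : unitary_dilation ip A U.

Lemma higher_rank_nr_extend k lam : higher_rank_nr ip A k lam -> higher_rank_nr ipK U k lam.
Proof.
move=> [P [[Pb Pa PP] Pr PAP]]; have [Pl _] := Pb; have [_ _ UA] := Ud.
pose P' (w : K) : K := (P w.1, 0).
have P'l : linearf P'.
  by move=> a x y; rewrite /P' /= Pl; congr (_, _); rewrite /= scaler0 addr0.
have P'a : is_adjoint ipK P' P'.
  by move=> x y; rewrite /P' ip_sum_l [RHS]ipKh.2 ip_sum_l -iph.2 Pa.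
have P'P w : P' (P' w) = P' w by rewrite /P' /= PP.
exists P'; split.
- by split=> //; apply: projection_bounded.
- case: k Pr => [n [e [[e1 e0] Pe]]|[e [[e1 e0] Pe]]].
    exists (fun i => (e i, 0)); split.
      by split=> [i|i j ij]; rewrite ip_sum_l /= ?e1 ?e0.
    have sumE (c : 'I_n -> C) : \sum_(i < n) c i *: ((e i, 0) : K) = (\sum_(i < n) c i *: e i, 0).
      have -> : \sum_(i < n) c i *: ((e i, 0) : K) = lc (\row_i c i) (fun i => ((e i, 0) : K)).
        by apply: eq_bigr => i _; rewrite mxE.
      rewrite [LHS]surjective_pairing fst_lc snd_lc; congr (_, _).
        by apply: eq_bigr => i _; rewrite mxE.
      by rewrite big1 // => i _; rewrite scaler0.
    apply/seteqP; split=> w /=.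
      move=> [z _ <-]; have : range P (P z.1) by exists z.1.
      by rewrite Pe => -[c cE]; exists c; rewrite sumE -cE.
    move=> [c ->]; rewrite sumE; have : fspan e (\sum_(i < n) c i *: e i) by exists c.
    by rewrite -Pe => -[z _ zE]; exists (z, 0) => //; rewrite /P' /= zE.
  exists (fun i => (e i, 0)); split.
    by split=> [i|i j ij]; rewrite ip_sum_l /= ?e1 ?e0.
  by move=> i; have [z _ zE] := Pe i; exists (z, 0) => //; rewrite /P' /= zE.
- move=> w; rewrite /P' /= UA PAP; congr (_, _).
  by rewrite /= scaler0.
Qed.

Hypothesis compl : complete_ip ip.

(** Cut an orthonormal sequence of the range into blocks of N + 1 vectors: each block has a nonzero
    combination with vanishing component in the N-dimensional summand, and different blocks stay
    orthogonal. *)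
Lemma compressed_family (P : K -> K) : orth_proj ipK P -> proj_rank ipK P None ->
  exists f : nat -> V, orthonormal ip f /\ forall j, P (f j, 0) = (f j, 0).
Proof.
move=> [[Pl _] _ PP] [e [[e1 e0] eP]].
have Pe i : P (e i) = e i by apply: range_fixed.
pose blk j (i : 'I_N.+1) := e (j * N.+1 + i)%N.
have blko j : orthonormal ipK (blk j).
  split=> [i|i i' ii']; rewrite /blk ?e1 // e0 // => /addnI /val_inj; exact: ii'.
have ex j : exists y, [/\ P (y, 0) = (y, 0), ip y y = 1 & exists c, ((y, 0) : K) = lc c (blk j)].
  pose X : 'M[C]_(N.+1, N) := \matrix_(i, l) (blk j i).2 l 0.
  have /rowV0Pn [c /sub_kermxP cX c0] : kermx X != 0.
    rewrite kermx_eq0 /row_free; apply/negP => /eqP rX.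
    by have := rank_leq_col X; rewrite rX ltnn.
  set w := lc c (blk j).
  have w2 : w.2 = 0.
    rewrite snd_lc; apply/colP => l; rewrite summxE [RHS]mxE.
    have := congr1 (fun M : 'rV_N => M 0 l) cX; rewrite mxE [RHS]mxE => cXl; rewrite -[RHS]cXl.
    by apply: eq_bigr => i _; rewrite !mxE.
  have wE : w = (w.1, 0) by rewrite [LHS]surjective_pairing w2.
  have Pw : P w = w by rewrite /w linearf_lc //; congr lc; apply/funext => i; rewrite Pe.
  have w0 : w.1 != 0.
    apply: contraNneq c0 => w1; apply/eqP; apply: (orthonormal_indep ipKP (blko j)).
    by rewrite -/w wE w1.
  pose t := ((hn w.1)^-1)%:C; exists (t *: w.1); split.
  - have -> : (t *: w.1, 0) = t *: w :> K by rewrite wE; congr (_, _); rewrite /= scaler0.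
    by rewrite (linearfZ _ _ Pl) Pw.
  - exact: ip_normalize.
  - exists (t *: c); rewrite lcZl -/w wE; congr (_, _); by rewrite /= scaler0.
have [f fP] := choice ex; exists f; split; last by move=> j; case: (fP j).
split=> [j|i j ij]; first by case: (fP j).
have [_ _ [c cE]] := fP i; have [_ _ [d dE]] := fP j.
have -> : ip (f i) (f j) = ipK (f i, 0) (f j, 0) by rewrite ip_sum_l.
rewrite cE dE /lc (sesq_suml ipKs) big1 // => a _.
rewrite (sesq_sumr ipKs) big1 // => b _; rewrite (sesqZl ipKs) (sesqZr ipKs) e0 ?mulr0 //.
move=> /(congr1 (fun m => m %/ N.+1)%N); rewrite !divnMDl // !divn_small ?ltn_ord // !addn0.
exact: ij.
Qed.

(** M, the trace of the range of P on H, is closed because P is bounded, so completeness provides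
    the projection Q onto it. Pairing with vectors of M turns PUP = lam P into QAQ = lam Q. *)
Lemma infinite_rank_compress lam : higher_rank_nr ipK U None lam -> higher_rank_nr ip A None lam.
Proof.
move=> [P [Po Pr PUP]]; have [[Pl [B PB]] Pa PP] := Po; have [_ _ UA] := Ud.
pose M x := P (x, 0) = (x, 0).
have pairD a x y : ((a *: x + y, 0) : K) = a *: ((x, 0) : K) + (y, 0).
  by congr (_, _); rewrite /= scaler0 addr0.
have Ml a x y : M x -> M y -> M (a *: x + y).
  by rewrite /M => Mx My; rewrite pairD Pl Mx My.
have M0 : M 0 by rewrite /M; apply: (linearf0 Pl).
have hK x : hnorm ipK (x, 0) = hn x by rewrite /hnorm ip_sum_l.
have Mc x : (forall eps : R, 0 < eps -> exists2 m, M m & hn (x - m) < eps) -> M x.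
  move=> xl; apply/eqP; rewrite -subr_eq0; apply/eqP/(hnorm_eq0 ipKP)/eqP.
  rewrite eq_le hnorm_ge0 andbT; apply: le_of_small => eps e0; rewrite add0r.
  have B1 : 0 < `|B| + 1 by rewrite ltr_wpDl.
  have [m Mm xm] := xl _ (divr_gt0 e0 B1).
  have xmE : ((x, 0) : K) = ((x - m, 0) : K) + (m, 0).
    by congr (_, _); rewrite /= ?subrK ?addr0.
  have -> : P (x, 0) - (x, 0) = P (x - m, 0) + - ((x - m, 0) : K).
    by rewrite xmE (linearfD _ _ Pl) Mm opprD addrACA subrr addr0.
  apply: le_trans (ler_hnormD ipKP _ _) _; rewrite (hnormN ipKP) hK.
  have := PB (x - m, 0); rewrite hK; have := ler_norm B; have := hnorm_ge0 ip (x - m).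
  move: xm; rewrite ltr_pdivlMr //; nra.
have [Q QP] := choice (fun x => let: ex_intro2 p h1 h2 := projection_exists ipP compl M0 Ml Mc x in
  ex_intro (fun p => M p /\ forall m, M m -> ip (x - p) m = 0) p (conj h1 h2)).
have QM x : M (Q x) by case: (QP x).
have Qo x m : M m -> ip x m = ip (Q x) m.
  move=> Mm; have [_ /(_ m Mm)] := QP x; rewrite (sesqBl ips) => /eqP.
  by rewrite subr_eq0 => /eqP.
have Muniq x y : M x -> M y -> (forall m, M m -> ip x m = ip y m) -> x = y.
  move=> Mx My xy; apply/eqP; rewrite -subr_eq0; apply/eqP; case: (ipP) => _ _; apply.
  have MB : M (x - y) by rewrite addrC -scaleN1r; apply: Ml.
  by rewrite (sesqBl ips) xy // subrr.
have Ql : linearf Q.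
  move=> a x y; apply: Muniq => // [|m Mm]; first exact: Ml.
  by rewrite -Qo // !ips.1 (Qo x m) // (Qo y m).
have Qid x : M x -> Q x = x by move=> Mx; apply: Muniq => // m Mm; rewrite -Qo.
have Qa : is_adjoint ip Q Q.
  have aux x y : ip (Q x) y = ip (Q x) (Q y) by rewrite [LHS]iph.2 Qo // -iph.2.
  by move=> x y; rewrite aux -Qo.
have QQ x : Q (Q x) = Q x by apply: Qid.
exists Q; split.
- by split=> //; apply: projection_bounded.
- have [f [fo fP]] := compressed_family Po Pr; exists f; split=> // j.
  by exists (f j) => //; apply: Qid; apply: fP.
- move=> x; apply: Muniq => // [|m Mm].
    by have := Ml lam _ _ (QM x) M0; rewrite addr0.
  rewrite -Qo // (sesqZl ips) -UA.
  have := projected_scalar ipKP Pa PUP (QM x) Mm; rewrite !ip_sum_l /= => <-.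
  by rewrite [RHS]ipKh.2 ip_sum_l -iph.2.
Qed.

End InfiniteRank.

Local Open Scope classical_set_scope.

Theorem theorem1p3 (R : realType) (V : lmodType R[i]) (ip : V -> V -> R[i])
  (hH : is_sep_inf_hilbert ip) (A : V -> V) (Astar : V -> V) (N : nat)
  (hA : contraction ip A) (hAstar : is_adjoint ip A Astar)
  (hdA : defect_number_eq ip A N) (hdAstar : defect_number_eq ip Astar N)
  (k : option nat) (hk : if k is Some k' then (1 <= k')%N else true) :
  cclosure (higher_rank_nr ip A k) =
  \bigcap_(U in [set U | unitary_dilation ip A U])
     cclosure (higher_rank_nr (ip_sum ip (N:=N)) U k).
Proof.
case: hH => ipl ipc [ip0 ipd] [compl _] infdim.
have ipP : is_ip ip by [].
have [[Al _] Ac] := hA.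
have U0 := unitary_dilation_exists ipP Al hAstar hdA hdAstar.
apply/seteqP; split=> [lam lamA U Ud eps e0|lam lamU].
  have [mu muA mul] := lamA eps e0; exists mu => //.
  exact: higher_rank_nr_extend muA.
case: k hk lamU => [k|] hk lamU.
  by apply: (finite_index_inclusion ipP compl infdim Al Ac hAstar hk U0) => U Ud; apply: lamU.
have [U Ud] := U0; move=> eps e0; have [mu muU mul] := lamU U Ud eps e0.
by exists mu => //; apply: infinite_rank_compress muU.
Qed.
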